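(* Let $H$ be a Hilbert space and let $Q\in\mathbb{B}(H)$ be a non-projection idempotent with $\|Q\|=r$, and let $D\in\mathbb{B}(H_5)$ be the operator in the canonical decomposition of $Q$ described in the context. Then $Q$ is a universal $r$-idempotent if and only if $\sigma(D)=[1,\|D\|]$.
   Context: $H$ is a non-zero complex Hilbert space and $\mathbb{B}(H)$ the bounded operators on it. An idempotent satisfies $Q^2=Q$; a projection is a self-adjoint idempotent; a non-projection idempotent is an idempotent that is not a projection (it has norm $>1$). $\mathcal{R},\mathcal{N}$ denote range and null space, $P_M$ the orthogonal projection onto a closed subspace $M$, $\sigma(\cdot)$ the spectrum, $|T|=(T^*T)^{1/2}$, $T^\dag$ the Moore-Penrose inverse. $C^*\{Q\}$ is the $C^*$-algebra generated by $Q$ alone (not assumed to contain a unit of the ambient algebra). Universal $r$-idempotent ($r>1$): a non-projection idempotent $Q$ in a $C^*$-algebra such that $\|Q\|=r$ and for every non-projection idempotent $Q'$ in any $C^*$-algebra with $\|Q'\|\le r$ there is a $C^*$-algebra homomorphism ($*$-homomorphism) $\pi:C^*\{Q\}\to C^*\{Q'\}$ with $\pi(Q)=Q'$. Matched projection: $m(Q)=\frac12(|Q^*|+Q^* )|Q^*|^\dag(|Q^*|+I)^{-1}(|Q^*|+Q)$, which is a projection. Canonical decomposition of a non-projection idempotent $Q$: put $H_1=\mathcal{R}(m(Q))\cap\mathcal{R}(Q)$, $H_4=\mathcal{N}(m(Q))\cap\mathcal{N}(Q)$, $H_5=\overline{\mathcal{R}(m(Q)Q(I-m(Q)))}$, $H_6=\overline{\mathcal{R}((I-m(Q))Qm(Q))}$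 (some of $H_1,H_4$ may be zero). These are mutually orthogonal with $m(Q)=P_{H_1}+P_{H_5}$ and $I-m(Q)=P_{H_4}+P_{H_6}$, and $U_{m(Q),Q}:H\to H_1\oplus H_4\oplus H_5\oplus H_6$, $x\mapsto(P_{H_1}x,P_{H_4}x,P_{H_5}x,P_{H_6}x)^T$, is unitary. It is known that there are a unitary $U\in\mathbb{B}(H_5,H_6)$ and an operator $D\in\mathbb{B}(H_5)$ with $D\ge I_{H_5}$ and $\mathcal{N}(D-I_{H_5})=\{0\}$ such that, with $\ell(D)=(D(D-I_{H_5}))^{1/2}$, $$U_{m(Q),Q}\,Q\,U_{m(Q),Q}^*=I_{H_1}\oplus 0_{H_4}\oplus\begin{pmatrix}D&-\ell(D)U^*\\ U\ell(D)&U(I_{H_5}-D)U^*\end{pmatrix}.$$ Set $V_Q=(I_{H_1}\oplus I_{H_4}\oplus I_{H_5}\oplus U^* )U_{m(Q),Q}$. Then $$m(Q)=V_Q^*\big(I_{H_1}\oplus0_{H_4}\oplus I_{H_5}\oplus0_{H_5}\big)V_Q,\qquad Q=V_Q^*\big(I_{H_1}\oplus0_{H_4}\oplus\widetilde{Q}\big)V_Q,\qquad \widetilde{Q}=\begin{pmatrix}D&-\ell(D)\\ \ell(D)&I_{H_5}-D\end{pmatrix}.$$ *)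

(* Defs.v *)
From HB Require Import structures.
From mathcomp Require Import all_boot all_order all_algebra.
From mathcomp Require Import sesquilinear ring lra.
From mathcomp Require Import boolp classical_sets reals topology normedtype.
From mathcomp Require Import complex.

Set Implicit Arguments.
Unset Strict Implicit.
Unset Printing Implicit Defensive.

Import Order.TTheory GRing.Theory Num.Theory.
Import numFieldNormedType.Exports.

Local Open Scope classical_set_scope.
Local Open Scope ring_scope.
Local Open Scope complex_scope.

Local Notation Re := complex.Re.

(* The inner product is linear in its first argument; the norm it induces is
   the norm of the underlying Banach space. *)
HB.mixin Record CompleteNormedModule_isHilbert (R : realType) H
    & CompleteNormedModule R[i] H := {
  inner : {dot H for @Num.conj R[i]};
  inner_normE : forall x : H, inner x x = `|x| ^+ 2
}.

#[short(type="hilbertType")]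
HB.structure Definition Hilbert (R : realType) :=
  {H of CompleteNormedModule_isHilbert R H & CompleteNormedModule R[i] H}.

(* Not assumed unital, hence the multiplication is not a MathComp ring
   multiplication. *)
HB.mixin Record CompleteNormedModule_isCStarAlgebra (R : realType) A
    & CompleteNormedModule R[i] A := {
  smul : A -> A -> A;
  star : A -> A;
  smulA : associative smul;
  smulPl : forall (a : R[i]) x y z,
    smul (a *: x + y) z = a *: smul x z + smul y z;
  smulPr : forall (a : R[i]) x y z,
    smul x (a *: y + z) = a *: smul x y + smul x z;
  starK : involutive star;
  starP : forall (a : R[i]) x y,
    star (a *: x + y) = Num.conj a *: star x + star y;
  starM : forall x y, star (smul x y) = smul (star y) (star x);
  ler_normM : forall x y, `|smul x y| <= `|x| * `|y|;
  norm_starM : forall x, `|smul (star x) x| = `|x| ^+ 2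
}.

#[short(type="cstarAlgType")]
HB.structure Definition CStarAlgebra (R : realType) :=
  {A of CompleteNormedModule_isCStarAlgebra R A & CompleteNormedModule R[i] A}.

Section CStarNotions.
Variable R : realType.
Implicit Types A B : cstarAlgType R.

Definition idempotent_elt A (q : A) : Prop := smul q q = q.

Definition projection_elt A (q : A) : Prop := idempotent_elt q /\ star q = q.

Definition nonprojection_idempotent A (q : A) : Prop :=
  idempotent_elt q /\ ~ projection_elt q.

Definition cstar_subalgebra A (S : set A) : Prop :=
  [/\ closed S, S 0,
      forall (a : R[i]) x y, S x -> S y -> S (a *: x + y),
      forall x y, S x -> S y -> S (smul x y) &
      forall x, S x -> S (star x)].

Definition cstar_gen A (q : A) : set A := smallest (@cstar_subalgebra A) [set q].

(* A *-homomorphism between the C*-subalgebras S and T is represented by a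
   function on the ambient algebra; only its restriction to S matters. *)
Definition star_hom A B (S : set A) (T : set B) (pi : A -> B) : Prop :=
  [/\ forall x, S x -> T (pi x),
      forall (a : R[i]) x y, S x -> S y -> pi (a *: x + y) = a *: pi x + pi y,
      forall x y, S x -> S y -> pi (smul x y) = smul (pi x) (pi y) &
      forall x, S x -> pi (star x) = star (pi x)].

Definition universal_idempotent (r : R) A (q : A) : Prop :=
  [/\ 1 < r, nonprojection_idempotent q, `|q| = r%:C &
      forall (B : cstarAlgType R) (q' : B),
        nonprojection_idempotent q' -> `|q'| <= r%:C ->
        exists2 pi : A -> B,
          star_hom (cstar_gen q) (cstar_gen q') pi & pi q = q'].

End CStarNotions.

Section RePart.
Variable R : realType.
Implicit Types z : R[i].

Lemma cge0_ReK z : 0 <= z -> (Re z)%:C = z.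
Proof. by case: z => a b; rewrite lecE /= => /andP[/eqP -> _]. Qed.

Lemma cReD z1 z2 : Re (z1 + z2) = Re z1 + Re z2.
Proof. by case: z1; case: z2. Qed.

Lemma cReZ (t : R) z : Re (t%:C * z) = t * Re z.
Proof. by case: z => a b /=; rewrite mul0r subr0. Qed.

Lemma conj_complexE z : Num.conj z = (z^*)%C.
Proof.
have [->|z0] := eqVneq z 0; first by rewrite conjC0; apply/eqP; rewrite eq_complex /= oppr0 !eqxx.
apply: (mulfI z0); rewrite -normCK.
by case: z {z0} => a b; rewrite sqr_normc.
Qed.

Lemma complexRe_conj z : Re (Num.conj z) = Re z.
Proof. by rewrite conj_complexE; case: z. Qed.

Lemma conj_real (t : R) : Num.conj (t%:C) = t%:C :> R[i].
Proof. by rewrite conj_complexE /= oppr0. Qed.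

Lemma cRe_le_norm z : Re z <= Re `|z|.
Proof.
case: z => a b /=; apply: (le_trans (ler_norm a)).
by rewrite -sqrtr_sqr ler_wsqrtr// lerDl sqr_ge0.
Qed.

Lemma cRe_le z1 z2 : z1 <= z2 -> Re z1 <= Re z2.
Proof. by rewrite lecE => /andP[]. Qed.

End RePart.

Section HilbertTheory.
Variables (R : realType) (H : hilbertType R).
Implicit Types x y z : H.
Local Notation "''[' x , y ]" := (@inner R H x y).

Lemma innerPl (a : R[i]) x y z : '[a *: x + y, z] = a * '[x, z] + '[y, z].
Proof. by rewrite linearDl linearZl_LR. Qed.
Lemma innerPr (a : R[i]) x y z : '[x, a *: y + z] = Num.conj a * '[x, y] + '[x, z].
Proof. by rewrite linearD linearZ. Qed.
Lemma innerC x y : '[x, y] = Num.conj '[y, x].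
Proof. by rewrite (hermitian_subproof x y) expr0 mul1r. Qed.
End HilbertTheory.

Section Operators.
Variables (R : realType) (H K : hilbertType R).

Record bop := Bop {
  bop_fun :> H -> K;
  bop_linear : linear bop_fun;
  bop_bounded : exists M : R[i], forall x, `|bop_fun x| <= M * `|x|
}.

Implicit Types S T : bop.
HB.instance Definition _ := gen_eqMixin bop.
HB.instance Definition _ := gen_choiceMixin bop.
HB.instance Definition _ (T : bop) :=
  GRing.isLinear.Build R[i] H K *:%R (bop_fun T) (bop_linear T).

Lemma bopP (S T : bop) : (forall x, S x = T x) -> S = T.
Proof.
case: S T => [f fl fb] [g gl gb] /= /funext fg; move: fl fb; rewrite fg => fl fb.
by rewrite (Prop_irrelevance fl gl) (Prop_irrelevance fb gb).
Qed.

Lemma bop_boundedP (T : bop) :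
  exists2 M : R[i], 0 <= M & forall x, `|T x| <= M * `|x|.
Proof.
have [M TM] := bop_bounded T; exists `|M| => // x.
have Mx0 : 0 <= M * `|x| by apply: le_trans (TM x).
by rewrite -[X in _ * X]normr_id -normrM ger0_norm.
Qed.

Definition opnormR (T : bop) : R := sup [set Re `|T x| | x in [set x | `|x| <= 1]].

Let has_sup_opnorm (T : bop) : has_sup [set Re `|T x| | x in [set x | `|x| <= 1]].
Proof.
split; first by exists (Re `|T 0|), 0 => //=; rewrite normr0.
have [M M0 TM] := bop_boundedP T.
exists (Re M) => _ /= [x x1 <-]; apply: cRe_le; apply: le_trans (TM x) _.
by rewrite ler_piMr.
Qed.

Lemma opnormR_ge0 T : 0 <= opnormR T.
Proof.
apply: sup_upper_bound => //; exists 0; first by rewrite /= normr0.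
by rewrite linear0 normr0.
Qed.

Definition opnorm (T : bop) : R[i] := (opnormR T)%:C.

Lemma opnorm_ge0 T : 0 <= opnorm T.
Proof. by rewrite ler0c opnormR_ge0. Qed.

Lemma opnormP T x : `|T x| <= opnorm T * `|x|.
Proof.
have [->|x0] := eqVneq x 0; first by rewrite linear0 !normr0 mulr0.
have nx0 : 0 < `|x| by rewrite normr_gt0.
rewrite -ler_pdivrMr//.
have -> : `|T x| / `|x| = `|T (`|x|^-1 *: x)|.
  by rewrite linearZ/= normrZ mulrC normfV normr_id.
rewrite -[`|_|]cge0_ReK// lecR; apply: sup_upper_bound => //.
exists (`|x|^-1 *: x) => //=.
by rewrite normfZV.
Qed.

Lemma opnorm_le T (M : R[i]) : 0 <= M -> (forall x, `|T x| <= M * `|x|) -> opnorm T <= M.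
Proof.
move=> M0 TM; rewrite -[M]cge0_ReK// lecR; apply: ge_sup.
  by exists (Re `|T 0|), 0 => //=; rewrite normr0.
move=> _ /= [x x1 <-]; apply: cRe_le; apply: le_trans (TM x) _.
by rewrite ler_piMr.
Qed.

Program Definition bop0 := @Bop (fun=> 0) _ _.
Next Obligation. by move=> a x y; rewrite scaler0 addr0. Qed.
Next Obligation. by exists 0 => x; rewrite normr0 mul0r. Qed.

Program Definition bopD (S T : bop) := @Bop (fun x => S x + T x) _ _.
Next Obligation.
by move=> S T a x y; rewrite !linearP scalerDr !addrA -!(addrA (a *: S x)) (addrC (S y)).
Qed.
Next Obligation.
move=> S T; exists (opnorm S + opnorm T) => x.
by rewrite mulrDl (le_trans (ler_normD _ _))// lerD ?opnormP.
Qed.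

Program Definition bopZ (a : R[i]) (T : bop) := @Bop (fun x => a *: T x) _ _.
Next Obligation.
by move=> a T b x y; rewrite linearP scalerDr !scalerA mulrC.
Qed.
Next Obligation.
move=> a T; exists (`|a| * opnorm T) => x.
by rewrite normrZ -mulrA ler_wpM2l ?opnormP.
Qed.

Definition bopN (T : bop) := bopZ (-1) T.

Fact bopA : associative bopD.
Proof. by move=> S T U; apply: bopP => x /=; rewrite addrA. Qed.
Fact bopC : commutative bopD.
Proof. by move=> S T; apply: bopP => x /=; rewrite addrC. Qed.
Fact bop0D : left_id bop0 bopD.
Proof. by move=> T; apply: bopP => x /=; rewrite add0r. Qed.
Fact bopND : left_inverse bop0 bopN bopD.
Proof. by move=> T; apply: bopP => x /=; rewrite scaleN1r addNr. Qed.
HB.instance Definition _ := GRing.isZmodule.Build bop bopA bopC bop0D bopND.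

Fact bopZA a b T : bopZ a (bopZ b T) = bopZ (a * b) T.
Proof. by apply: bopP => x /=; rewrite scalerA. Qed.
Fact bop1Z : left_id 1 bopZ.
Proof. by move=> T; apply: bopP => x /=; rewrite scale1r. Qed.
Fact bopZDr : right_distributive bopZ +%R.
Proof. by move=> a S T; apply: bopP => x /=; rewrite scalerDr. Qed.
Fact bopZDl T : {morph bopZ^~ T : a b / a + b}.
Proof. by move=> a b; apply: bopP => x /=; rewrite scalerDl. Qed.
HB.instance Definition _ :=
  GRing.Zmodule_isLmodule.Build R[i] bop bopZA bop1Z bopZDr bopZDl.

Lemma bopDE (S T : bop) x : (S + T) x = S x + T x. Proof. by []. Qed.
Lemma bopZE a (T : bop) x : (a *: T) x = a *: T x. Proof. by []. Qed.
Lemma bopNE (T : bop) x : (- T) x = - T x. Proof. exact: scaleN1r. Qed.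
Lemma bopBE (S T : bop) x : (S - T) x = S x - T x. Proof. by rewrite bopDE bopNE. Qed.

Fact opnormD (S T : bop) : opnorm (S + T) <= opnorm S + opnorm T.
Proof.
apply: opnorm_le => [|x]; first by rewrite addr_ge0 ?opnorm_ge0.
by rewrite mulrDl (le_trans (ler_normD _ _))// lerD ?opnormP.
Qed.
Fact opnormZ_le a (T : bop) : opnorm (a *: T) <= `|a| * opnorm T.
Proof.
apply: opnorm_le => [|x]; first by rewrite mulr_ge0 ?opnorm_ge0.
by rewrite bopZE normrZ -mulrA ler_wpM2l ?opnormP.
Qed.
Fact opnormZ a (T : bop) : opnorm (a *: T) = `|a| * opnorm T.
Proof.
apply/eqP; rewrite eq_le opnormZ_le /=.
have [->|a0] := eqVneq a 0; first by rewrite normr0 mul0r opnorm_ge0.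
rewrite -ler_pdivlMl ?normr_gt0// -normfV.
by apply: le_trans (opnormZ_le _ _); rewrite scalerA mulVf// scale1r.
Qed.
Fact opnorm_eq0 (T : bop) : opnorm T = 0 -> T = 0.
Proof.
move=> T0; apply: bopP => x /=; apply/eqP; rewrite -normr_le0.
by have := opnormP T x; rewrite T0 mul0r.
Qed.
HB.instance Definition _ :=
  Lmodule_isNormed.Build R[i] bop opnormD opnormZ opnorm_eq0.

Lemma bop_normE (T : bop) : `|T| = opnorm T. Proof. by []. Qed.

Lemma bop_normP (T : bop) x : `|T x| <= `|T| * `|x|. Proof. exact: opnormP. Qed.

Lemma normed_small_eq0 (V : normedModType R[i]) (x : V) (c : R[i]) :
  0 <= c -> (forall e : R[i], 0 < e -> `|x| <= e * c) -> x = 0.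
Proof.
move=> c0 xe; apply/eqP; rewrite -normr_le0; apply/ler_addgt0Pr => e e0.
rewrite add0r; have c1 : 0 < c + 1 by rewrite ltr_wpDl.
apply: le_trans (xe (e / (c + 1)) _) _; first by rewrite divr_gt0.
by rewrite -mulrA ler_piMr// ?(ltW e0)// mulrC ler_pdivrMr// mul1r lerDl.
Qed.

Lemma bop_complete (F : set_system bop) : ProperFilter F -> cauchy F -> cvg F.
Proof.
move=> FF /cauchyP Fc.
have Fx x : cvg ((fun T : bop => T x) @ F).
  apply: cauchy_cvg; apply: cauchy_exP => e e0.
  have x1 : 0 < `|x| + 1 by rewrite ltr_wpDl.
  have [S FS] := Fc (e / (`|x| + 1)) (divr_gt0 e0 x1).
  exists (S x); rewrite nbhs_simpl /=; apply: filterS FS => T.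
  rewrite -!ball_normE /= -bopBE => ST.
  apply: (le_lt_trans (bop_normP _ _)).
  apply: (@le_lt_trans _ _ (`|S - T| * (`|x| + 1))).
    by rewrite ler_wpM2l// lerDl.
  by rewrite -ltr_pdivlMr.
pose L x := lim ((fun T : bop => T x) @ F).
have L_S (e : R[i]) : 0 < e -> exists2 S : bop, F (ball S e) & forall x, `|L x - S x| <= e * `|x|.
  move=> e0; have [S FS] := Fc e e0; exists S => // x.
  apply/ler_addgt0Pr => d d0.
  have /cvgrPdist_lt /(_ d d0) Fd := Fx x.
  near F => T.
  have -> : L x - S x = (L x - T x) + (T x - S x) by rewrite addrA subrK.
  apply: le_trans (ler_normD _ _) _; rewrite addrC; apply: lerD.
    rewrite -bopBE; apply: le_trans (bop_normP _ _) _; apply: ler_wpM2r => //.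
    rewrite distrC; apply: ltW; have : ball S e T by near: T.
    by rewrite -ball_normE.
  by apply: ltW; near: T.
have Llin : linear L.
  move=> a x y; apply/eqP; rewrite -subr_eq0; apply/eqP.
  apply: (@normed_small_eq0 _ _ (`|a *: x + y| + `|a| * `|x| + `|y|)).
    by rewrite !addr_ge0// mulr_ge0.
  move=> e e0; have [S _ LS] := L_S e e0.
  have -> : L (a *: x + y) - (a *: L x + L y) =
      (L (a *: x + y) - S (a *: x + y)) - a *: (L x - S x) - (L y - S y).
    rewrite (linearP S) scalerBr -[RHS]addrA -[in RHS](opprD (a *: L x - a *: S x)) addrACA -opprD.
    by rewrite opprB addrA subrK.
  rewrite !mulrDr; apply: le_trans (ler_normB _ _) _; apply: lerD (LS _).
  apply: le_trans (ler_normB _ _) _; apply: lerD (LS _) _.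
  by rewrite normrZ mulrCA ler_wpM2l.
have Lbd : exists M : R[i], forall x, `|L x| <= M * `|x|.
  have [S _ LS] := L_S 1 ltr01; exists (1 + `|S|) => x.
  rewrite -[L x](subrK (S x)) mulrDl; apply: le_trans (ler_normD _ _) _.
  exact: lerD (LS _) (bop_normP _ _).
apply/cvg_ex; exists (Bop Llin Lbd).
apply/cvgrPdist_le => e e0.
have e20 : 0 < e / 2 by rewrite divr_gt0.
have [S FS LS] := L_S _ e20.
apply: filterS FS => T; rewrite -ball_normE /= => /ltW ST.
have -> : Bop Llin Lbd - T = (Bop Llin Lbd - S) + (S - T) by rewrite addrA subrK.
apply: le_trans (ler_normD _ _) _; rewrite [e in _ <= e]splitr; apply: lerD => //.
apply: opnorm_le; first exact: ltW.
by move=> x; rewrite bopBE; exact: LS.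
Unshelve. all: by end_near. Qed.

HB.instance Definition _ := Uniform_isComplete.Build bop bop_complete.

End Operators.

Section InnerTheory.
Variables (R : realType) (H : hilbertType R).
Implicit Types x y z : H.
Local Notation "''[' x , y ]" := (@inner R H x y).
Local Notation n x := (Re `|x|).

Lemma hilbert_normK x : (n x)%:C = `|x|. Proof. exact: cge0_ReK. Qed.
Lemma hilbert_n_ge0 x : 0 <= n x. Proof. by rewrite -ler0c hilbert_normK. Qed.
Lemma inner_nE x : Re '[x, x] = n x ^+ 2.
Proof. by rewrite inner_normE -hilbert_normK -rmorphXn. Qed.
Lemma hilbert_n_triangle x y : n (x + y) <= n x + n y.
Proof. by rewrite -cReD; apply: cRe_le; apply: ler_normD. Qed.

Lemma innerDl x y z : '[x + y, z] = '[x, z] + '[y, z].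
Proof. by have := innerPl 1 x y z; rewrite scale1r mul1r. Qed.
Lemma innerDr x y z : '[z, x + y] = '[z, x] + '[z, y].
Proof. by have := innerPr 1 z x y; rewrite scale1r rmorph1 mul1r. Qed.
Lemma inner0l z : '[0, z] = 0.
Proof. by apply: (addrI '[0, z]); rewrite -innerDl !addr0. Qed.
Lemma inner0r z : '[z, 0] = 0.
Proof. by rewrite innerC inner0l rmorph0. Qed.
Lemma innerZl a x z : '[a *: x, z] = a * '[x, z].
Proof. by have := innerPl a x 0 z; rewrite inner0l !addr0. Qed.
Lemma innerZr a x z : '[z, a *: x] = Num.conj a * '[z, x].
Proof. by have := innerPr a z x 0; rewrite inner0r !addr0. Qed.
Lemma innerBl x y z : '[x - y, z] = '[x, z] - '[y, z].
Proof. by rewrite -scaleN1r innerDl innerZl mulN1r. Qed.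
Lemma innerBr x y z : '[z, x - y] = '[z, x] - '[z, y].
Proof. by rewrite -scaleN1r innerDr innerZr rmorphN1 mulN1r. Qed.

Lemma innerI x y : (forall z, '[z, x] = '[z, y]) -> x = y.
Proof.
move=> xy; apply/eqP; rewrite -subr_eq0 -normr_eq0 -sqrf_eq0 -inner_normE.
by rewrite innerBr xy subrr.
Qed.

Lemma hilbert_n_expand x y (t : R) :
  n (x + t%:C *: y) ^+ 2 = n x ^+ 2 + 2 * t * Re '[x, y] + t ^+ 2 * n y ^+ 2.
Proof.
rewrite -!inner_nE !innerDl !innerDr !innerZl !innerZr conj_real !cReD !cReZ.
by rewrite (innerC y x) complexRe_conj; ring.
Qed.

Lemma Re_inner_le x y : Re '[x, y] <= n x * n y.
Proof.
have [/eqP ny0|ny0] := eqVneq (n y) 0.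
  have -> : y = 0 by apply/eqP; rewrite -normr_eq0 -hilbert_normK (eqP ny0).
  by rewrite inner0r normr0 mulr0.
have [/eqP nx0|nx0] := eqVneq (n x) 0.
  have -> : x = 0 by apply/eqP; rewrite -normr_eq0 -hilbert_normK (eqP nx0).
  by rewrite inner0l normr0 mul0r.
have ny : 0 < n y by rewrite lt_def ny0 hilbert_n_ge0.
have nx : 0 < n x by rewrite lt_def nx0 hilbert_n_ge0.
have := hilbert_n_expand x y (- (n x / n y)).
have := sqr_ge0 (n (x + (- (n x / n y))%:C *: y)) => /[swap] ->.
set t := n x / n y; have tE : n x = t * n y by rewrite divfK.
have t0 : 0 < t by rewrite divr_gt0.
rewrite {1}tE sqrrN exprMn => h.
rewrite tE -(ler_pM2l t0); nra.
Qed.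

Lemma inner_CauchySchwarz x y : `|'[x, y]| <= `|x| * `|y|.
Proof.
have [->|d0] := eqVneq '[x, y] 0; first by rewrite normr0 mulr_ge0.
pose u := Num.conj '[x, y] / `|'[x, y]|.
have nd0 : `|'[x, y]| != 0 by rewrite normr_eq0.
have u1 : `|u| = 1 by rewrite normf_div norm_conjC normr_id divff.
have uE : '[u *: x, y] = `|'[x, y]|.
  by rewrite innerZl /u mulrAC [_ * '[x, y]]mulrC -normCK expr2 mulfK.
have := Re_inner_le (u *: x) y; rewrite uE normrZ u1 mul1r => h.
by rewrite -[`|'[_, _]|]cge0_ReK// -(hilbert_normK x) -(hilbert_normK y) -rmorphM lecR.
Qed.

Section Riesz.
Variables (f : H -> R[i]) (m : R).
Hypothesis f_lin : forall a x y, f (a *: x + y) = a * f x + f y.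
Hypothesis f_bd : forall x, `|f x| <= m%:C * `|x|.

Let p x := Re (f x).
Let J x := n x ^+ 2 - 2 * p x.

Let fD x y : f (x + y) = f x + f y.
Proof. by have := f_lin 1 x y; rewrite scale1r mul1r. Qed.
Let f0 : f 0 = 0.
Proof. by apply: (addrI (f 0)); rewrite -fD !addr0. Qed.
Let fZ a x : f (a *: x) = a * f x.
Proof. by have := f_lin a x 0; rewrite f0 !addr0. Qed.
Let pD x y : p (x + y) = p x + p y. Proof. by rewrite /p fD cReD. Qed.
Let pZ (t : R) x : p (t%:C *: x) = t * p x. Proof. by rewrite /p fZ cReZ. Qed.

Let p_le x : p x <= m * n x.
Proof.
apply: le_trans (cRe_le_norm _) _; have := cRe_le (f_bd x).
by rewrite cReZ.
Qed.

Let hinf : has_inf (range J).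
Proof.
split; first by exists (J 0), 0.
by exists (- m ^+ 2) => _ [x _ <-]; rewrite /J; have := p_le x; have := sqr_ge0 (n x - m); lra.
Qed.
Let I := inf (range J).

Let I_le x : I <= J x.
Proof. by apply: inf_lbound; [case: hinf|exists x]. Qed.

Let I_adh (e : R) : 0 < e -> exists x, J x < I + e.
Proof. by move=> e0; have [_ [x _ <-] h] := inf_adherent e0 hinf; exists x. Qed.

Let parallelogram x y : n (x - y) ^+ 2 =
  2 * J x + 2 * J y - 4 * J (2^-1%:C *: x + 2^-1%:C *: y).
Proof.
have e1 : x - y = x + (-1)%:C *: y by rewrite rmorphN1 scaleN1r.
rewrite /J pD !pZ e1 hilbert_n_expand hilbert_n_expand.
have -> : n (2^-1%:C *: x) ^+ 2 = 4^-1 * n x ^+ 2.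
  have := hilbert_n_expand 0 x 2^-1; rewrite add0r normr0 inner0l/= => ->; by field.
by rewrite innerZl cReZ; field.
Qed.

Let F := filter_from [set e : R | 0 < e] (fun e => [set x | J x < I + e]).

Let FF : ProperFilter F.
Proof.
apply: filter_from_proper; last by move=> e /I_adh.
apply: filter_from_filter; first by exists 1 => /=.
move=> e1 e2 /= e10 e20; exists (Order.min e1 e2); first by rewrite /= lt_min e10.
by move=> x /= xe; split; apply: lt_le_trans xe _; rewrite lerD2l ge_min lexx ?orbT.
Qed.

#[local] Existing Instance FF.

Let F_cvg : cvg F.
Proof.
apply: cauchy_cvg; apply: cauchy_exP => e e0.
have e_real := cge0_ReK (ltW e0).
have re0 : 0 < Re e by rewrite -(ltcR 0) e_real.
pose d := Re e ^+ 2 / 8.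
have d0 : 0 < d by rewrite divr_gt0// exprn_gt0.
have [x xd] := I_adh d0; exists x; exists d => //= y yd.
rewrite -ball_normE /= -e_real -hilbert_normK ltcR.
rewrite -(@ltr_pXn2r _ 2) ?nnegrE ?hilbert_n_ge0// ?(ltW re0)//.
rewrite parallelogram; have := I_le (2^-1%:C *: x + 2^-1%:C *: y).
move: xd yd => /= xd yd; rewrite /d in xd yd d0.
by lra.
Qed.

Let z0 := lim F.

Let J_z0 : J z0 <= I.
Proof.
apply/ler_addgt0Pr => e e0.
pose c := 2 + 2 * n z0 + 2 * `|m|.
have c0 : 0 < c.
  by rewrite /c -addrA ltr_pwDl// addr_ge0// mulr_ge0// hilbert_n_ge0.
pose d := Order.min 1 (e / c).
have d0 : 0 < d by rewrite lt_min ltr01 divr_gt0.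
have d1 : d <= 1 by rewrite ge_min lexx.
have dc : d * c <= e by rewrite -ler_pdivlMr// ge_min lexx orbT.
have dC : 0 < d%:C :> R[i] by rewrite ltcR.
have Fd : F (ball z0 d%:C) by apply: F_cvg; exact: nbhsx_ballx.
have Fd' : F [set x | J x < I + d] by exists d.
have [z [zd Jz]] := filter_ex (filterI Fd Fd').
move: zd; rewrite -ball_normE /= -hilbert_normK ltcR => zd.
move: Jz => /= Jz.
have e1 : z0 = z + (z0 - z) by rewrite addrC subrK.
have e2 : z = z0 + (z - z0) by rewrite addrC subrK.
have h1 : n z0 <= n z + d.
  rewrite {1}e1; apply: le_trans (hilbert_n_triangle _ _) _; lra.
have h2 : n z <= n z0 + d.
  rewrite {1}e2; apply: le_trans (hilbert_n_triangle _ _) _; rewrite (distrC z); lra.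
have h3 : p z - p z0 <= `|m| * d.
  have -> : p z - p z0 = p (z - z0) by rewrite {1}e2 pD addrC addKr.
  apply: le_trans (p_le _) _; rewrite (distrC z).
  apply: (@le_trans _ _ (`|m| * n (z0 - z))).
    by rewrite ler_wpM2r ?hilbert_n_ge0// ler_norm.
  by rewrite ler_wpM2l// ltW.
have h4 : n z0 ^+ 2 - n z ^+ 2 <= d * (2 * n z0 + 1).
  have := hilbert_n_ge0 z0; have := hilbert_n_ge0 z; nra.
move: Jz dc; rewrite /J /c; lra.
Qed.

Lemma riesz_ex : exists z, forall x, f x = '[x, z].
Proof.
exists z0.
have key x : Re '[x, z0] = p x.
  have hq (t : R) : 0 <= 2 * t * (Re '[x, z0] - p x) + t ^+ 2 * n x ^+ 2.
    have := le_trans J_z0 (I_le (z0 + t%:C *: x)).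
    by rewrite /J hilbert_n_expand pD pZ (innerC z0) complexRe_conj; lra.
  set a := Re '[x, z0] - p x in hq.
  suff : a = 0 by move=> /eqP; rewrite subr_eq0 => /eqP.
  apply/eqP; rewrite -sqrf_eq0 eq_le sqr_ge0 andbT.
  have N0 : 0 < 1 + n x ^+ 2 by rewrite ltr_pwDl// sqr_ge0.
  have := hq (- a / (1 + n x ^+ 2)).
  set N := n x ^+ 2 in N0 *.
  have -> : 2 * (- a / (1 + N)) * a + (- a / (1 + N)) ^+ 2 * N =
    - (a ^+ 2 * ((2 + N) / (1 + N) ^+ 2)) by field; rewrite gt_eqF.
  rewrite oppr_ge0 pmulr_lle0// divr_gt0// ?exprn_gt0//.
  by rewrite ltr_pwDl ?sqr_ge0.
move=> x; apply/eqP; rewrite eq_complex; apply/andP; split.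
  by apply/eqP; rewrite key.
have := key ('i%C *: x); rewrite /p fZ innerZl.
case: (f x) => a b; case: '[x, z0] => c d /=.
by rewrite !mul0r !mul1r !sub0r => /oppr_inj ->.
Qed.
End Riesz.
End InnerTheory.

Section Adjoint.
Variables (R : realType) (H K : hilbertType R).
Implicit Type T : bop H K.

Fact adjoint_ex T y : exists z : H, forall x, inner (T x) y = inner x z.
Proof.
apply: (@riesz_ex _ _ (fun x => inner (T x) y) (Re (`|T| * `|y|))).
  by move=> a x1 x2; rewrite linearP innerDl innerZl.
move=> x; rewrite cge0_ReK ?mulr_ge0//; apply: le_trans (inner_CauchySchwarz _ _) _.
by rewrite mulrAC ler_wpM2r// bop_normP.
Qed.

Definition adjoint_fun T (y : K) : H := sval (cid (adjoint_ex T y)).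

Fact adjoint_funP T x y : inner (T x) y = inner x (adjoint_fun T y).
Proof. exact: (svalP (cid (adjoint_ex T y))). Qed.

Fact adjoint_linear T : linear (adjoint_fun T).
Proof.
move=> a x y; apply: innerI => z.
by rewrite -adjoint_funP innerDr innerZr innerDr innerZr -!adjoint_funP.
Qed.

Fact adjoint_bounded_by T y : `|adjoint_fun T y| <= `|T| * `|y|.
Proof.
have [->|z0] := eqVneq (adjoint_fun T y) 0; first by rewrite normr0 mulr_ge0.
have nz : 0 < `|adjoint_fun T y| by rewrite normr_gt0.
rewrite -(ler_pM2l nz) -expr2 -inner_normE -adjoint_funP.
rewrite -[leLHS]ger0_norm; last by rewrite adjoint_funP inner_normE exprn_ge0.
apply: le_trans (inner_CauchySchwarz _ _) _.
by rewrite mulrA (mulrC `|adjoint_fun T y|) ler_wpM2r// bop_normP.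
Qed.

Fact adjoint_bounded T : exists M : R[i], forall y, `|adjoint_fun T y| <= M * `|y|.
Proof. by exists `|T|; exact: adjoint_bounded_by. Qed.

Definition adj T : bop K H := Bop (adjoint_linear T) (adjoint_bounded T).

Lemma adjP T x y : inner (T x) y = inner x (adj T y).
Proof. exact: adjoint_funP. Qed.

Lemma norm_adj_le T : `|adj T| <= `|T|.
Proof. by apply: opnorm_le => // y; exact: adjoint_bounded_by. Qed.
End Adjoint.

Section Composition.
Variables (R : realType) (H K L : hilbertType R) (S : bop K L) (T : bop H K).

Fact bcomp_linear : linear (S \o T).
Proof. by move=> a x y /=; rewrite !linearP. Qed.
Fact bcomp_bounded : exists M : R[i], forall x, `|(S \o T) x| <= M * `|x|.
Proof.
exists (`|S| * `|T|) => x /=; apply: le_trans (bop_normP _ _) _.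
by rewrite -mulrA ler_wpM2l// bop_normP.
Qed.
Definition bcomp : bop H L := Bop bcomp_linear bcomp_bounded.
End Composition.

Section Identity.
Variables (R : realType) (H : hilbertType R).
Fact bid_linear : linear (@idfun H). Proof. by []. Qed.
Fact bid_bounded : exists M : R[i], forall x : H, `|idfun x| <= M * `|x|.
Proof. by exists 1 => x; rewrite mul1r. Qed.
Definition bid : bop H H := Bop bid_linear bid_bounded.
End Identity.
Arguments bid {R H}.

Notation "S \op T" := (bcomp S T) (at level 40, left associativity).

Section BH.
Variables (R : realType) (H : hilbertType R).
Implicit Types S T U : bop H H.

Lemma adjK (K : hilbertType R) (T : bop H K) : adj (adj T) = T.
Proof.
apply: bopP => x; apply: innerI => z.
by rewrite -adjP innerC -adjP -innerC.
Qed.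

Fact bcompA : associative (fun S T => S \op T).
Proof. by move=> S T U; apply: bopP. Qed.
Fact bcompPl (a : R[i]) S T U : (a *: S + T) \op U = a *: (S \op U) + T \op U.
Proof. exact: bopP. Qed.
Fact bcompPr (a : R[i]) S T U : S \op (a *: T + U) = a *: (S \op T) + S \op U.
Proof. by apply: bopP => x; rewrite /= !linearP. Qed.
Fact adj_semilinear (a : R[i]) S T : adj (a *: S + T) = Num.conj a *: adj S + adj T.
Proof.
apply: bopP => x; apply: innerI => z.
rewrite -adjP !bopDE !bopZE innerDl innerZl innerDr innerZr -!adjP.
by rewrite conjCK.
Qed.
Fact adj_comp S T : adj (S \op T) = adj T \op adj S.
Proof. by apply: bopP => x; apply: innerI => z; rewrite -adjP /= !adjP. Qed.
Fact bcomp_norm S T : `|S \op T| <= `|S| * `|T|.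
Proof.
apply: opnorm_le; first by rewrite mulr_ge0.
move=> x /=; apply: le_trans (bop_normP _ _) _.
by rewrite -mulrA ler_wpM2l// bop_normP.
Qed.
Fact adj_norm T : `|adj T \op T| = `|T| ^+ 2.
Proof.
apply/eqP; rewrite eq_le; apply/andP; split.
  by apply: le_trans (bcomp_norm _ _) _; rewrite expr2 ler_wpM2r// norm_adj_le.
have h0 : 0 <= Re `|adj T \op T| by rewrite -ler0c cge0_ReK.
pose s : R[i] := (Num.sqrt (Re `|adj T \op T|))%:C.
have s0 : 0 <= s by rewrite ler0c sqrtr_ge0.
have sE : s ^+ 2 = `|adj T \op T| by rewrite -rmorphXn/= sqr_sqrtr// cge0_ReK.
rewrite -sE ler_pXn2r ?nnegrE//; apply: opnorm_le => // x.
rewrite -(@ler_pXn2r _ 2) ?nnegrE ?mulr_ge0// exprMn sE.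
rewrite -!inner_normE adjP -[leLHS]ger0_norm; last first.
  by rewrite -adjP inner_normE exprn_ge0.
apply: le_trans (inner_CauchySchwarz _ _) _.
rewrite inner_normE mulrC expr2 mulrA ler_wpM2r//.
exact: (bop_normP (adj T \op T)).
Qed.

HB.instance Definition _ := CompleteNormedModule_isCStarAlgebra.Build R (bop H H)
  bcompA bcompPl bcompPr (@adjK H) adj_semilinear adj_comp bcomp_norm adj_norm.
End BH.

Section Subspaces.
Variables (R : realType) (H : hilbertType R).

Record closed_subspace := ClosedSubspace {
  csub_set :> set H;
  csub0 : csub_set 0;
  csub_lin : forall (a : R[i]) x y,
    csub_set x -> csub_set y -> csub_set (a *: x + y);
  csub_closed : closed csub_set
}.

Record subsp (M : closed_subspace) := Subsp {
  subsp_val : H;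
  subspP : subsp_val \in (M : set H)
}.

Section Instances.
Variable M : closed_subspace.
Definition csub_pred : {pred H} := fun x => x \in (M : set H).
HB.instance Definition _ := [isSub for @subsp_val M].
HB.instance Definition _ := [Choice of subsp M by <:].
Fact csub_submod : submod_closed csub_pred.
Proof.
split; first by rewrite unfold_in inE; exact: csub0.
by move=> a x y; rewrite !unfold_in !inE; exact: csub_lin.
Qed.
HB.instance Definition _ := GRing.isSubmodClosed.Build R[i] H csub_pred csub_submod.
HB.instance Definition _ := GRing.SubChoice_isSubLmodule.Build R[i] H csub_pred (subsp M) csub_submod.
End Instances.
End Subspaces.

Section SubHilbert.
Variables (R : realType) (H : hilbertType R) (M : closed_subspace H).
Local Notation S := (subsp M).
Implicit Types x y : S.

Lemma subsp_valD x y : val (x + y) = val x + val y. Proof. exact: raddfD. Qed.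
Lemma subsp_valZ (a : R[i]) x : val (a *: x) = a *: val x.
Proof. exact: linearZ. Qed.
Lemma subsp_valB x y : val (x - y) = val x - val y. Proof. exact: raddfB. Qed.

Fact subsp_normD x y : `|val (x + y)| <= `|val x| + `|val y|.
Proof. by rewrite subsp_valD ler_normD. Qed.
Fact subsp_normZ (a : R[i]) x : `|val (a *: x)| = `|a| * `|val x|.
Proof. by rewrite subsp_valZ normrZ. Qed.
Fact subsp_norm_eq0 x : `|val x| = 0 -> x = 0.
Proof. by move=> /eqP; rewrite normr_eq0 => /eqP x0; apply: val_inj; rewrite x0 raddf0. Qed.
HB.instance Definition _ :=
  Lmodule_isNormed.Build R[i] S subsp_normD subsp_normZ subsp_norm_eq0.

Lemma subsp_normE x : `|x| = `|val x|. Proof. by []. Qed.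

Fact subsp_complete (F : set_system S) : ProperFilter F -> cauchy F -> cvg F.
Proof.
move=> FF /cauchyP Fc.
have Fv : cvg ((val : S -> H) @ F).
  apply: cauchy_cvg; apply: cauchy_exP => e e0; have [x Fx] := Fc e e0.
  exists (val x); rewrite nbhs_simpl /=; apply: filterS Fx => y.
  by rewrite -!ball_normE /= -subsp_valB.
have Ml : lim ((val : S -> H) @ F) \in (M : set H).
  have FM : F (fun x => (M : set H) (val x)).
    by apply: filterE => x; have := subspP x; rewrite inE.
  apply: mem_set.
  by have := @closed_cvg _ _ F _ (val : S -> H) _ (@csub_closed _ _ M) FM _ Fv; apply.
apply/cvg_ex; exists (Subsp Ml).
apply/cvgrPdist_lt => e e0; have /cvgrPdist_lt/(_ e e0) := Fv.
by apply: filterS => x; rewrite subsp_normE subsp_valB.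
Qed.
HB.instance Definition _ := Uniform_isComplete.Build S subsp_complete.

Definition subsp_inner x y : R[i] := inner (val x) (val y).
Fact subsp_inner_bilinear :
  bilinear_for (GRing.Scale.Law.clone _ _ *%R _)
    (GRing.Scale.Law.clone _ _ (Num.conj \; *%R) _) subsp_inner.
Proof.
split=> [u' a x y|u a x y] /=; rewrite /subsp_inner subsp_valD subsp_valZ.
  by rewrite innerPl.
by rewrite innerPr.
Qed.
HB.instance Definition _ := bilinear_isBilinear.Build R[i] S S R[i] *%R
  (Num.conj \; *%R) subsp_inner subsp_inner_bilinear.
Fact subsp_inner_herm x y :
  subsp_inner x y = (-1) ^+ false * Num.conj (subsp_inner y x).
Proof. by rewrite expr0 mul1r /subsp_inner innerC. Qed.
HB.instance Definition _ := isHermitianSesquilinear.Build R[i] S false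
  Num.conj subsp_inner subsp_inner_herm.
Fact subsp_inner_gt0 x : x != 0 -> 0 < subsp_inner x x.
Proof.
by move=> x0; rewrite /subsp_inner inner_normE exprn_gt0// -subsp_normE normr_gt0.
Qed.
HB.instance Definition _ := isDotProduct.Build R[i] S subsp_inner subsp_inner_gt0.
Fact subsp_inner_normE x : subsp_inner x x = `|x| ^+ 2.
Proof. by rewrite /subsp_inner inner_normE. Qed.
HB.instance Definition _ := CompleteNormedModule_isHilbert.Build R S subsp_inner_normE.
End SubHilbert.

Section ClosedRange.
Variables (R : realType) (H K : hilbertType R) (T : bop H K).

Fact closed_range0 : closure (range T) 0.
Proof. by apply: subset_closure; exists 0 => //; exact: linear0. Qed.

Fact closed_range_lin (a : R[i]) x y :
  closure (range T) x -> closure (range T) y -> closure (range T) (a *: x + y).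
Proof.
move=> clx cly B /nbhs_ballP[e /= e0 eB].
have c0 : 0 < `|a| + 1 by rewrite ltr_wpDl.
have d0 : 0 < e / 2 / (`|a| + 1) by rewrite !divr_gt0.
have e20 : 0 < e / 2 by rewrite divr_gt0.
have [_ [[u _ <-] xu]] := clx _ (nbhsx_ballx x _ d0).
have [_ [[v _ <-] yv]] := cly _ (nbhsx_ballx y _ e20).
exists (a *: T u + T v); split; first by exists (a *: u + v); rewrite ?linearP.
apply: eB; move: xu yv; rewrite -!ball_normE /= => xu yv.
rewrite opprD addrACA -scalerBr; apply: le_lt_trans (ler_normD _ _) _.
rewrite [e]splitr normrZ; apply: ler_ltD => //.
apply: (@le_trans _ _ ((`|a| + 1) * `|x - T u|)); first by rewrite ler_wpM2r// lerDl.
by rewrite mulrC -ler_pdivlMr// ltW.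
Qed.

Definition closed_range : closed_subspace K :=
  ClosedSubspace closed_range0 closed_range_lin (@closed_closure _ (range T)).
End ClosedRange.

Section OperatorNotions.
Variables (R : realType).
Implicit Types H K : hilbertType R.

Definition bop_inverse H K (T : bop H K) (S : bop K H) : Prop :=
  S \op T = bid /\ T \op S = bid.

Definition spectrum H (T : bop H H) : set R[i] :=
  [set l | ~ exists S : bop H H, bop_inverse (l *: bid - T) S].

(* Self-adjointness is automatic, H being a complex Hilbert space. *)
Definition positive_op H (T : bop H H) : Prop := forall x : H, 0 <= inner (T x) x.

Definition unitary_op H K (U : bop H K) : Prop := bop_inverse U (adj U).

(* 0 when T is not positive. *)
Definition sqrt_op H (T : bop H H) : bop H H :=
  xget 0 [set S | positive_op S /\ S \op S = T].

Definition abs_op H K (T : bop H K) : bop H H := sqrt_op (adj T \op T).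

(* 0 when T is not invertible. *)
Definition inv_op H (T : bop H H) : bop H H := xget 0 [set S | bop_inverse T S].

Definition moore_penrose H K (T : bop H K) (S : bop K H) : Prop :=
  [/\ T \op S \op T = T, S \op T \op S = S,
      adj (T \op S) = T \op S & adj (S \op T) = S \op T].

(* 0 when the range of T is not closed. *)
Definition pinv_op H K (T : bop H K) : bop K H := xget 0 [set S | moore_penrose T S].

Definition matched_projection H (Q : bop H H) : bop H H :=
  2^-1 *: ((abs_op (adj Q) + adj Q) \op pinv_op (abs_op (adj Q))
             \op inv_op (abs_op (adj Q) + bid) \op (abs_op (adj Q) + Q)).

End OperatorNotions.

Section Decomposition.
Variables (R : realType) (H : hilbertType R) (Q : bop H H).
Let m := matched_projection Q.
Definition canon_H1 : set H := range m `&` range Q.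
Definition canon_H4 : set H := [set x | m x = 0] `&` [set x | Q x = 0].
Definition canon_H5 : closed_subspace H := closed_range (m \op Q \op (bid - m)).
Definition canon_H6 : closed_subspace H := closed_range ((bid - m) \op Q \op m).

Definition ell (K : hilbertType R) (D : bop K K) : bop K K := sqrt_op (D \op (D - bid)).

(* The adjoint of the unitary x |-> (P_H1 x, P_H4 x, P_H5 x, P_H6 x) is
   (x1, x4, x5, x6) |-> x1 + x4 + x5 + x6. Writing W for the former, the last
   clause is the equation Q W^* = W^* (I (+) 0 (+) [D, - l U^*; U l, U (I - D) U^*])
   with l = (D (D - I))^(1/2), evaluated on a vector (x1, x4, x5, x6). *)
Definition canonical_decomposition (D : bop (subsp canon_H5) (subsp canon_H5))
    (U : bop (subsp canon_H5) (subsp canon_H6)) : Prop :=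
  [/\ unitary_op U, positive_op (D - bid),
      forall x, (D - bid) x = 0 -> x = 0 &
      forall x1 x4 (x5 : subsp canon_H5) (x6 : subsp canon_H6),
        canon_H1 x1 -> canon_H4 x4 ->
        Q (x1 + x4 + val x5 + val x6) =
          x1 + val (D x5 - ell D (adj U x6))
          + val (U (ell D x5) + U ((bid - D) (adj U x6)))].
End Decomposition.

(* Main.v *)
Require Import Defs.
From mathcomp Require Import all_boot all_order all_algebra.
From mathcomp Require Import boolp classical_sets reals topology normedtype.
From mathcomp Require Import complex.
From mathcomp Require Import sesquilinear ring lra.

Set Implicit Arguments.
Unset Strict Implicit.
Unset Printing Implicit Defensive.

Import Order.TTheory GRing.Theory Num.Theory.
Import numFieldNormedType.Exports.

Local Open Scope classical_set_scope.
Local Open Scope ring_scope.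
Local Open Scope complex_scope.

(* For an idempotent q of a C*-algebra put a = q q^*, w = i (q - q^* ) and
   z = 1 + w^2. The self-adjoint element z commutes with q and q^*, and
   a x = z x as soon as q x = x, so that the spectrum of a lies in {0} and
   [1, |q|^2]. For the operator Q of the theorem z acts on H5 as (2 D - 1)^2,
   and |Q| = 2 |D| - 1.

   If the spectrum of D is [1, |D|], every point of [1, |Q|^2] is an approximate
   eigenvalue of Q Q^*, hence |f(b) b| <= |f(a) a| for every polynomial f, where
   a = Q Q^* and b = p p^* for an idempotent p of norm at most |Q|. The elements
   f(a) a exhaust the compressions Q x Q^* of the polynomials x in Q and Q^*;
   comparing norms of high powers of x^* x extends the inequality from these
   compressions to all x, so that Q |-> p defines a homomorphism. The abstract
   algebra is never represented on a Hilbert space: its spectral theory rests on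
   the inequality 2 |k x| <= |x + k^2 x| for self-adjoint k.

   Conversely, let t in (1, |D|) lie outside the spectrum of D and put
   l = (2 t - 1)^2. Then (a - 1)^2 a = k (l - a)^2 y for a scalar k and some y in
   C*{Q}. There is an idempotent p of rank one and norm 2 t - 1, for which
   (p p^* )^2 = l p p^*; a homomorphism sending Q to p would give
   l (l - 1)^2 p p^* = 0. *)

(** Compressions enter because a word q ... q^* collapses, by idempotency, to a power of a:
    noncommuting polynomials reduce to one variable. Compressing costs a constant factor in the
    norm, which n-th roots remove.

    In the converse, a lower bound for l - z is known only on H5. With m the matched projection, w
    exchanges the ranges of m and 1 - m, and m w takes its values in H5; so factors w carry
    estimates from H5 to all of H. This is the origin of (a - 1)^2 a, which equals w^4 a. The factor
    l - a is squared because l - z is indefinite, whereas 1 - (l - z)^2 / K is a contraction on H5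
    for large K. Since C*{Q} need not contain the identity, no inverse is formed: the geometric
    series is applied to an element of C*{Q}.

    Of the formula defining m, only m = m^* = m^2 and (2 m - 1) Q = Q^* (2 m - 1) are retained. *)

Section LinearCombinations.
Variables (K : comRingType) (V : lmodType K).

Inductive lexp := LAtom of nat | LZero | LAdd of lexp & lexp | LOpp of lexp
  | LScale of K & lexp.

Fixpoint leval (s : seq V) (e : lexp) : V :=
  match e with
  | LAtom i => s`_i
  | LZero => 0
  | LAdd e f => leval s e + leval s f
  | LOpp e => - leval s e
  | LScale c e => c *: leval s e
  end.

(** Indices are compared by [eqn], so that [cbn] computes the coefficients of concrete
    expressions. *)
Fixpoint lcoef (i : nat) (e : lexp) : K :=
  match e with
  | LAtom j => if eqn j i then 1 else 0
  | LZero => 0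
  | LAdd e f => lcoef i e + lcoef i f
  | LOpp e => - lcoef i e
  | LScale c e => c * lcoef i e
  end.

Lemma levalE s e : leval s e = \sum_(i < size s) lcoef i e *: s`_i.
Proof.
elim: e => [j| |e IHe f IHf|e IHe|c e IHe] /=.
- have [js|js] := ltnP j (size s); last first.
    rewrite nth_default// big1// => i _; case: eqnP; last by rewrite scale0r.
    by move=> ji; move: js; rewrite ji leqNgt ltn_ord.
  rewrite (bigD1 (Ordinal js))//= big1 => [|i ij].
    by (have -> : eqn j j by apply/eqnP); rewrite scale1r addr0.
  case: eqnP; last by rewrite scale0r.
  by move=> ji; move: ij; rewrite -val_eqE /= ji eqxx.
- by rewrite big1// => i _; rewrite scale0r.
- by rewrite IHe IHf -big_split; apply: eq_bigr => i _; rewrite /= scalerDl.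
- by rewrite IHe -sumrN; apply: eq_bigr => i _; rewrite scaleNr.
- by rewrite IHe scaler_sumr; apply: eq_bigr => i _; rewrite scalerA.
Qed.

(** A recursive conjunction instead of a bounded quantifier: for a concrete number of atoms it
    unfolds to separate ring equations. *)
Fixpoint all_below (n : nat) (P : nat -> Prop) : Prop :=
  if n is m.+1 then all_below m P /\ P m else True.

Lemma leval_eq s e f :
  all_below (size s) (fun i => lcoef i e = lcoef i f) -> leval s e = leval s f.
Proof.
rewrite !levalE; elim: (size s) => [|n IHn] /=; first by rewrite !big_ord0.
by move=> [/IHn en fn]; rewrite !big_ord_recr /= en fn.
Qed.
End LinearCombinations.
Arguments LAtom {K}. Arguments LZero {K}.

Ltac lmem x s :=
  lazymatch s with
  | nil => constr:(false)
  | cons x _ => constr:(true)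
  | cons _ ?s' => lmem x s'
  end.
Ltac lindex x s :=
  lazymatch s with
  | cons x _ => constr:(O)
  | cons _ ?s' => let i := lindex x s' in constr:(S i)
  end.
Ltac latoms t s :=
  lazymatch t with
  | @GRing.add _ ?a ?b => let s := latoms a s in latoms b s
  | @GRing.opp _ ?a => latoms a s
  | @GRing.scale _ _ _ ?a => latoms a s
  | @GRing.zero _ => s
  | _ => lazymatch lmem t s with true => s | false => constr:(cons t s) end
  end.
Ltac lreify K t s :=
  lazymatch t with
  | @GRing.add _ ?a ?b =>
      let a := lreify K a s in let b := lreify K b s in constr:(LAdd a b)
  | @GRing.opp _ ?a => let a := lreify K a s in constr:(LOpp a)
  | @GRing.scale _ _ ?c ?a => let a := lreify K a s in constr:(LScale (c : K) a)
  | @GRing.zero _ => constr:(@LZero K)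
  | _ => let i := lindex t s in constr:(@LAtom K i)
  end.
(* Reduces an equation between linear combinations to one goal per atom, the
   equality of its two coefficients. *)
Ltac lmod_coef K :=
  lazymatch goal with
  | |- @eq ?T ?t ?u =>
      let s := latoms t (@nil T) in let s := latoms u s in
      let e := lreify K t s in let f := lreify K u s in
      change (leval s e = leval s f); apply: leval_eq; cbn [size all_below lcoef eqn];
      repeat split
  end.
Ltac lmod K := lmod_coef K; ring.

Local Notation cabs c := (complex.Re `|c|).

(** * Real-valued norms and C*-algebras *)

Section RealNorm.
Variables (R : realType) (V : normedModType R[i]).
Implicit Types x y : V.

(** The norm takes values in [R[i]], which is only partially ordered; a copy in [R] gives [lra] and
    [nra] access to norm estimates. *)
Definition nr x : R := complex.Re `|x|.

Lemma nrE x : (nr x)%:C = `|x|. Proof. exact: cge0_ReK. Qed.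
Lemma nr_ge0 x : 0 <= nr x. Proof. by rewrite -ler0c nrE. Qed.
Lemma nrD x y : nr (x + y) <= nr x + nr y.
Proof. by rewrite -lecR rmorphD /= !nrE ler_normD. Qed.
Lemma nrN x : nr (- x) = nr x. Proof. by rewrite /nr normrN. Qed.
Lemma nrB x y : nr (x - y) <= nr x + nr y.
Proof. by rewrite -(nrN y) nrD. Qed.
Lemma nr0 : nr 0 = 0. Proof. by rewrite /nr normr0. Qed.
Lemma nr_eq0 x : nr x = 0 -> x = 0.
Proof. by move=> x0; apply/eqP; rewrite -normr_eq0 -nrE x0. Qed.
Lemma nr_gt0 x : x <> 0 -> 0 < nr x.
Proof. by move=> x0; rewrite lt_def nr_ge0 andbT; apply/eqP => /nr_eq0. Qed.
Lemma nr_distC x y : nr (x - y) = nr (y - x).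
Proof. by rewrite /nr distrC. Qed.
Lemma nr_triangle x y z : nr (x - z) <= nr (x - y) + nr (y - z).
Proof. by apply: le_trans (nrD _ _); rewrite addrA subrK. Qed.

Lemma nrZ c x : nr (c *: x) = cabs c * nr x.
Proof.
by rewrite /nr normrZ -[`|c|]cge0_ReK// -[`|x|]cge0_ReK// cReZ /=.
Qed.
Lemma cabsE (c : R[i]) : (cabs c)%:C = `|c|. Proof. exact: cge0_ReK. Qed.
Lemma cabs_ge0 (c : R[i]) : 0 <= cabs c. Proof. by rewrite -ler0c cabsE. Qed.
Lemma cabs_real (t : R) : cabs (t%:C : R[i]) = `|t|.
Proof. by rewrite normc_def /= expr0n addr0 sqrtr_sqr. Qed.
Lemma nrZr (t : R) x : nr (t%:C *: x) = `|t| * nr x.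
Proof. by rewrite nrZ cabs_real. Qed.
Lemma cabsM (c d : R[i]) : cabs (c * d) = cabs c * cabs d.
Proof. by rewrite normrM -[`|c|]cabsE cReZ. Qed.
Lemma nrZi x : nr ('i%C *: x) = nr x.
Proof.
rewrite nrZ; suff -> : cabs ('i%C : R[i]) = 1 by rewrite mul1r.
by rewrite normc_def /= expr0n expr1n add0r sqrtr1.
Qed.

Lemma nr_normalize x : x <> 0 -> nr ((nr x)^-1%:C *: x) = 1.
Proof.
move=> /nr_gt0 x0; rewrite nrZr ger0_norm ?invr_ge0 ?nr_ge0//.
by rewrite mulVf// gt_eqF.
Qed.
End RealNorm.

Local Notation "x ** y" := (smul x y) (at level 40, left associativity).

Section CStar.
Variables (R : realType) (A : cstarAlgType R).
Implicit Types x y z k w q a : A.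

Lemma smulDl x y z : (x + y) ** z = x ** z + y ** z.
Proof. by have := smulPl 1 x y z; rewrite !scale1r. Qed.
Lemma smulDr x y z : z ** (x + y) = z ** x + z ** y.
Proof. by have := smulPr 1 z x y; rewrite !scale1r. Qed.
Lemma smul0l z : 0 ** z = 0.
Proof. by apply: (addrI (0 ** z)); rewrite -smulDl !addr0. Qed.
Lemma smul0r z : z ** 0 = 0.
Proof. by apply: (addrI (z ** 0)); rewrite -smulDr !addr0. Qed.
Lemma smulZl c x z : (c *: x) ** z = c *: (x ** z).
Proof. by have := smulPl c x 0 z; rewrite smul0l !addr0. Qed.
Lemma smulZr c x z : z ** (c *: x) = c *: (z ** x).
Proof. by have := smulPr c z x 0; rewrite smul0r !addr0. Qed.
Lemma smulNl x z : (- x) ** z = - (x ** z).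
Proof. by rewrite -scaleN1r smulZl scaleN1r. Qed.
Lemma smulNr x z : z ** (- x) = - (z ** x).
Proof. by rewrite -scaleN1r smulZr scaleN1r. Qed.
Lemma star0 : star 0 = 0 :> A.
Proof.
by apply: (addrI (star 0)); have := starP 1 0 (0 : A); rewrite rmorph1 !scale1r !addr0.
Qed.
Lemma starD x y : star (x + y) = star x + star y.
Proof. by have := starP 1 x y; rewrite rmorph1 !scale1r. Qed.
Lemma starZ c x : star (c *: x) = Num.conj c *: star x.
Proof. by have := starP c x 0; rewrite star0 !addr0. Qed.
Lemma starN x : star (- x) = - star x.
Proof. by rewrite -scaleN1r starZ rmorphN1 scaleN1r. Qed.

Definition smulE := (smulDl, smulDr, smulNl, smulNr, smulZl, smulZr, smul0l, smul0r).
Definition starE := (starD, starN, starZ, star0, @starM R A, @starK R A).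

Lemma nrM x y : nr (x ** y) <= nr x * nr y.
Proof. by rewrite -lecR rmorphM /= !nrE ler_normM. Qed.
Lemma nr_starM x : nr (star x ** x) = nr x ^+ 2.
Proof. by apply: complexI; rewrite rmorphXn /= !nrE norm_starM. Qed.
(** From |y|^2 = |y^* y| <= |y^*| |y| one gets |y| <= |y^*|; apply this to x and to x^*. *)
Lemma nr_star x : nr (star x) = nr x.
Proof.
have h y : nr y <= nr (star y).
  have := nr_starM y; have := nrM (star y) y; have := nr_ge0 y; have := nr_ge0 (star y).
  move=> h1 h2 h3 h4; rewrite h4 in h3.
  have [->//|y0] := eqVneq (nr y) 0.
  by rewrite -(@ler_pM2r _ (nr y)) ?lt_def ?y0// -expr2.
by apply/le_anti; rewrite h -{2}[x]starK h.
Qed.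
Lemma nr_Mstar x : nr (x ** star x) = nr x ^+ 2.
Proof. by rewrite -(nr_star x) -nr_starM starK. Qed.

Definition selfadj x := star x = x.

Lemma selfadj_star x : selfadj (star x ** x).
Proof. by rewrite /selfadj starM starK. Qed.

Lemma nr_selfadj_sqr k : selfadj k -> nr (k ** k) = nr k ^+ 2.
Proof. by move=> kk; rewrite -nr_starM kk. Qed.

Lemma conj_i : Num.conj ('i%C : R[i]) = - 'i%C.
Proof. by rewrite conj_complexE /=; apply/eqP; rewrite eq_complex /= oppr0 !eqxx. Qed.
Lemma ii : 'i%C * 'i%C = -1 :> R[i].
Proof. by rewrite -expr2 sqr_i. Qed.

(** Both 1 + ik and 1 - ik have 1 + k^2 as squared modulus. They are applied to x because there may
    be no unit. *)
Lemma nr_normal_shift k x : selfadj k ->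
  nr (x + 'i%C *: (k ** x)) = nr (x - 'i%C *: (k ** x)).
Proof.
move=> kk; apply/eqP; rewrite -(@eqrXn2 _ 2) ?nr_ge0//; apply/eqP.
rewrite -!nr_starM !starE !smulE conj_i kk !smulA; congr nr.
by lmod_coef R[i]; ring: ii.
Qed.

(* The normal elements 1 + ik and 1 - ik have the same modulus, and
   (1 + ik)^2 - (1 - ik)^2 = 4ik. *)
Lemma nr_amgm k x : selfadj k -> 2 * nr (k ** x) <= nr (x + k ** (k ** x)).
Proof.
move=> kk.
pose P := x + 'i%C *: (k ** x); pose N := x - 'i%C *: (k ** x).
have eP : P - 'i%C *: (k ** P) = x + k ** (k ** x).
  by rewrite /P !smulE; lmod_coef R[i]; ring: ii.
have eN : N + 'i%C *: (k ** N) = x + k ** (k ** x).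
  by rewrite /N !smulE; lmod_coef R[i]; ring: ii.
have hP := nr_normal_shift P kk; have hN := nr_normal_shift N kk.
rewrite eP in hP; rewrite eN in hN.
have e4 : (P + 'i%C *: (k ** P)) - (N - 'i%C *: (k ** N)) = 4%:C *: ('i%C *: (k ** x)).
  rewrite /P /N !smulE rmorph_nat.
  by lmod_coef R[i]; ring: ii.
have := nrB (P + 'i%C *: (k ** P)) (N - 'i%C *: (k ** N)).
rewrite e4 nrZr nrZi hP -hN ger0_norm//; lra.
Qed.

Lemma nr_smulB x y u v (e : R) : nr (x - u) < e ->
  nr (y - v) < e -> e <= 1 -> nr (x ** y - u ** v) <= e * (nr x + nr y + 1).
Proof.
move=> xu yv e1.
have -> : x ** y - u ** v = (x - u) ** y + (x ** (y - v) - (x - u) ** (y - v)).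
  by rewrite !smulE; lmod R[i].
have := nrD ((x - u) ** y) (x ** (y - v) - (x - u) ** (y - v)).
have := nrB (x ** (y - v)) ((x - u) ** (y - v)).
have := nrM (x - u) y; have := nrM x (y - v); have := nrM (x - u) (y - v).
have := nr_ge0 x; have := nr_ge0 y; have := nr_ge0 (x - u); have := nr_ge0 (y - v).
nra.
Qed.

Lemma cstar_gen_subalgebra z :
  cstar_subalgebra (cstar_gen z) /\ cstar_gen z z.
Proof.
split; last by move=> S [_ zS]; exact: zS.
split.
- by apply: closed_bigI => S [[]].
- by move=> S [[]].
- by move=> c x y hx hy S hS; case: (hS) => [[_ _ SD _ _] _]; apply: SD; [exact: hx|exact: hy].
- by move=> x y hx hy S hS; case: (hS) => [[_ _ _ SM _] _]; apply: SM; [exact: hx|exact: hy].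
- by move=> x hx S hS; case: (hS) => [[_ _ _ _ SS] _]; apply: SS; exact: hx.
Qed.
End CStar.

(** * Spectral bounds for an idempotent *)

Section PolynomialAction.
Variables (R : realType) (V : lmodType R[i]) (L : V -> V).
Hypothesis L_lin : linear L.
Implicit Types (p q : {poly R[i]}) (x y : V).

Let LD x y : L (x + y) = L x + L y.
Proof. by have := L_lin 1 x y; rewrite !scale1r. Qed.
Let L0 : L 0 = 0.
Proof. by apply: (addrI (L 0)); rewrite -LD !addr0. Qed.
Let LZ c x : L (c *: x) = c *: L x.
Proof. by have := L_lin c x 0; rewrite L0 !addr0. Qed.

(** This is p(L) x. Acting on a vector replaces evaluation in the algebra, which may lack a unit;
    [pact (smul a) p a] is the element p(a) a. *)
Definition pact p x : V := \sum_(i < size p) p`_i *: iter i L x.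

Lemma pact_wide n p x : (size p <= n)%N ->
  pact p x = \sum_(i < n) p`_i *: iter i L x.
Proof.
move=> pn; rewrite /pact (big_ord_widen n (fun i => p`_i *: iter i L x) pn).
rewrite big_mkcond; apply: eq_bigr => i _; case: ltnP => // hi.
by rewrite nth_default// scale0r.
Qed.

Lemma pactD p q x : pact (p + q) x = pact p x + pact q x.
Proof.
pose n := maxn (size p) (size q).
rewrite (@pact_wide n) ?size_polyD// (@pact_wide n p) ?leq_maxl// (@pact_wide n q) ?leq_maxr//.
by rewrite -big_split; apply: eq_bigr => i _; rewrite coefD scalerDl.
Qed.

Lemma pactZ c p x : pact (c *: p) x = c *: pact p x.
Proof.
rewrite (@pact_wide (size p)) ?size_scale_leq// scaler_sumr.
by apply: eq_bigr => i _; rewrite coefZ scalerA.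
Qed.

Lemma pact0 x : pact 0 x = 0.
Proof. by rewrite /pact size_poly0 big_ord0. Qed.

Lemma pactC c x : pact c%:P x = c *: x.
Proof. by rewrite (@pact_wide 1) ?size_polyC ?leq_b1// big_ord1 coefC. Qed.

Lemma pact1 x : pact 1 x = x.
Proof. by rewrite pactC scale1r. Qed.

Lemma pactMX p x : pact (p * 'X) x = L (pact p x).
Proof.
have [->|p0] := eqVneq p 0; first by rewrite mul0r pact0 L0.
rewrite /pact size_mulX// big_ord_recl coefMX /= scale0r add0r.
rewrite (big_morph L LD L0); apply: eq_bigr => i _.
by rewrite coefMX /= LZ.
Qed.

Lemma pactX x : pact 'X x = L x.
Proof. by rewrite -['X]mul1r pactMX pact1. Qed.

Lemma pactM p q x : pact (p * q) x = pact p (pact q x).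
Proof.
elim/poly_ind: p => [|p c IHp]; first by rewrite mul0r !pact0.
rewrite mulrDl pactD [in RHS]pactD mulrAC !pactMX IHp; congr (_ + _).
by rewrite mul_polyC pactZ pactC.
Qed.

Lemma pact_ind (P : V -> Prop) p x : P x -> P 0 ->
  (forall y, P y -> P (L y)) -> (forall c y z, P y -> P z -> P (c *: y + z)) ->
  P (pact p x).
Proof.
move=> Px P0 PL PD; elim/poly_ind: p => [|p c IHp]; first by rewrite pact0.
by rewrite pactD pactMX pactC addrC; apply: PD => //; apply: PL.
Qed.
End PolynomialAction.

Lemma pact_morph (R : realType) (V W : lmodType R[i]) (L : V -> V) (M : W -> W) (T : V -> W)
    (p : {poly R[i]}) x :
  linear L -> linear M -> linear T -> (forall y, T (L y) = M (T y)) ->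
  T (pact L p x) = pact M p (T x).
Proof.
move=> Ll Ml Tl TL.
have T0 : T 0 = 0.
  by apply: (addrI (T 0)); have := Tl 1 0 0; rewrite !scale1r !addr0.
elim/poly_ind: p => [|p c IHp]; first by rewrite !pact0.
by rewrite !pactD !pactMX// !pactC addrC Tl TL IHp addrC.
Qed.

Section Decay.
Variables (R : realType) (A : cstarAlgType R) (V : A -> Prop) (k : A) (d : R).
Hypotheses (kk : selfadj k) (Vk : V k) (Vstep : forall x, V x -> V (k ** x)).
Hypotheses (k1 : nr k = 1) (d0 : 0 < d).
Hypothesis V_bb : forall x, V x -> d * nr x <= nr (x - k ** (k ** x)).

(** [kp j] is k^(2^j), and [Kp j x] below is k^(2^j - 1) x, the product of the earlier [kp i]
    applied to x. *)
Let kp := fix kp j := if j is j'.+1 then kp j' ** kp j' else k.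
Let Kp := fix Kp j x := if j is j'.+1 then Kp j' (kp j' ** x) else x.

Let kp_sa j : selfadj (kp j).
Proof. by elim: j => //= j IH; rewrite /selfadj starM IH. Qed.
Let kp_comm j : k ** kp j = kp j ** k.
Proof. by elim: j => //= j IH; rewrite smulA IH -smulA IH smulA. Qed.
Let kpV j x : V x -> V (kp j ** x).
Proof.
by elim: j x => [|j IH] x Vx /=; [exact: Vstep|rewrite -smulA; apply/IH/IH].
Qed.
Let nr_kp j : nr (kp j) = 1.
Proof. by elim: j => //= j IH; rewrite nr_selfadj_sqr// IH expr1n. Qed.
Let KpM j y z : Kp j (y ** z) = Kp j y ** z.
Proof. by elim: j y => //= j IH y; rewrite smulA IH. Qed.
Let Kpk j : Kp j k = kp j.
Proof. by elim: j => //= j IH; rewrite -kp_comm KpM IH. Qed.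

(** With K = k^(2^j), factor 1 - K^4 = (1 + K^2)(1 - K^2). By [nr_amgm] the first factor is at least
    2K in norm, which doubles the constant and contributes one more power K. *)
Let growth j x : V x -> 2 ^+ j * d * nr (Kp j x) <= nr (x - kp j.+1 ** x).
Proof.
elim: j x => [|j IH] x Vx; first by rewrite expr0 mul1r /= -smulA; apply: V_bb.
pose y := x - kp j.+1 ** x.
have -> : x - kp j.+2 ** x = y + kp j ** (kp j ** y).
  by rewrite /y /= !smulE !smulA; lmod R[i].
apply: le_trans (nr_amgm _ (kp_sa j)).
have -> : kp j ** y = kp j ** x - kp j.+1 ** (kp j ** x) by rewrite /y /= !smulE !smulA.
by rewrite exprS -!mulrA ler_wpM2l// mulrA; apply/IH/kpV.
Qed.

(* On V the powers k^(2^j) decay like 2^-j, although their norm stays 1. *)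
Lemma bounded_below_peak : False.
Proof.
have bd j : 2 ^+ j * d <= 2.
  have := growth j Vk; rewrite Kpk nr_kp mulr1 => /le_trans; apply.
  apply: le_trans (nrB _ _) _; have := nrM (kp j.+1) k.
  by rewrite nr_kp k1; lra.
have := archi_boundP (ltW (divr_gt0 (ltr0n _ 2) d0)); set n := Num.bound _.
rewrite ltr_pdivrMr// => h.
have : n%:R * d <= 2.
  apply: le_trans (bd n); rewrite ler_wpM2r ?(ltW d0)//.
  by rewrite -natrX ler_nat ltnW// ltn_expl.
by rewrite leNgt h.
Qed.
End Decay.

Section BoundedBelow.
Variables (R : realType) (A : cstarAlgType R).
Implicit Types (x y w q : A) (c : R[i]).

(** The cross terms cancel in (w + it)^* (w + it) = w^2 + t^2. *)
Lemma nr_selfadj_shift w (t : R) x : selfadj w ->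
  nr (w ** x + ('i%C * t%:C) *: x) ^+ 2 <= (nr w ^+ 2 + t ^+ 2) * nr x ^+ 2.
Proof.
move=> ww; rewrite -nr_starM !starE !smulE ww rmorphM /= conj_i conj_real.
set lhs := (X in nr X).
have -> : lhs = star x ** (w ** (w ** x)) + (t ^+ 2)%:C *: (star x ** x).
  by rewrite /lhs rmorphXn /= !smulA; lmod_coef R[i]; ring: (@ii R).
apply: le_trans (nrD _ _) _; rewrite nrZr ger0_norm ?sqr_ge0// nr_starM mulrDl lerD2r.
apply: le_trans (nrM _ _) _; rewrite nr_star.
have h1 := nrM w (w ** x); have h2 := nrM w x.
have := nr_ge0 w; have := nr_ge0 x => x0 w0.
have h3 : nr (w ** (w ** x)) <= nr w * (nr w * nr x).
  by apply: le_trans h1 _; rewrite ler_wpM2l.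
apply: le_trans (_ : _ <= nr x * (nr w * (nr w * nr x))) _; first by rewrite ler_wpM2l.
by rewrite [leLHS](_ : _ = nr w ^+ 2 * nr x ^+ 2)//; ring.
Qed.

(* |w - c| >= |c + it| - |w + it|, which is positive for a suitable t. *)
Lemma selfadj_bounded_below w c : selfadj w -> complex.Im c != 0 ->
  exists2 d : R, 0 < d & forall x, d * nr x <= nr (w ** x - c *: x).
Proof.
move=> ww; case: c => al be /= be0.
have be2 : 0 < be ^+ 2 by rewrite exprn_even_gt0.
(* Chosen so that 2 be t = 2 |w|^2, which makes X - Y = al^2 + be^2 + |w|^2 positive. *)
pose s := nr w ^+ 2 / be ^+ 2; pose t := s * be.
have s0 : 0 <= s by rewrite divr_ge0// sqr_ge0.
have sE : s * be ^+ 2 = nr w ^+ 2 by rewrite divfK// gt_eqF.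
pose X := al ^+ 2 + (be + t) ^+ 2; pose Y := nr w ^+ 2 + t ^+ 2.
have X0 : 0 <= X by rewrite addr_ge0// sqr_ge0.
have Y0 : 0 <= Y by rewrite addr_ge0// sqr_ge0.
have YX : Y < X by rewrite /X /Y /t; have := sqr_ge0 al; nra.
exists (Num.sqrt X - Num.sqrt Y) => [|x].
  by rewrite subr_gt0 ltr_sqrt// (le_lt_trans Y0).
have hY : nr (w ** x + ('i%C * t%:C) *: x) <= Num.sqrt Y * nr x.
  rewrite -(@ler_pXn2r _ 2) ?nnegrE ?nr_ge0 ?mulr_ge0 ?sqrtr_ge0 ?nr_ge0//.
  by rewrite exprMn sqr_sqrtr//; exact: nr_selfadj_shift.
have hX : nr ((al +i* be + 'i%C * t%:C) *: x) = Num.sqrt X * nr x.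
  rewrite nrZ; congr (_ * _); rewrite normc_def /=; congr (Num.sqrt (_ ^+ 2 + _ ^+ 2)).
    by rewrite !(mul0r, mul1r, mulr0); ring.
  by rewrite !(mul0r, mul1r, mulr0); ring.
have := nrB (w ** x + ('i%C * t%:C) *: x) (w ** x - (al +i* be) *: x).
have -> : w ** x + ('i%C * t%:C) *: x - (w ** x - (al +i* be) *: x) =
          (al +i* be + 'i%C * t%:C) *: x by lmod R[i].
by rewrite hX; lra.
Qed.
End BoundedBelow.

Section Idempotent.
Variables (R : realType) (A : cstarAlgType R) (q : A) (r : R).
Hypotheses (qq : q ** q = q) (qr : nr q <= r).
Implicit Types (x y v : A) (c : R[i]).

Let a := q ** star q.
Let w := 'i%C *: (q - star q).

Lemma idempotent_skew_selfadj : selfadj w.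
Proof.
by rewrite /selfadj /w !starE conj_i; lmod R[i].
Qed.

Lemma star_idempotent : star q ** star q = star q.
Proof. by rewrite -starM qq. Qed.

(** Here w^2 = q q^* + q^* q - q - q^*, and the second and last terms cancel on x = q x. *)
Lemma idempotent_modulus x : q ** x = x -> a ** x = x + w ** (w ** x).
Proof.
move=> qx; rewrite /w /a !smulE -!smulA.
have -> : q ** (q ** x) = x by rewrite !qx.
have -> : star q ** (star q ** x) = star q ** x by rewrite smulA star_idempotent.
by rewrite !qx; lmod_coef R[i]; ring: (@ii R).
Qed.

Let V x := q ** x = x.

Let Va x : V (a ** x).
Proof. by rewrite /V /a !smulA qq. Qed.

Let nr_a : nr a <= r ^+ 2.
Proof. by rewrite nr_Mstar lerXn2r ?nnegrE ?nr_ge0// (le_trans (nr_ge0 q)). Qed.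

(** On V, a - c = (w - k)(w + k) with k^2 = c - 1. For k not real both factors are bounded below, w
    being self-adjoint; for k real c is at least 1, hence exceeds r^2 >= |a|. *)
Lemma idempotent_bounded_below c :
  (forall t : R, 1 <= t <= r ^+ 2 -> c != t%:C) ->
  exists2 d : R, 0 < d & forall x, V x -> d * nr x <= nr (a ** x - c *: x).
Proof.
move=> cr; pose k := sqrtC (c - 1).
have kE : k ^+ 2 = c - 1 by rewrite sqrtCK.
have [k0|k0] := eqVneq (complex.Im k) 0; last first.
  have [d d0 hd] := selfadj_bounded_below idempotent_skew_selfadj k0.
  have kN0 : complex.Im (- k) != 0 by case: (k) k0 => ? ? /=; rewrite oppr_eq0.
  have [e e0 he] := selfadj_bounded_below idempotent_skew_selfadj kN0.
  exists (d * e) => [|x Vx]; first by rewrite mulr_gt0.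
  rewrite idempotent_modulus//.
  have -> : x + w ** (w ** x) - c *: x =
      w ** (w ** x - (- k) *: x) - k *: (w ** x - (- k) *: x).
    by rewrite !smulE; lmod_coef R[i]; ring: kE.
  by apply: le_trans (hd _); rewrite -mulrA ler_wpM2l ?(ltW d0).
have [s ks] : exists s : R, k = s%:C by exists (complex.Re k); case: (k) k0 => ? ? /= ->.
have cE : c = (1 + s ^+ 2)%:C by rewrite rmorphD rmorphXn rmorph1 /= -ks kE; ring.
have rs : r ^+ 2 < 1 + s ^+ 2.
  rewrite ltNge; apply/negP => h; have := cr (1 + s ^+ 2).
  by rewrite h lerDl sqr_ge0 cE eqxx => /(_ isT).
exists (1 + s ^+ 2 - r ^+ 2) => [|x Vx]; first by rewrite subr_gt0.
have := nrB (a ** x) (a ** x - c *: x); rewrite opprB addrC subrK cE nrZr.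
have := nrM a x; have := nr_ge0 x; have := nr_a.
rewrite ger0_norm ?addr_ge0 ?sqr_ge0//; nra.
Qed.

(** Over [R[i]] the polynomial splits; its linear factors are bounded below on V, which a maps into
    itself, so their bounds multiply. *)
Lemma idempotent_pact_bounded_below (p : {poly R[i]}) : p != 0 ->
  (forall t : R, 1 <= t <= r ^+ 2 -> p.[t%:C] != 0) ->
  exists2 d : R, 0 < d & forall x, V x -> d * nr x <= nr (pact (smul a) p x).
Proof.
move=> p0 hp; have [s ps] := closed_field_poly_normal p.
have al : linear (smul a) by move=> c x y; exact: smulPr.
have V0 : V 0 by rewrite /V smul0r.
have VL y : V y -> V (a ** y) by move=> _; exact: Va.
have VD (c : R[i]) y z : V y -> V z -> V (c *: y + z).
  by move=> Vy Vz; rewrite /V smulPr Vy Vz.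
have hs c : c \in s -> forall t : R, 1 <= t <= r ^+ 2 -> c != t%:C.
  move=> cs t /hp; apply: contra_neq => <-.
  rewrite ps hornerZ horner_prod (big_rem c)//= hornerXsubC subrr mul0r mulr0//.
rewrite ps; have {ps} : lead_coef p != 0 by rewrite lead_coef_eq0.
move: (lead_coef p) => l l0.
suff [d d0 hd] : exists2 d : R, 0 < d & forall x, V x ->
    d * nr x <= nr (pact (smul a) (\prod_(z <- s) ('X - z%:P)) x).
  have cl : 0 < cabs l by rewrite -ltcR cabsE normr_gt0.
  exists (cabs l * d) => [|x Vx]; first by rewrite mulr_gt0.
  by rewrite pactZ nrZ -mulrA ler_wpM2l ?(ltW cl)//; exact: hd.
elim: s hs => [|c s IHs] hs.
  by exists 1 => // x _; rewrite big_nil pact1// mul1r.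
have [d d0 hd] := IHs (fun z zs => hs z (@mem_behead _ (c :: s) z zs)).
have [e e0 he] := idempotent_bounded_below (hs c (mem_head c s)).
exists (e * d) => [|x Vx]; first by rewrite mulr_gt0.
rewrite big_cons pactM// -mulrA pactD pactX// -polyCN pactC scaleNr.
apply: le_trans (he _ _); first by rewrite ler_wpM2l ?(ltW e0)//; exact: hd.
by apply: (@pact_ind _ _ _ al V).
Qed.

(* Spectral mapping for a = q q^*, whose spectrum lies in {0} and [1, r^2].
   If g = f(a) a had norm M > N0, then k = g^* g / M^2 would have norm 1, while
   1 - k^2 is a polynomial in a without roots in [1, r^2]. *)
Lemma nr_pact_idempotent (f : {poly R[i]}) (N0 : R) :
  (forall t : R, 1 <= t <= r ^+ 2 -> t * cabs f.[t%:C] <= N0) -> 0 <= N0 ->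
  nr (pact (smul a) f a) <= N0.
Proof.
move=> hf N00; rewrite leNgt; apply/negP; set g := pact _ f a => hM.
pose M := nr g; have M0 : 0 < M by apply: le_lt_trans hM.
have al : linear (smul a) by move=> c x y; exact: smulPr.
have sa : selfadj a by rewrite /selfadj /a starM starK.
pose fc : {poly R[i]} := map_poly Num.conj f; pose F : {poly R[i]} := fc * 'X * f.
have starg : star g = pact (smul a) fc a.
  rewrite (@pact_wide _ _ (smul a) (size f) fc) ?size_map_poly// /g /pact.
  rewrite (big_morph star (@starD R A) (@star0 R A)); apply: eq_bigr => i _.
  rewrite starZ coef_map; congr (_ *: _).
  by elim: (nat_of_ord i) => //= j IH; rewrite starM IH sa;
    elim: j {IH} => //= j IH; rewrite -smulA IH.
pose h := star g ** g.
have actM p x y : pact (smul a) p x ** y = pact (smul a) p (x ** y).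
  apply: (@pact_morph _ _ _ (smul a) (smul a) (fun x => x ** y)) => //.
    by move=> c u v; rewrite smulPl.
  by move=> u; rewrite smulA.
have hE : h = pact (smul a) F a.
  by rewrite /h starg actM /F !pactM// pactX.
have hx x : h ** x = pact (smul a) (F * 'X) x.
  by rewrite hE actM pactM// pactX.
have hsa : selfadj h by exact: selfadj_star.
have nh : nr h = M ^+ 2 by rewrite /h nr_starM.
pose k := (M ^- 2)%:C *: h.
have ksa : selfadj k by rewrite /selfadj starZ conj_real hsa.
have nk : nr k = 1.
  by rewrite nrZr nh ger0_norm ?invr_ge0 ?sqr_ge0// mulVf// expf_neq0// gt_eqF.
have Vk x : V x -> V (k ** x).
  move=> Vx; rewrite /V /k smulZl smulZr hE actM; congr (_ *: _).
  apply: (@pact_ind _ _ _ al V) => //; rewrite /V ?smul0r// => c y z Vy Vz.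
  by rewrite smulPr Vy Vz.
have kV : V k.
  rewrite /V /k smulZr hE; congr (_ *: _).
  apply: (@pact_ind _ _ _ al V) => //; rewrite /V.
  - by rewrite /a smulA qq.
  - by rewrite smul0r.
  - by move=> c y z Vy Vz; rewrite smulPr Vy Vz.
(* Multiplication by h = g^* g is the action of F 'X, so P acts as 1 - k^2. On [1, r^2] its value is
   1 - (t |f(t)| / M)^4, positive because t |f(t)| <= N0 < M. *)
pose P : {poly R[i]} := 1 - (M ^- 4)%:C *: (F * 'X) ^+ 2.
have PE x : pact (smul a) P x = x - k ** (k ** x).
  rewrite /P pactD pact1 -scaleNr pactZ expr2 pactM// -!hx /k !smulE.
  have -> : (M ^- 4)%:C = (M ^- 2)%:C * (M ^- 2)%:C :> R[i].
    by rewrite -rmorphM -invfM -exprD.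
  by lmod R[i].
have P_root t : 1 <= t <= r ^+ 2 -> P.[t%:C] != 0.
  move=> ht; have hN := hf t ht.
  have -> : P.[t%:C] = (1 - (t * cabs f.[t%:C]) ^+ 4 / M ^+ 4)%:C.
    have ft : fc.[t%:C] = Num.conj f.[t%:C] by rewrite -[in LHS](conj_real t) horner_map.
    rewrite rmorphB rmorph1 rmorphM rmorphXn rmorphM /= cabsE.
    rewrite /P hornerD hornerN hornerZ horner_exp !hornerM !hornerX hornerC ft.
    have := normCK f.[t%:C]; set u := `|_| ; set v := f.[_]; set cv := v^* => uv.
    ring: uv.
  rewrite -(rmorph0 (real_complex R)) (inj_eq (@complexI _)) subr_eq0 eq_sym.
  rewrite lt_eqF// ltr_pdivrMr ?exprn_gt0// mul1r ltrXn2r//; first last.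
  - exact: le_lt_trans hM.
  - by rewrite mulr_ge0 ?cabs_ge0//; case/andP: ht; lra.
have P0 : P != 0.
  apply/eqP => /(congr1 (horner^~ 0)); rewrite /P hornerD hornerN hornerZ horner_exp
    hornerMX mulr0 expr0n mulr0 hornerC horner0 subr0.
  by move/eqP; rewrite oner_eq0.
have [d d0 hd] := idempotent_pact_bounded_below P0 P_root.
apply: (@bounded_below_peak _ _ V k d) => // x Vx.
by rewrite -PE; exact: hd.
Qed.
End Idempotent.

(** Constants independent of n vanish under n-th roots: if a > b > 0, Bernoulli's inequality makes
    (a / b)^n unbounded. *)
Lemma real_growth_le (R : realType) (a b c C : R) : 0 <= a -> 0 <= b -> 0 < c ->
  (forall n, c * a ^+ n.+1 <= C * b ^+ n.+1) -> a <= b.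
Proof.
move=> a0 b0 c0 h; rewrite leNgt; apply/negP => ba.
have a1 : 0 < a by apply: le_lt_trans ba.
have [b00|bN0] := eqVneq b 0.
  by have := h 0%N; rewrite b00 !expr1 mulr0 leNgt mulr_gt0.
have b1 : 0 < b by rewrite lt_def bN0.
pose s := a / b - 1; have s0 : 0 < s by rewrite subr_gt0 ltr_pdivlMr// mul1r.
have bern n : 1 + n%:R * s <= (1 + s) ^+ n.
  elim: n => [|n IH]; first by rewrite mul0r addr0 expr0.
  rewrite exprS -natr1; have : 0 <= n%:R :> R by []; have := ler_wpM2l (_ : 0 <= 1 + s) IH.
  by rewrite addr_ge0// ?(ltW s0)// => /(_ isT); nra.
have hb n : c * (1 + n.+1%:R * s) <= C.
  have := h n; rewrite -ler_pdivrMr ?exprn_gt0// -mulrA -expr_div_n => /(le_trans _); apply.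
  have -> : a / b = 1 + s by rewrite /s addrC subrK.
  by rewrite ler_wpM2l ?(ltW c0).
have C0 : 0 <= C.
  apply: le_trans (hb 0%N); rewrite mulr_ge0 ?(ltW c0)// addr_ge0// mulr_ge0// ltW//.
have := archi_boundP (divr_ge0 C0 (ltW (mulr_gt0 c0 s0))); set n := Num.bound _.
rewrite ltr_pdivrMr ?mulr_gt0// => hn.
have := hb n; rewrite leNgt => /negP; apply; apply: lt_le_trans hn _.
rewrite mulrCA ler_wpM2l ?(ltW c0)//; rewrite -natr1; have := ltW s0; lra.
Qed.

(** * Limits in the real-valued norm and norms of powers *)

Section RealNormLimits.
Variables (R : realType) (V : completeNormedModType R[i]).

Lemma nr_cauchy_cvg (u : nat -> V) :
  (forall e : R, 0 < e -> exists N, forall n, (N <= n)%N -> nr (u N - u n) < e) ->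
  exists x, forall e : R, 0 < e -> exists N, forall n, (N <= n)%N -> nr (x - u n) < e.
Proof.
move=> hu.
have creal (e : R[i]) : 0 < e -> e = (complex.Re e)%:C /\ 0 < complex.Re e.
  by move=> e0; rewrite -[0 < complex.Re e]ltcR cge0_ReK ?ltW.
have cu : cvg (u @ \oo).
  apply: cauchy_cvg; apply: cauchy_exP => e /creal[-> e0].
  have [N hN] := hu _ e0; exists (u N); exists N => // n /= Nn.
  by rewrite -ball_normE /= -nrE ltcR; apply: hN.
exists (lim (u @ \oo)) => e e0.
have eC : 0 < e%:C :> R[i] by rewrite ltcR.
have /cvgrPdist_lt /(_ _ eC) [N _ hN] := cu.
by exists N => n /hN /=; rewrite -nrE ltcR.
Qed.

Lemma nr_closed (S : set V) x : closed S ->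
  (forall e : R, 0 < e -> exists2 y, S y & nr (x - y) < e) -> S x.
Proof.
move=> Sc Sx; apply: Sc => B /nbhs_ballP[e /= e0 eB].
have re0 : 0 < complex.Re e by rewrite -(ltcR 0) cge0_ReK ?ltW.
have [y Sy xy] := Sx _ re0; exists y; split => //; apply: eB.
by rewrite -ball_normE /= -nrE -[e]cge0_ReK ?ltW// ltcR.
Qed.

Lemma nr_lt_eq0 (x : V) : (forall e : R, 0 < e -> nr x < e) -> x = 0.
Proof.
move=> h; apply/nr_eq0/le_anti; rewrite nr_ge0 andbT leNgt; apply/negP => x0.
by have := h _ x0; rewrite ltxx.
Qed.
End RealNormLimits.

Section Powers.
Variables (R : realType) (A : cstarAlgType R).
Implicit Types h : A.

(* spow h n is the power of exponent n + 1. *)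
Fixpoint spow h n := if n is m.+1 then h ** spow h m else h.

Lemma spowD h n m : spow h n ** spow h m = spow h (n + m).+1.
Proof. by elim: n => //= n IH; rewrite -smulA IH. Qed.

Lemma spow_selfadj h n : selfadj h -> selfadj (spow h n).
Proof.
move=> hh; elim: n => //= n IH; rewrite /selfadj starM IH hh.
by have := spowD h n 0; rewrite addn0.
Qed.

Lemma nr_spow_le h n : nr (spow h n) <= nr h ^+ n.+1.
Proof.
elim: n => [|n IH]; first by rewrite expr1.
by rewrite exprS; apply: le_trans (nrM _ _) _; rewrite ler_wpM2l ?nr_ge0.
Qed.

(** From h^n h^(n+2) = (h^(n+1))^2 and the C*-identity, |h^n| |h^(n+2)| >= |h^(n+1)|^2. Hence the
    induction carries two consecutive exponents. *)
Lemma nr_spow h n : selfadj h -> nr (spow h n) = nr h ^+ n.+1.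
Proof.
move=> hh; have [h0|h0] := eqVneq (nr h) 0.
  apply/le_anti; rewrite nr_spow_le h0 exprS mul0r; exact: nr_ge0.
have {}h0 : 0 < nr h by rewrite lt_def h0 nr_ge0.
suff [//] : nr (spow h n) = nr h ^+ n.+1 /\ nr (spow h n.+1) = nr h ^+ n.+2.
elim: n => [|n [IH1 IH2]]; first by rewrite /= nr_selfadj_sqr.
split=> //; apply/le_anti; rewrite nr_spow_le /=.
rewrite -(@ler_pM2l _ (nr h ^+ n.+1)) ?exprn_gt0// -IH1.
apply: le_trans (nrM _ _).
have -> : spow h n ** (h ** (h ** spow h n)) = spow h n.+1 ** spow h n.+1.
  by rewrite /= smulA; have := spowD h n 0; rewrite addn0 /= => ->.
rewrite nr_selfadj_sqr ?IH2; last exact: spow_selfadj.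
by rewrite IH1 -exprD -exprM muln2 -addnn !addSn !addnS.
Qed.
End Powers.

(** * The homomorphism defined by a pair of idempotents *)

Section Generators.
Variables (R : realType) (A : cstarAlgType R) (q : A).
Hypothesis qq : q ** q = q.
Implicit Types x y u v : A.

(** For y = q^* x idempotency gives y^* y = y^* (q y). Thus multiplying by q does not shrink
    elements already starting with q or q^*, which makes compressions faithful up to constants. *)
Lemma nr_idempotent_star x : nr (star q ** x) <= nr (q ** (star q ** x)).
Proof.
set y := star q ** x; have [y0|y0] := eqVneq (nr y) 0; first by rewrite y0 nr_ge0.
rewrite -(@ler_pM2l _ (nr y)) ?lt_def ?y0 ?nr_ge0// -expr2 -nr_starM.
have {1}-> : star y ** y = star y ** (q ** y).
  by rewrite {1 3}/y starM starK -!smulA (smulA q q) qq.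
by apply: le_trans (nrM _ _) _; rewrite nr_star.
Qed.

Lemma nr_idempotent_left u x : u = q \/ u = star q -> nr (u ** x) <= nr (q ** (u ** x)).
Proof. by case=> ->; rewrite ?smulA ?qq// -smulA nr_idempotent_star. Qed.

Lemma nr_idempotent_right u x : u = q \/ u = star q ->
  nr (x ** u) <= nr ((x ** u) ** star q).
Proof.
move=> hu; rewrite -(nr_star (x ** u)) -(nr_star (_ ** star q)) !starM starK.
by apply: nr_idempotent_left; case: hu => ->; rewrite ?starK; [right|left].
Qed.
End Generators.

Section PairedIdempotents.
Variables (R : realType) (A B : cstarAlgType R) (q : A) (p : B).
Hypotheses (qq : q ** q = q) (pp : p ** p = p).
Let a := q ** star q.
Let b := p ** star p.

(* The pairs (f(q, q^* ), f(p, p^* )), f ranging over the polynomials without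
   constant term in two noncommuting variables. *)
Inductive paired : A -> B -> Prop :=
| paired0 : paired 0 0
| paired_lin c x x' y y' : paired x x' -> paired y y' ->
    paired (c *: x + y) (c *: x' + y')
| paired_gen : paired q p
| paired_star_gen : paired (star q) (star p)
| paired_genM x x' : paired x x' -> paired (q ** x) (p ** x')
| paired_star_genM x x' : paired x x' -> paired (star q ** x) (star p ** x').

Lemma pairedM x x' y y' : paired x x' -> paired y y' -> paired (x ** y) (x' ** y').
Proof.
move=> Gx Gy; elim: Gx => [|c u u' v v' _ IHu _ IHv| | |u u' _ IH|u u' _ IH].
- by rewrite !smul0l; exact: paired0.
- by rewrite !smulPl; exact: paired_lin.
- exact: paired_genM.
- exact: paired_star_genM.
- by rewrite -!smulA; exact: paired_genM.
- by rewrite -!smulA; exact: paired_star_genM.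
Qed.

Lemma paired_star x x' : paired x x' -> paired (star x) (star x').
Proof.
elim=> [|c u u' v v' _ IHu _ IHv| | |u u' _ IH|u u' _ IH].
- by rewrite !star0; exact: paired0.
- by rewrite !starP; exact: paired_lin.
- exact: paired_star_gen.
- by rewrite !starK; exact: paired_gen.
- by rewrite !starM; apply: pairedM => //; exact: paired_star_gen.
- by rewrite !starM !starK; apply: pairedM => //; exact: paired_gen.
Qed.

(** Two claims are proved together because prefixing q^* turns the compression of x by q into that
    by a: q (q^* x) q^* = a x q^*. The same f serves both algebras. *)
Lemma paired_compression x x' : paired x x' ->
  (exists f : {poly R[i]}, q ** (x ** star q) = pact (smul a) f a /\
                           p ** (x' ** star p) = pact (smul b) f b) /\
  (exists f : {poly R[i]}, a ** (x ** star q) = pact (smul a) f a /\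
                           b ** (x' ** star p) = pact (smul b) f b).
Proof.
have al : linear (smul a) by move=> c u v; exact: smulPr.
have bl : linear (smul b) by move=> c u v; exact: smulPr.
have sq := star_idempotent qq; have sp := star_idempotent pp.
elim=> [|c u u' v v' _ [[f [f1 f2]] [g [g1 g2]]] _ [[h [h1 h2]] [k [k1 k2]]]| |
        |u u' _ [[f [f1 f2]] [g [g1 g2]]]|u u' _ [[f [f1 f2]] [g [g1 g2]]]].
- by split; exists 0; rewrite !pact0 !smul0l !smul0r.
- split; [exists (c *: f + h)|exists (c *: g + k)];
    by rewrite !pactD !pactZ !smulPl !smulPr ?f1 ?f2 ?g1 ?g2 ?h1 ?h2 ?k1 ?k2.
- split; [exists 1|exists 'X].
    by rewrite !pact1// !smulA qq pp.
  by rewrite !pactX.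
- by split; exists 1; rewrite !pact1// sq sp // /a /b -!smulA sq sp.
- split; [exists f|exists ('X * f)].
    by rewrite -f1 -f2 -!(smulA _ u) -!(smulA _ u') !(smulA q q) !(smulA p p) qq pp.
  by rewrite !pactM// !pactX// -f1 -f2 !smulA.
- split; [exists g|exists g]; rewrite -g1 -g2 /a /b -!smulA //.
  by rewrite !(smulA (star q) (star q)) !(smulA (star p) (star p)) sq sp.
Qed.

(** Every monomial ends in p or p^*, since there is no constant term. *)
Lemma paired_dominated x x' : paired x x' -> exists2 C, 0 <= C &
  forall v, nr (x' ** v) <= C * (nr (p ** v) + nr (star p ** v)).
Proof.
have S0 v : 0 <= nr (p ** v) + nr (star p ** v) by rewrite addr_ge0 ?nr_ge0.
elim=> [|c u u' v v' _ [C C0 hC] _ [D D0 hD]| | |u u' _ [C C0 hC]|u u' _ [C C0 hC]].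
- by exists 0 => // v; rewrite smul0l nr0 mul0r.
- exists (cabs c * C + D) => [|z]; first by rewrite addr_ge0 ?mulr_ge0 ?cabs_ge0.
  rewrite smulPl mulrDl; apply: le_trans (nrD _ _) _; apply: lerD => //.
  by rewrite nrZ -mulrA ler_wpM2l ?cabs_ge0.
- by exists 1 => // v; rewrite mul1r lerDl nr_ge0.
- by exists 1 => // v; rewrite mul1r lerDr nr_ge0.
- exists (nr p * C) => [|z]; first by rewrite mulr_ge0 ?nr_ge0.
  by rewrite -smulA -mulrA; apply: le_trans (nrM _ _) _; rewrite ler_wpM2l ?nr_ge0.
- exists (nr p * C) => [|z]; first by rewrite mulr_ge0 ?nr_ge0.
  rewrite -smulA -mulrA; apply: le_trans (nrM _ _) _.
  by rewrite nr_star ler_wpM2l ?nr_ge0.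
Qed.

Lemma paired_dominated_right x x' : paired x x' -> exists2 C, 0 <= C &
  forall v, nr (v ** x') <= C * (nr (v ** p) + nr (v ** star p)).
Proof.
move=> /paired_star/paired_dominated[C C0 hC]; exists C => // v.
by have := hC (star v); rewrite -!starM !nr_star -{1}[p]starK -starM nr_star addrC.
Qed.

Hypothesis corner_le : forall f : {poly R[i]},
  nr (pact (smul b) f b) <= nr (pact (smul a) f a).

(** Compressing u' x' v' by p and p^* does not decrease its norm, and lands on some f(b) b, to which
    [corner_le] applies. The four factors |q| come from q, u, v and q^*. *)
Lemma paired_compression_le u u' v v' x x' : paired x x' ->
  (u, u') = (q, p) \/ (u, u') = (star q, star p) ->
  (v, v') = (q, p) \/ (v, v') = (star q, star p) ->
  nr (u' ** (x' ** v')) <= nr q ^+ 4 * nr x.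
Proof.
move=> Gx hu hv.
have hu' : u' = p \/ u' = star p by case: hu => [[_ ->]|[_ ->]]; [left|right].
have hv' : v' = p \/ v' = star p by case: hv => [[_ ->]|[_ ->]]; [left|right].
have nu : nr u = nr q by case: hu => [[-> _]|[-> _]]; rewrite ?nr_star.
have nv : nr v = nr q by case: hv => [[-> _]|[-> _]]; rewrite ?nr_star.
have Gu : paired u u'.
  by case: hu => [[-> ->]|[-> ->]]; [exact: paired_gen|exact: paired_star_gen].
have Gv : paired v v'.
  by case: hv => [[-> ->]|[-> ->]]; [exact: paired_gen|exact: paired_star_gen].
apply: le_trans (nr_idempotent_left pp _ hu') _; rewrite !smulA.
apply: le_trans (nr_idempotent_right pp _ hv') _; rewrite -!smulA.
have /paired_compression[[f [f1 f2]] _] := pairedM Gu (pairedM Gx Gv).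
rewrite -!smulA in f1 f2; rewrite f2; apply: le_trans (corner_le f) _; rewrite -f1.
have q0 := nr_ge0 q; have x0 := nr_ge0 x.
have -> : nr q ^+ 4 * nr x = nr q * (nr q * (nr x * (nr q * nr q))) by ring.
apply: le_trans (nrM _ _) _; rewrite ler_wpM2l//.
apply: le_trans (nrM _ _) _; rewrite nu ler_wpM2l//.
apply: le_trans (nrM _ _) _; rewrite ler_wpM2l//.
by apply: le_trans (nrM _ _) _; rewrite nr_star nv.
Qed.

Lemma paired_nr_le x x' : paired x x' -> nr x' <= nr x.
Proof.
move=> Gx; pose h := star x ** x; pose h' := star x' ** x'.
have Gh : paired h h' by apply: pairedM => //; exact: paired_star.
have Gpow n : paired (spow h n) (spow h' n).
  by elim: n => //= n IH; exact: pairedM.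
have hsa : selfadj h' by exact: selfadj_star.
rewrite -(@ler_pXn2r _ 2) ?nnegrE ?nr_ge0// -!nr_starM -/h -/h'.
have [h0|h0] := eqVneq (nr h') 0; first by rewrite h0 nr_ge0.
have {}h0 : 0 < nr h' by rewrite lt_def h0 nr_ge0.
have [C C0 hC] := paired_dominated Gh.
have [D D0 hD] := paired_dominated_right Gh.
(* The power h'^(n+3) is split as h' h'^(n+1) h'; the outer factors are dominated by p and p^* on
   each side, leaving four compressions of h'^(n+1). *)
apply: (@real_growth_le _ _ _ (nr h' ^+ 2) (C * D * 4 * nr q ^+ 4));
  rewrite ?nr_ge0 ?exprn_gt0//.
move=> n; have -> : nr h' ^+ 2 * nr h' ^+ n.+1 = nr (spow h' 0 ** (spow h' n ** spow h' 0)).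
  by rewrite !spowD nr_spow// -exprD addn0.
have e u v : u = (q, p) \/ u = (star q, star p) -> v = (q, p) \/ v = (star q, star p) ->
    nr (u.2 ** (spow h' n ** v.2)) <= nr q ^+ 4 * nr h ^+ n.+1.
  case: u v => u u' [v v'] hu hv.
  apply: le_trans (paired_compression_le (Gpow n) hu hv) _.
  by rewrite ler_wpM2l ?exprn_ge0 ?nr_ge0// nr_spow_le.
have P1 : (q, p) = (q, p) \/ (q, p) = (star q, star p) by left.
have P2 : (star q, star p) = (q, p) \/ (star q, star p) = (star q, star p) by right.
have e1 := e _ _ P1 P1; have e2 := e _ _ P1 P2; have e3 := e _ _ P2 P1; have e4 := e _ _ P2 P2.
have f u : nr (u ** (spow h' n ** h')) <=
    D * (nr (u ** (spow h' n ** p)) + nr (u ** (spow h' n ** star p))).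
  by rewrite (smulA u _ h') (smulA u _ p) (smulA u _ (star p)).
apply: le_trans (hC _) _; rewrite -(mulrA _ (nr q ^+ 4)) -2!mulrA ler_wpM2l//.
set X := nr q ^+ 4 * _ in e1 e2 e3 e4 *.
have g1 : nr (p ** (spow h' n ** h')) <= D * (X + X).
  by apply: le_trans (f _) _; rewrite ler_wpM2l// lerD.
have g2 : nr (star p ** (spow h' n ** h')) <= D * (X + X).
  by apply: le_trans (f _) _; rewrite ler_wpM2l// lerD.
apply: le_trans (lerD g1 g2) _; lra.
Qed.

(** The homomorphism is handled as a closed relation: distinct words may represent the same element,
    and single-valuedness comes only from the norm inequality. *)
Definition paired_closure (x : A) (x' : B) := forall e : R, 0 < e ->
  exists y y', [/\ paired y y', nr (x - y) < e & nr (x' - y') < e].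

Lemma paired_paired_closure x x' : paired x x' -> paired_closure x x'.
Proof. by move=> Gx e e0; exists x, x'; rewrite !subrr !nr0. Qed.

Lemma paired_closure_lin c x x' y y' : paired_closure x x' -> paired_closure y y' ->
  paired_closure (c *: x + y) (c *: x' + y').
Proof.
move=> hx hy e e0; have c0 := cabs_ge0 c.
have d0 : 0 < e / (cabs c + 1) by rewrite divr_gt0// ltr_wpDl.
have [u [u' [Gu xu xu']]] := hx _ (divr_gt0 d0 (ltr0n _ 2)).
have [v [v' [Gv yv yv']]] := hy _ (divr_gt0 d0 (ltr0n _ 2)).
move: d0 xu xu' yv yv'; set d := e / _ => d0 xu xu' yv yv'.
have dE : cabs c * d + d = e by rewrite /d; field; rewrite gt_eqF// ltr_wpDl.
exists (c *: u + v), (c *: u' + v'); split; first exact: paired_lin.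
- have -> : c *: x + y - (c *: u + v) = c *: (x - u) + (y - v) by lmod R[i].
  apply: le_lt_trans (nrD _ _) _; rewrite nrZ; nra.
- have -> : c *: x' + y' - (c *: u' + v') = c *: (x' - u') + (y' - v') by lmod R[i].
  apply: le_lt_trans (nrD _ _) _; rewrite nrZ; nra.
Qed.

Lemma paired_closureM x x' y y' : paired_closure x x' -> paired_closure y y' ->
  paired_closure (x ** y) (x' ** y').
Proof.
move=> hx hy e e0.
pose K := nr x + nr y + nr x' + nr y' + 1.
have K0 : 0 < K by rewrite ltr_wpDl// !addr_ge0 ?nr_ge0.
pose d := Order.min 1 (e / (2 * K)).
have d0 : 0 < d by rewrite lt_min ltr01 divr_gt0// mulr_gt0.
have d1 : d <= 1 by rewrite ge_min lexx.
have dK : d * K < e.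
  apply: (@le_lt_trans _ _ (e / 2)); last lra.
  rewrite -ler_pdivlMr// -mulrA -invfM ge_min lexx orbT//.
have [u [u' [Gu xu xu']]] := hx _ d0; have [v [v' [Gv yv yv']]] := hy _ d0.
exists (u ** v), (u' ** v'); split; first exact: pairedM.
- apply: le_lt_trans (nr_smulB xu yv d1) _; apply: le_lt_trans dK.
  by rewrite ler_wpM2l ?(ltW d0)// /K; have := nr_ge0 x'; have := nr_ge0 y'; lra.
- apply: le_lt_trans (nr_smulB xu' yv' d1) _; apply: le_lt_trans dK.
  by rewrite ler_wpM2l ?(ltW d0)// /K; have := nr_ge0 x; have := nr_ge0 y; lra.
Qed.

Lemma paired_closure_star x x' : paired_closure x x' -> paired_closure (star x) (star x').
Proof.
move=> hx e e0; have [u [u' [Gu xu xu']]] := hx _ e0.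
exists (star u), (star u'); split; first exact: paired_star.
- by rewrite -starN -starD nr_star.
- by rewrite -starN -starD nr_star.
Qed.

Lemma paired_closure_nr_le x x' : paired_closure x x' -> nr x' <= nr x.
Proof.
move=> hx; apply/ler_addgt0Pr => e e0.
have [u [u' [Gu xu xu']]] := hx _ (divr_gt0 e0 (ltr0n _ 2)).
have := paired_nr_le Gu; have := nr_triangle x' u' 0; have := nr_triangle u x 0.
rewrite !subr0 (nr_distC u); lra.
Qed.

Lemma paired_closure_fun x x1 x2 :
  paired_closure x x1 -> paired_closure x x2 -> x1 = x2.
Proof.
move=> h1 h2; apply/eqP; rewrite -subr_eq0; apply/eqP/nr_eq0/le_anti.
have := paired_closure_lin (-1) h2 h1; rewrite !scaleN1r addNr addrC => /paired_closure_nr_le.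
by rewrite nr0 nr_ge0 => ->.
Qed.

Lemma paired_closure_exists x :
  (forall e : R, 0 < e -> exists y y', paired y y' /\ nr (x - y) < e) ->
  exists x', paired_closure x x'.
Proof.
move=> hx.
have inv_gt0 n : 0 < n.+1%:R^-1 :> R by rewrite invr_gt0.
pose w n := cid (hx _ (inv_gt0 n)); pose y n := sval (w n).
pose y' n := sval (cid (svalP (w n))).
have Gy n : paired (y n) (y' n) by case: (svalP (cid (svalP (w n)))).
have xy n : nr (x - y n) < n.+1%:R^-1 by case: (svalP (cid (svalP (w n)))).
have small (e : R) : 0 < e -> exists N, forall n, (N <= n)%N -> nr (x - y n) < e.
  move=> e0; have := archi_boundP (ltW (_ : 0 < e^-1)); rewrite invr_gt0 => /(_ e0).
  set N := Num.bound _ => hN; exists N => n Nn; apply: lt_trans (xy n) _.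
  rewrite -[e]invrK ltf_pV2 ?posrE ?invr_gt0//; apply: lt_le_trans hN _.
  by rewrite ler_nat ltnW.
have cauchy (e : R) : 0 < e -> exists N, forall n, (N <= n)%N -> nr (y' N - y' n) < e.
  move=> e0; have [N hN] := small _ (divr_gt0 e0 (ltr0n _ 2)); exists N => n Nn.
  have Gd : paired (y N - y n) (y' N - y' n).
    by have := paired_lin (-1) (Gy n) (Gy N); rewrite !scaleN1r ![- _ + _]addrC.
  apply: le_lt_trans (paired_nr_le Gd) _.
  have := nr_triangle (y N) x (y n); have := hN _ Nn; have := hN _ (leqnn N).
  by rewrite (nr_distC (y N) x); lra.
have [x' hx'] := nr_cauchy_cvg cauchy; exists x' => e e0.
have [N hN] := small _ e0; have [M hM] := hx' _ e0.
by exists (y (maxn N M)), (y' (maxn N M)); rewrite hN ?hM ?leq_maxl ?leq_maxr.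
Qed.

Lemma paired_cstar_gen x x' : paired x x' -> cstar_gen p x'.
Proof.
have [[_ S0 SD SM SS] Sp] := cstar_gen_subalgebra p.
elim=> [|c u u' v v' _ IHu _ IHv| | |u u' _ IH|u u' _ IH] //.
- exact: SD.
- exact: SS.
- exact: SM.
- by apply: SM => //; exact: SS.
Qed.

Lemma paired_closure_cstar_gen x x' : paired_closure x x' -> cstar_gen p x'.
Proof.
have [[Sc _ _ _ _] _] := cstar_gen_subalgebra p.
move=> hx; apply: (nr_closed Sc) => e e0; have [u [u' [Gu _ xu']]] := hx _ e0.
by exists u' => //; exact: paired_cstar_gen Gu.
Qed.

(** The domain of the relation is a C*-subalgebra containing q; it is closed because the relation is
    contractive and B is complete. *)
Lemma cstar_gen_paired_closure x : cstar_gen q x -> exists x', paired_closure x x'.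
Proof.
move=> hx; apply: (hx [set y | exists y', paired_closure y y']).
split; last by move=> _ ->; exists p; apply: paired_paired_closure; exact: paired_gen.
split.
- move=> x0 clx; apply: paired_closure_exists => e e0.
  have e20 : 0 < (e / 2)%:C :> R[i] by rewrite ltcR divr_gt0.
  have [y [[y' hy] xy]] := clx _ (nbhsx_ballx x0 _ e20).
  have [u [u' [Gu yu _]]] := hy _ (divr_gt0 e0 (ltr0n _ 2)).
  exists u, u'; split => //; apply: le_lt_trans (nr_triangle _ y _) _.
  by move: xy; rewrite -ball_normE /= -nrE ltcR; lra.
- by exists 0; apply: paired_paired_closure; exact: paired0.
- by move=> c y z [y' hy] [z' hz]; exists (c *: y' + z'); exact: paired_closure_lin.
- by move=> y z [y' hy] [z' hz]; exists (y' ** z'); exact: paired_closureM.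
- by move=> y [y' hy]; exists (star y'); exact: paired_closure_star.
Qed.

Lemma star_hom_of_corner_le : exists2 pi : A -> B,
  star_hom (cstar_gen q) (cstar_gen p) pi & pi q = p.
Proof.
(* [star_hom] constrains [pi] on [cstar_gen q] only, so the default 0 is harmless. *)
pose pi x := xget 0 [set x' | paired_closure x x'].
have piP x : cstar_gen q x -> paired_closure x (pi x).
  by move=> /cstar_gen_paired_closure[x' hx']; rewrite /pi; case: xgetP => [y _ //|/(_ _ hx')].
have [[_ S0 SD SM SS] Sq] := cstar_gen_subalgebra q.
exists pi; last first.
  by apply: paired_closure_fun (piP _ Sq) _; apply: paired_paired_closure; exact: paired_gen.
split=> [x /piP/paired_closure_cstar_gen //|c x y hx hy|x y hx hy|x hx].
- apply: paired_closure_fun (piP _ (SD _ _ _ hx hy)) _.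
  by apply: paired_closure_lin; exact: piP.
- apply: paired_closure_fun (piP _ (SM _ _ hx hy)) _.
  by apply: paired_closureM; exact: piP.
- by apply: paired_closure_fun (piP _ (SS _ hx)) _; apply: paired_closure_star; exact: piP.
Qed.
End PairedIdempotents.

(** * Operators on a Hilbert space *)

Section IteratedLimits.
Variables (R : realType) (V : completeNormedModType R[i]).

(** Majorant method: t is nondecreasing and bounded, so its tails, which dominate those of u, are
    small. *)
Lemma nr_increments_cvg (u : nat -> V) (t : nat -> R) (M : R) :
  (forall n, nr (u n.+1 - u n) <= t n.+1 - t n) -> (forall n, t n <= M) ->
  exists x, forall e : R, 0 < e -> exists N, forall n, (N <= n)%N -> nr (x - u n) < e.
Proof.
move=> ut tM; apply: nr_cauchy_cvg => e e0.
have tsup : has_sup (range t) by split; [exists (t 0%N), 0%N|exists M => _ [n _ <-]].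
have [_ [N _ <-] hN] := sup_adherent e0 tsup; exists N => n Nn.
have h m : nr (u (N + m)%N - u N) <= t (N + m)%N - t N.
  elim: m => [|m IH]; first by rewrite addn0 !subrr nr0.
  rewrite addnS; apply: le_trans (nr_triangle _ (u (N + m)%N) _) _.
  have := ut (N + m)%N; lra.
have := h (n - N)%N; rewrite subnKC// nr_distC => hn.
have : t n <= sup (range t) by apply: sup_upper_bound => //; exists n.
lra.
Qed.

(** K may exceed 1: convergence is given, and only continuity of f along the iterates is needed. *)
Lemma nr_fixpoint (f : V -> V) (u : nat -> V) (x : V) (K : R) :
  (forall n, u n.+1 = f (u n)) ->
  (forall e : R, 0 < e -> exists N, forall n, (N <= n)%N -> nr (x - u n) < e) ->
  (forall n, nr (f x - f (u n)) <= K * nr (x - u n)) -> f x = x.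
Proof.
move=> uf ux fK; apply/eqP; rewrite -subr_eq0; apply/eqP/nr_lt_eq0 => e e0.
have K0 : 0 < `|K| + 1 by rewrite ltr_wpDl.
have [N hN] := ux _ (divr_gt0 e0 (addr_gt0 K0 ltr01)).
have h1 := hN _ (leqnn N); have h2 := hN _ (leqnSn N).
have := nr_triangle (f x) (f (u N)) x; have := fK N.
rewrite -uf (nr_distC (u N.+1)).
move: h1 h2; set d := e / _; have dE : d * (`|K| + 1 + 1) = e.
  by rewrite /d divfK// gt_eqF// addr_gt0.
have := ler_norm K; have := nr_ge0 (x - u N); nra.
Qed.

(** The Neumann series of T at s. Decay is demanded on the orbit of s alone, since T itself need not
    be a contraction; the clause on S later places the sum in C*{Q}. *)
Lemma nr_geometric_fixpoint (T : V -> V) (s : V) (C th K : R) :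
  linear T -> 0 <= th < 1 -> (forall x, nr (T x) <= K * nr x) ->
  (forall n, nr (iter n T s) <= C * th ^+ n) ->
  exists2 y, y = s + T y &
    forall S : set V, closed S -> S 0 -> (forall x, S x -> S (s + T x)) -> S y.
Proof.
move=> Tl /andP[th0 th1] TK Ts.
have TB x y : T (x - y) = T x - T y.
  by have := Tl (-1) y x; rewrite !scaleN1r ![- _ + _]addrC.
pose f y := s + T y; pose u n := iter n f 0.
have T0 : T 0 = 0 by have := TB 0 0; rewrite !subrr.
have du n : u n.+1 - u n = iter n T s.
  elim: n => [|n IH]; first by rewrite /u /= /f T0 addr0 subr0.
  rewrite [RHS]/= -IH TB /u /= /f; lmod R[i].
pose t n : R := C * (1 - th ^+ n) / (1 - th).
have th1' : 1 - th != 0 by rewrite gt_eqF// subr_gt0.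
have C0 : 0 <= C by have := Ts 0%N; rewrite expr0 mulr1 => /(le_trans (nr_ge0 _)).
have [||y uy] := @nr_increments_cvg u t (C / (1 - th)).
- move=> n; rewrite du; apply: le_trans (Ts n) _.
  rewrite le_eqVlt; apply/orP; left; apply/eqP; rewrite /t exprS; field => //.
- move=> n; rewrite /t -mulrA ler_wpM2l// ler_pdivrMr ?subr_gt0// mulVf//.
  by have := exprn_ge0 n th0; lra.
have fy : f y = y.
  apply: (nr_fixpoint (u := u) (K := K)) => // n.
  have -> : f y - f (u n) = T (y - u n) by rewrite TB /f; lmod R[i].
  exact: TK.
exists y => // S Sc S0 Sf; apply: (nr_closed Sc) => e e0.
have [N hN] := uy _ e0; exists (u N); last exact: hN.
by elim: N {hN} => //= n IH; exact: Sf.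
Qed.
End IteratedLimits.

(* The iteration y <- (s + y^2) / 2 computes 1 - (1 - s)^(1/2). Its increments
   are dominated by those of the same iteration started from s = 1 in R. *)
Lemma sqrt_iteration (R : realType) (A : cstarAlgType R) (s : A) :
  selfadj s -> nr s <= 1 ->
  exists y, [/\ selfadj y, nr y <= 1 & 2 *: y = s + y ** y].
Proof.
move=> ss s1.
pose f y := 2^-1%:C *: (s + y ** y); pose u n := iter n f 0.
pose t n := iter n (fun x : R => 2^-1 * (1 + x ^+ 2)) 0.
have fB x y : nr (f x - f y) <= 2^-1 * (nr (x - y) * (nr x + nr y)).
  (* The difference of squares is symmetrised because x and y need not commute. *)
  have -> : f x - f y = 2^-1%:C *: (2^-1%:C *: ((x - y) ** (x + y) + (x + y) ** (x - y))).
    rewrite /f !smulE; have -> : 2^-1%:C = 2^-1 :> R[i] by rewrite fmorphV rmorph_nat.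
    by lmod_coef R[i]; field.
  rewrite nrZr ger0_norm ?invr_ge0// ler_wpM2l ?invr_ge0// nrZr ger0_norm ?invr_ge0//.
  have := nrD ((x - y) ** (x + y)) ((x + y) ** (x - y)).
  have := nrM (x - y) (x + y); have := nrM (x + y) (x - y).
  have := nrD x y; have := nr_ge0 (x - y); nra.
have t01 n : 0 <= t n <= 1.
  by elim: n => [|n /andP[h0 h1]]; rewrite /t /= ?lexx ?ler01// -/(t n);
    apply/andP; split; nra.
have ut n : nr (u n) <= t n.
  elim: n => [|n IH]; first by rewrite nr0.
  rewrite /u /t /= -/(u n) -/(t n) nrZr ger0_norm ?invr_ge0// ler_wpM2l ?invr_ge0//.
  have := nrD s (u n ** u n); have := nrM (u n) (u n); have := nr_ge0 (u n); nra.
have usa n : selfadj (u n).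
  by elim: n => [|n IH]; rewrite /selfadj ?star0// /u /= -/(u n) !starE conj_real ss IH.
have [||y uy] := @nr_increments_cvg _ _ u t 1.
- elim=> [|n IH].
    rewrite /u /t /= !subr0 /f smul0l addr0 nrZr ger0_norm ?invr_ge0// expr0n /= addr0.
    by rewrite ler_wpM2l ?invr_ge0.
  have tS k : t k.+1 = 2^-1 * (1 + t k ^+ 2) by [].
  apply: le_trans (fB (u n.+1) (u n)) _.
  have := tS n.+1; have := tS n.
  have : nr (u n.+1 - u n) * (nr (u n.+1) + nr (u n)) <=
      (t n.+1 - t n) * (t n.+1 + t n).
    by apply: ler_pM => //; rewrite ?addr_ge0 ?nr_ge0// lerD.
  by lra.
- by move=> n; case/andP: (t01 n).
have fy : f y = y.
  apply: (nr_fixpoint (u := u) (K := nr y + 1)) => // n.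
  apply: le_trans (fB _ _) _; have := ut n; have /andP[_] := t01 n.
  have := nr_ge0 (y - u n); have := nr_ge0 y; nra.
exists y; split.
- apply/eqP; rewrite -subr_eq0; apply/eqP/nr_lt_eq0 => e e0.
  have [N hN] := uy _ (divr_gt0 e0 (ltr0n _ 2)); have {}hN := hN _ (leqnn N).
  apply: le_lt_trans (nr_triangle _ (u N) _) _.
  rewrite (nr_distC (u N)); have -> : nr (star y - u N) = nr (y - u N).
    by rewrite -[in LHS](usa N) -starN -starD nr_star.
  by lra.
- apply/ler_addgt0Pr => e e0; have [N hN] := uy _ e0; have {}hN := hN _ (leqnn N).
  have := nr_triangle y (u N) 0; rewrite !subr0; have := ut N; have /andP[_] := t01 N.
  by lra.
- rewrite -[in LHS]fy /f scalerA; have -> : 2 * 2^-1%:C = 1 :> R[i].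
    by rewrite fmorphV rmorph_nat divff ?pnatr_eq0.
  by rewrite scale1r.
Qed.

Section HilbertOperators.
Variables (R : realType) (H : hilbertType R).
Implicit Types (S T P : bop H H) (x y : H).

Lemma nr_bop (K : hilbertType R) (T : bop H K) x : nr (T x) <= nr T * nr x.
Proof. by rewrite -lecR rmorphM /= !nrE; exact: bop_normP. Qed.

Lemma nr_bop_le (K : hilbertType R) (T : bop H K) (M : R) : 0 <= M ->
  (forall x, nr (T x) <= M * nr x) -> nr T <= M.
Proof.
move=> M0 h; rewrite -lecR nrE; apply: opnorm_le; first by rewrite ler0c.
by move=> x; rewrite -!nrE -rmorphM lecR.
Qed.

Lemma bop_lD (K : hilbertType R) (T : bop H K) x y : T (x + y) = T x + T y.
Proof. exact: linearD. Qed.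
Lemma bop_lB (K : hilbertType R) (T : bop H K) x y : T (x - y) = T x - T y.
Proof. exact: linearB. Qed.
Lemma bop_lZ (K : hilbertType R) (T : bop H K) c x : T (c *: x) = c *: T x.
Proof. exact: linearZ. Qed.
Lemma bop_l0 (K : hilbertType R) (T : bop H K) : T 0 = 0.
Proof. exact: linear0. Qed.
Lemma bop_lN (K : hilbertType R) (T : bop H K) x : T (- x) = - T x.
Proof. exact: linearN. Qed.
Definition bop_linE := (bop_lD, bop_lB, bop_lN, bop_lZ, bop_l0).

Lemma bcompE S T : S \op T = S ** T. Proof. by []. Qed.
Lemma adjE T : adj T = star T. Proof. by []. Qed.
Lemma smul_bopE S T x : (S ** T) x = S (T x). Proof. by []. Qed.
Lemma bidE x : (bid : bop H H) x = x. Proof. by []. Qed.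
Lemma smul1l T : bid ** T = T. Proof. exact: bopP. Qed.
Lemma smul1r T : T ** bid = T. Proof. exact: bopP. Qed.
Lemma inner_star T x y : inner (T x) y = inner x (star T y).
Proof. exact: adjP. Qed.
Lemma star_bid : star (bid : bop H H) = bid.
Proof. by apply: bopP => x; apply: innerI => z; rewrite -inner_star. Qed.

Definition bop_simp := (bopDE, bopBE, bopNE, bopZE, bidE).

Lemma inner_nr x : inner x x = (nr x ^+ 2)%:C.
Proof. by rewrite inner_normE rmorphXn /= nrE. Qed.

Lemma selfadjP T : (forall x y, inner (T x) y = inner x (T y)) -> selfadj T.
Proof. by move=> h; apply: bopP => x; apply: innerI => z; rewrite -inner_star h. Qed.

(** Polarisation: the form is real at x + y and at x + i y, which yields the imaginary and the real
    part of the identity. *)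
Lemma positive_selfadj T : positive_op T -> selfadj T.
Proof.
move=> Tp; apply: selfadjP => x y.
have Im0 z : complex.Im (inner (T z) z) = 0.
  by have := Tp z; rewrite lecE => /andP[/eqP].
have h1 := Im0 (x + y); have h2 := Im0 (x + 'i%C *: y).
move: h1 h2; rewrite !bop_linE !innerDl !innerDr !innerZl !innerZr conj_i.
have := Im0 x; have := Im0 y; rewrite (innerC x).
rewrite conj_complexE.
case: (inner (T x) x) => ? ? /=; case: (inner (T y) y) => ? ? /=.
case: (inner (T x) y) => a b /=; case: (inner (T y) x) => c d /=.
rewrite !(mul0r, mul1r, oppr0, mulr0, addr0, add0r, subr0) => -> ->.
move=> h1 h2; apply/eqP; rewrite eq_complex /=; apply/andP; split; apply/eqP; lra.
Qed.

(** The form of T is nonnegative at x - t T x; taking t = 1 / k and bounding the form at x and at T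
    x by k gives |T x|^2 <= k^2 |x|^2. *)
Lemma positive_nr_le T (k : R) : positive_op T -> 0 <= k ->
  (forall x, complex.Re (inner (T x) x) <= k * nr x ^+ 2) -> nr T <= k.
Proof.
move=> Tp k0 Tk; have Ts := positive_selfadj Tp.
have pos x : 0 <= complex.Re (inner (T x) x).
  by have := Tp x; rewrite lecE => /andP[].
apply: nr_bop_le => // x; set y := T x.
have quad (t : R) : 0 <= complex.Re (inner (T x) x) - 2 * t * nr y ^+ 2
    + t ^+ 2 * complex.Re (inner (T y) y).
  have := pos (x - t%:C *: y).
  rewrite !bop_linE !innerBl !innerBr !innerZl !innerZr conj_real.
  rewrite (inner_star T y x) Ts -/y inner_nr.
  rewrite -!rmorphM /=; case: (inner (T y) y) => u v /=; case: (inner y x) => e f /=.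
  by rewrite !(mul0r, mulr0, subr0, oppr0, addr0); lra.
have A := Tk x; have C := Tk y; have x0 := nr_ge0 x; have y0 := nr_ge0 y.
rewrite -(@ler_pXn2r _ 2) ?nnegrE ?mulr_ge0// exprMn.
have [k00|kN0] := eqVneq k 0.
  have := quad 1; move: A C; rewrite k00 !mul0r; lra.
have {}k0 : 0 < k by rewrite lt_def kN0.
have := quad k^-1; set B := nr y ^+ 2 in C *; set X := nr x ^+ 2 in A *.
have e : k^-1 ^+ 2 * (k * B) = k^-1 * B by field.
have := ler_wpM2l (sqr_ge0 k^-1) C; rewrite e => C' q.
have q1 : k^-1 * B <= k * X by lra.
by move: q1; rewrite ler_pdivrMl// expr2 mulrA.
Qed.

Lemma bounded_below_contraction T (d : R) : 0 < d ->
  (forall x, d * nr x <= nr (T x)) -> exists K th : R, [/\ 0 < K, 0 <= th < 1,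
    selfadj (bid - K^-1%:C *: (star T ** T)) &
    nr (bid - K^-1%:C *: (star T ** T)) <= th].
Proof.
move=> d0 Td; set P := star T ** T.
have Pn x : inner (P x) x = (nr (T x) ^+ 2)%:C.
  by rewrite smul_bopE inner_star starK inner_nr.
(* T^* T lies between d^2 and |T|^2, so 1 - T^* T / K lies between 0 and 1 - d^2 / K. The summand
   d^2 keeps K positive even on the zero space. *)
pose K := nr T ^+ 2 + d ^+ 2.
have d2 : 0 < d ^+ 2 by rewrite exprn_gt0.
have K0 : 0 < K by rewrite ltr_wpDl ?sqr_ge0.
set e : bop H H := bid - K^-1%:C *: P.
have en x : inner (e x) x = (nr x ^+ 2 - K^-1 * nr (T x) ^+ 2)%:C.
  by rewrite !bop_simp innerBl innerZl Pn inner_nr rmorphB (rmorphM _ K^-1).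
have hT x : nr (T x) ^+ 2 <= K * nr x ^+ 2.
  have := nr_bop T x; have := nr_ge0 (T x); have := nr_ge0 x; have := nr_ge0 T.
  move=> h1 h2 h3 h4; have : nr (T x) ^+ 2 <= (nr T * nr x) ^+ 2.
    by rewrite ler_pXn2r ?nnegrE ?mulr_ge0.
  rewrite /K exprMn mulrDl => /le_trans; apply; rewrite lerDl mulr_ge0// ?sqr_ge0//.
have ep : positive_op e.
  move=> x; rewrite en ler0c subr_ge0 ler_pdivrMl//.
pose th := 1 - d ^+ 2 / K.
have th01 : 0 <= th < 1.
  rewrite /th subr_ge0 ltrBlDr ltrDl divr_gt0// andbT ler_pdivrMr// mul1r lerDr sqr_ge0//.
have nth' : nr e <= th.
  apply: positive_nr_le => //; first by case/andP: th01.
  move=> x; rewrite en /= /th mulrBl mul1r lerD2l lerN2 mulrAC [leRHS]mulrC.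
  rewrite ler_wpM2r ?invr_ge0 ?(ltW K0)//.
  by rewrite -exprMn ler_pXn2r ?nnegrE ?mulr_ge0 ?nr_ge0// ?(ltW d0).
by exists K, th; split=> //; exact: positive_selfadj.
Qed.

Lemma bounded_below_left_inverse T (d : R) : 0 < d ->
  (forall x, d * nr x <= nr (T x)) -> exists S, S ** (star T ** T) = bid /\
  (star T ** T) ** S = bid.
Proof.
move=> d0 /(bounded_below_contraction d0)[K [th [K0 th01 _ nth']]].
move: nth'; set P := star T ** T; set e := bid - _ => nth'.
have [|||y yE _] := @nr_geometric_fixpoint R (bop H H) (smul e) bid
  (nr (bid : bop H H)) th (nr e) _ th01.
- by move=> c u v; exact: smulPr.
- by move=> x; exact: nrM.
- elim=> [|n IH]; first by rewrite expr0 mulr1.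
  rewrite iterS exprS mulrCA; apply: le_trans (nrM _ _) _.
  by apply: ler_pM => //; exact: nr_ge0.
have Py : P ** (K^-1%:C *: y) = bid.
  have : y - e ** y = bid by rewrite {1}yE addrK.
  by rewrite /e smulDl smul1l smulNl smulZl opprD addNKr opprK smulZr.
exists (K^-1%:C *: y); split => //.
(* The series gives a right inverse of the self-adjoint P; its adjoint is a left inverse, so the two
   coincide. *)
have := congr1 star Py; rewrite starM star_bid /P starM starK -/P => h.
suff <- : star (K^-1%:C *: y) = K^-1%:C *: y by [].
by rewrite -[LHS]smul1r -Py smulA h smul1l.
Qed.

(** If S inverts T^* T, normality makes S commute with T^*, and S T^* is a two-sided inverse. *)
Lemma normal_invertible T (d : R) : star T ** T = T ** star T -> 0 < d ->
  (forall x, d * nr x <= nr (T x)) -> exists S, bop_inverse T S.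
Proof.
move=> Tn d0 /(bounded_below_left_inverse d0)[S [h1 h2]].
have e : S ** star T = star T ** S.
  by rewrite -[LHS]smul1r -h2 Tn -!smulA (smulA (star T)) (smulA S) h1 smul1l.
exists (S ** star T); split; rewrite bcompE; first by rewrite -smulA.
by rewrite e smulA -Tn.
Qed.
End HilbertOperators.

(** * Square roots, inverses and Moore-Penrose inverses *)

Section SquareRoots.
Variables (R : realType) (H : hilbertType R).
Implicit Types T S : bop H H.

Lemma positive_sqrt_exists T : positive_op T -> exists S, positive_op S /\ S ** S = T.
Proof.
move=> Tp; have Ts := positive_selfadj Tp.
pose K := nr T + 1; have K0 : 0 < K by rewrite ltr_wpDl ?nr_ge0.
pose s : bop H H := bid - K^-1%:C *: T.
have Re_le (S : bop H H) x : complex.Re (inner (S x) x) <= nr S * nr x ^+ 2.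
  apply: le_trans (Re_inner_le _ _) _; rewrite expr2 mulrA ler_wpM2r ?nr_ge0//.
  exact: nr_bop.
have sn x : inner (s x) x = (nr x ^+ 2 - K^-1 * complex.Re (inner (T x) x))%:C.
  rewrite !bop_simp innerBl innerZl inner_nr rmorphB (rmorphM _ K^-1) /=.
  by rewrite cge0_ReK.
have sp : positive_op s.
  move=> x; rewrite sn ler0c subr_ge0 ler_pdivrMl//.
  apply: le_trans (Re_le _ _) _; rewrite /K mulrDl mul1r lerDl sqr_ge0//.
have s1 : nr s <= 1.
  apply: positive_nr_le => // x; rewrite sn /= mul1r lerBlDr lerDl.
  rewrite mulr_ge0 ?invr_ge0 ?(ltW K0)//.
  by have := Tp x; rewrite lecE => /andP[].
have [y [ys y1 yE]] := sqrt_iteration (positive_selfadj sp) s1.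
(* 2 y = s + y^2 gives (1 - y)^2 = 1 - s = T / K. *)
exists ((Num.sqrt K)%:C *: (bid - y)); split.
  move=> x; rewrite !bop_simp innerZl innerBl inner_nr mulr_ge0 ?ler0c ?sqrtr_ge0//.
  have Im0 : complex.Im (inner (y x) x) = 0.
    have := innerC (y x) x.
    rewrite (_ : inner x (y x) = inner (y x) x); last by rewrite inner_star ys.
    rewrite conj_complexE; case: (inner _ _) => u v /= /eqP.
    by rewrite eq_complex /= => /andP[_ /eqP]; lra.
  have := Re_le y x; have := y1; have := sqr_ge0 (nr x).
  case: (inner (y x) x) Im0 => u v /= -> h1 h2 h3.
  by rewrite lecE /= oppr0 addr0 eqxx /= subr_ge0; nra.
rewrite smulZl smulZr scalerA -rmorphM /= -expr2 sqr_sqrtr ?(ltW K0)//.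
have -> : (bid - y) ** (bid - y) = bid - 2 *: y + y ** y.
  by rewrite !(smulDl, smulDr, smulNl, smulNr) !smul1l !smul1r; lmod R[i].
rewrite yE opprD addrA subrK /s subKr scalerA -rmorphM /= divff ?gt_eqF//.
by rewrite scale1r.
Qed.

Lemma sqrt_opP T : positive_op T ->
  positive_op (sqrt_op T) /\ sqrt_op T ** sqrt_op T = T.
Proof.
move=> /positive_sqrt_exists[S hS]; rewrite /sqrt_op.
by case: xgetP => [S' _ //|/(_ _ hS)].
Qed.

Lemma positive_Mstar T : positive_op (T ** star T).
Proof. by move=> x; rewrite smul_bopE inner_star inner_nr ler0c sqr_ge0. Qed.

Lemma inv_opP T S : bop_inverse T S ->
  inv_op T ** T = bid /\ T ** inv_op T = bid.
Proof. by move=> hS; rewrite /inv_op; case: xgetP => [S' _ //|/(_ _ hS)]. Qed.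

Lemma moore_penrose_uniq T X Y : moore_penrose T X -> moore_penrose T Y -> X = Y.
Proof.
rewrite /moore_penrose !bcompE !adjE => -[x1 x2 x3 x4] [y1 y2 y3 y4].
have TXY : T ** X = T ** Y.
  have := congr1 (fun Z => star (Z ** X)) y1.
  rewrite /= -(smulA _ T X) starM x3 y3 => <-.
  by rewrite !smulA x1.
have XYT : X ** T = Y ** T.
  have := congr1 (fun Z => star (Y ** Z)) x1.
  rewrite /= -(smulA T X T) smulA starM x4 y4 => <-.
  by rewrite -!smulA (smulA T) y1.
by rewrite -x2 XYT -smulA TXY smulA.
Qed.

Lemma pinv_opP T X : moore_penrose T X -> pinv_op T = X.
Proof.
move=> hX; rewrite /pinv_op; case: xgetP => [Y _ hY|/(_ _ hX)//].
exact: moore_penrose_uniq hY hX.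
Qed.

Lemma inverse_comm (z zi X : bop H H) : zi ** z = bid -> z ** zi = bid ->
  z ** X = X ** z -> zi ** X = X ** zi.
Proof.
by move=> h1 h2 zX; rewrite -[LHS]smul1r -h2 !smulA -(smulA zi X) -zX smulA h1 smul1l.
Qed.

Lemma inverse_selfadj (z zi : bop H H) : zi ** z = bid -> z ** zi = bid ->
  selfadj z -> selfadj zi.
Proof.
move=> h1 h2 zs; have := congr1 star h2; rewrite starM star_bid zs => h.
by rewrite /selfadj -[LHS]smul1r -h2 smulA h smul1l.
Qed.
End SquareRoots.

(** * The matched projection *)

Section MatchedProjection.
Variables (R : realType) (H : hilbertType R) (Q : bop H H).
Hypothesis QQ : Q ** Q = Q.

Local Notation Qs := (star Q).
Local Notation a := (Q ** Qs).
Local Notation w := ('i%C *: (Q - Qs)).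
Local Notation z := (bid + w ** w).

Let QsQs : Qs ** Qs = Qs. Proof. exact: star_idempotent. Qed.

Lemma idempotent_centralE : z = bid + (Q ** Qs + Qs ** Q - Q - Qs).
Proof.
rewrite !smulE QQ QsQs; congr (_ + _).
by lmod_coef R[i]; ring: (@ii R).
Qed.

Lemma idempotent_central_smul : z ** Q = Q ** Qs ** Q.
Proof.
by rewrite idempotent_centralE !smulE smul1l -!smulA QQ; lmod R[i].
Qed.

Lemma idempotent_centralC : z ** Q = Q ** z.
Proof.
rewrite idempotent_central_smul idempotent_centralE !smulE smul1r !smulA QQ.
by lmod R[i].
Qed.

Lemma idempotent_central_selfadj : selfadj z.
Proof.
rewrite /selfadj starD star_bid; congr (_ + _).
by rewrite starM !(idempotent_skew_selfadj Q).
Qed.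

Lemma idempotent_central_starC : z ** Qs = Qs ** z.
Proof.
have := congr1 star idempotent_centralC.
by rewrite !starM idempotent_central_selfadj => ->.
Qed.

Let z_inv : exists zi, zi ** z = bid /\ z ** zi = bid.
Proof.
apply: (@normal_invertible _ _ z 1); rewrite ?idempotent_central_selfadj//.
move=> x; rewrite mul1r; have [x0|x0] := eqVneq (nr x) 0; first by rewrite x0 nr_ge0.
rewrite -(@ler_pM2r _ (nr x)) ?lt_def ?x0 ?nr_ge0//.
apply: le_trans (Re_inner_le _ _).
rewrite bopDE smul_bopE bidE innerDl inner_star (idempotent_skew_selfadj Q) !inner_nr /=.
by rewrite -expr2 lerDl sqr_ge0.
Qed.

(** The last clause says J Q = Q^* J for the symmetry J = 2 m - 1. It holds because 2 m Q - Q = Q^*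
    |Q^*|^dag Q is self-adjoint. *)
Lemma matched_projectionP : let m := matched_projection Q in
  [/\ selfadj m, m ** m = m & 2 *: (m ** Q) - Q = 2 *: (Qs ** m) - Qs].
Proof.
have [zi [ziz zzi]] := z_inv.
have zQ := idempotent_centralC; have zQs := idempotent_central_starC.
have aQ : a ** Q = z ** Q by rewrite idempotent_central_smul.
have za : z ** a = a ** z by rewrite smulA zQ -smulA zQs smulA.
have ziC X : z ** X = X ** z -> zi ** X = X ** zi by exact: inverse_comm.
have zis := inverse_selfadj ziz zzi idempotent_central_selfadj.
have as_ : selfadj a by rewrite /selfadj starM starK.
(* The range projection of Q. *)
pose p := a ** zi.
have pQ : p ** Q = Q by rewrite /p -smulA ziC// smulA aQ zQ -smulA zzi smul1r.
have ps : selfadj p by rewrite /selfadj /p starM zis as_ ziC.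
have pa : p ** a = a by rewrite smulA pQ.
have ap : a ** p = a by rewrite -[LHS]starK starM ps as_ pa as_.
have Qp : Q ** p = p by rewrite /p !smulA QQ.
rewrite /matched_projection /abs_op.
have -> : adj (adj Q) \op adj Q = a by rewrite bcompE !adjE starK.
have [Sp SS] := sqrt_opP (positive_Mstar Q); set S := sqrt_op _ in Sp SS *.
have Ss := positive_selfadj Sp.
have SpS : S ** p = S.
  apply/eqP; rewrite -subr_eq0; apply/eqP/nr_eq0/eqP.
  rewrite -sqrf_eq0 -nr_starM; apply/eqP; rewrite -[RHS](@nr0 _ (bop H H)); congr nr.
  have -> : star (S ** p - S) = p ** S - S by rewrite starD starN starM ps Ss.
  rewrite smulDl smulNl !smulDr !smulNr -!(smulA p S) !(smulA S S p) SS.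
  by rewrite ap pa !subrr.
have pS : p ** S = S by rewrite -[LHS]starK starM Ss ps SpS.
have zp : z ** p = a by rewrite /p (smulA z a) za -(smulA a z) zzi smul1r.
have pz : p ** z = a by rewrite /p -(smulA a zi) ziz smul1r.
(* S = p S = S p and z p = p z = S^2, so S commutes with z without any functional calculus. *)
have zS : z ** S = S ** z.
  have -> : z ** S = a ** S by rewrite -{1}pS smulA zp.
  have -> : S ** z = S ** a by rewrite -{1}SpS -smulA pz.
  by rewrite -SS smulA.
have ziS := ziC _ zS.
(* The Moore-Penrose inverse of S = |Q^*|: both products with S are the projection p. *)
pose T := S ** zi.
have Tmp : moore_penrose S T.
  have ST : S ** T = p by rewrite /T smulA SS.
  have TS : T ** S = p by rewrite /T -smulA ziS smulA SS.
  split; rewrite !bcompE ?adjE.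
  - by rewrite ST.
  - by rewrite TS /T smulA pS.
  - by rewrite ST ps.
  - by rewrite TS ps.
rewrite (pinv_opP Tmp) !bcompE !adjE.
have S1 : exists E, bop_inverse (S + bid) E.
  apply: (@normal_invertible _ _ _ 1) => //; rewrite ?starD ?Ss ?star_bid//.
  move=> x; rewrite mul1r; have [x0|x0] := eqVneq (nr x) 0; first by rewrite x0 nr_ge0.
  rewrite -(@ler_pM2r _ (nr x)) ?lt_def ?x0 ?nr_ge0//.
  apply: le_trans (Re_inner_le _ _); rewrite bopDE bidE innerDl inner_nr cReD /= -expr2.
  by rewrite lerDr; have := Sp x; rewrite lecE => /andP[].
have [E0 /inv_opP[]] := S1; set E := inv_op _ => ES SE.
have S1s : selfadj (S + bid) by rewrite /selfadj starD Ss star_bid.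
have Es := inverse_selfadj ES SE S1s.
have EC X : S ** X = X ** S -> E ** X = X ** E.
  by move=> SX; apply: (inverse_comm ES SE); rewrite smulDl smulDr smul1l smul1r SX.
have Ts : selfadj T by rewrite /selfadj /T starM zis Ss ziS.
have STC : S ** T = T ** S by rewrite /T -[RHS]smulA ziS smulA.
have STp : S ** T = p by rewrite /T smulA SS.
have pT : p ** T = T by rewrite /T smulA pS.
clearbody T; clearbody p; have ETC := EC _ STC.
have QS : Q ** S = S by rewrite -{1}pS smulA Qp pS.
have SQs : S ** Qs = S by rewrite -[LHS]starK starM starK Ss QS Ss.
set m := 2^-1 *: _.
have m2 : 2 *: m = (S + Qs) ** T ** E ** (S + Q).
  by rewrite /m scalerA divff ?scale1r ?pnatr_eq0.
have ms : selfadj m.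
  rewrite /selfadj /m starZ !starM !starE Es Ts Ss -!smulA (smulA E) ETC -!smulA.
  by rewrite fmorphV rmorph_nat.
clearbody m.
have mQ : 2 *: (m ** Q) = Q + Qs ** T ** Q.
  rewrite -smulZl m2 -!smulA.
  have -> : (S + Q) ** Q = (S + bid) ** Q by rewrite !smulDl QQ smul1l.
  by rewrite (smulA E) ES smul1l smulDl (smulA S) STp pQ smulA.
have Qsm : 2 *: (Qs ** m) = Qs + Qs ** T ** Q.
  by have := congr1 star mQ; rewrite starZ starD !starM ms starK Ts rmorph_nat -smulA => <-.
split; [exact: ms| |by rewrite mQ Qsm; lmod_coef R[i]; ring].
have h4 : 4 *: (m ** m) = 4 *: m.
  have -> : 4 *: (m ** m) = (2 *: m) ** (2 *: m) by rewrite smulZl smulZr; lmod R[i].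
  (* Q S = S = S Q^* and Q Q^* = S^2; the factor S + 1 then cancels against the inverse E inside
     m^2. *)
  have SQ : (S + Q) ** (S + Qs) = 2 *: ((S + bid) ** S).
    rewrite !(smulDl, smulDr) SS QS SQs smul1l; lmod R[i].
  have -> : 4 *: m = 2 *: (2 *: m) by lmod R[i].
  rewrite m2 -!smulA (smulA (S + Q)) SQ smulZl !smulZr; congr (_ *: _).
  rewrite (smulA E) (smulA (E ** _)) (smulA E) ES smul1l -!smulA.
  by congr (_ ** _); rewrite (smulA T S) -STC STp smulA pT.
by rewrite -[LHS]scale1r -[RHS]scale1r -(@mulVf _ 4) ?pnatr_eq0// -!scalerA h4.
Qed.
End MatchedProjection.

(* For m the matched projection of Q, canon_H5 Q and canon_H6 Q are the closed
   ranges of m Q (1 - m) and (1 - m) Q m. *)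
Section MatchedPair.
Variables (R : realType) (H : hilbertType R) (Q m : bop H H).
Hypotheses (QQ : Q ** Q = Q) (mm : m ** m = m).
Hypothesis mQ : 2 *: (m ** Q) - Q = 2 *: (star Q ** m) - star Q.

Local Notation Qs := (star Q).
Local Notation a := (Q ** Qs).
Local Notation w := ('i%C *: (Q - Qs)).
Local Notation z := (bid + w ** w).
Local Notation J := (2 *: m - bid).

Local Notation H5 := (closed_range (m \op Q \op (bid - m))).
Local Notation H6 := (closed_range ((bid - m) \op Q \op m)).

Lemma matched_symmetry_sqr : J ** J = bid.
Proof.
by rewrite !(smulDl, smulDr, smulNl, smulNr, smulZl, smulZr) !smul1l !smul1r mm; lmod R[i].
Qed.

Lemma matched_symmetryC : J ** Q = Qs ** J.
Proof.
by rewrite smulDl smulDr smulNl smulNr smulZl smulZr smul1l smul1r.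
Qed.

Lemma matched_symmetry_starC : J ** Qs = Q ** J.
Proof.
have -> : J ** Qs = J ** ((Qs ** J) ** J) by rewrite -(smulA Qs J) matched_symmetry_sqr smul1r.
by rewrite -matched_symmetryC !smulA matched_symmetry_sqr smul1l.
Qed.

(** Conjugation by J = 2 m - 1 exchanges Q and Q^*, so J anticommutes with w: w exchanges the ranges
    of m and 1 - m. *)
Lemma matched_skew : m ** w = w - w ** m.
Proof.
have h : J ** w = - (w ** J).
  rewrite smulZr smulZl smulDr smulNr matched_symmetryC matched_symmetry_starC.
  by rewrite smulDl smulNl; lmod R[i].
have e : 2 *: (m ** w) = 2 *: (w - w ** m).
  have -> : 2 *: (m ** w) = J ** w + w.
    by rewrite smulDl smulNl smul1l smulZl subrK.
  rewrite h smulDr smulNr smul1r smulZr; lmod R[i].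
by rewrite -[LHS]scale1r -[RHS]scale1r -(@mulVf _ 2) ?pnatr_eq0// -!scalerA e.
Qed.

Lemma closed_range_kernel (T P : bop H H) x : (forall y, P (T y) = 0) ->
  csub_set (closed_range T) x -> P x = 0.
Proof.
move=> PT Tx; apply: nr_lt_eq0 => e e0.
have K0 : 0 < nr P + 1 by rewrite ltr_wpDl ?nr_ge0.
have d0 : 0 < (e / (nr P + 1))%:C :> R[i] by rewrite ltcR divr_gt0.
have [_ [[y _ <-] xy]] := Tx _ (nbhsx_ballx x _ d0).
have -> : P x = P (x - T y) by rewrite bop_lB PT subr0.
apply: le_lt_trans (nr_bop _ _) _.
move: xy; rewrite -ball_normE /= -nrE ltcR => xy.
apply: (@le_lt_trans _ _ ((nr P + 1) * nr (x - T y))).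
  by rewrite ler_wpM2r ?nr_ge0// lerDl.
by rewrite mulrC -ltr_pdivlMr.
Qed.

Lemma matched_H5 (x : subsp H5) : m (val x) = val x.
Proof.
have hx : csub_set H5 (val x) by have := subspP x; rewrite inE.
apply/eqP; rewrite -subr_eq0 -[X in _ - X]bidE -bopBE; apply/eqP.
apply: closed_range_kernel hx => y.
by rewrite -[(_ \op _) y]/(m (Q ((bid - m) y))) bopBE bidE -(smul_bopE m m) mm subrr.
Qed.

Lemma matched_H6 (x : subsp H6) : m (val x) = 0.
Proof.
have hx : csub_set H6 (val x) by have := subspP x; rewrite inE.
apply: closed_range_kernel hx => y; rewrite -[LHS]/(m ((bid - m) (Q (m y)))).
by rewrite bopBE bidE bop_lB -(smul_bopE m m) mm subrr.
Qed.

(** Because m Q^* = 2 m Q m - m Q, one has m w = 2i m Q (1 - m), whose range defines H5. *)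
Lemma matched_skew_H5 y : exists x : subsp H5, val x = m (w y).
Proof.
have hx : (2 * 'i%C) *: (m \op Q \op (bid - m)) y \in (H5 : set H).
  rewrite inE -[_ *: _]addr0; apply: csub_lin; last exact: csub0.
  by apply: subset_closure; exists y.
have h : m ** Qs = 2 *: (m ** Q ** m) - m ** Q.
  have := congr1 (smul m) matched_symmetry_starC.
  rewrite !smulA !(smulDr, smulDl, smulNr, smulNl, smulZr, smulZl) mm !smul1r => <-.
  by lmod R[i].
have E : (2 * 'i%C) *: (m ** Q ** (bid - m)) = m ** w.
  by rewrite smulZr !(smulDr, smulNr) smul1r h; lmod R[i].
by exists (Subsp hx); rewrite -smul_bopE -E bopZE.
Qed.

(* Writing w^3 y = w^2 (m w y) + w (m w (w y)) reduces estimates to H5. *)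
Lemma skew_transfer (P : bop H H) (th : R) : P ** w = w ** P ->
  (forall x : subsp H5, nr (P (val x)) <= th * nr x) -> 0 <= th ->
  nr (P ** (w ** (w ** w))) <= th * (2 * nr w ^+ 3 * nr m).
Proof.
move=> + Px th0; move: matched_skew matched_skew_H5.
move: ('i%C *: (Q - star Q)) => W mW mWH5 PW.
have Pm y : nr (P (m (W y))) <= th * (nr m * (nr W * nr y)).
  have [x xy] := mWH5 y; rewrite -xy; apply: le_trans (Px x) _.
  rewrite ler_wpM2l// /nr subsp_normE xy -!/(nr _); apply: le_trans (nr_bop _ _) _.
  by rewrite ler_wpM2l ?nr_ge0// nr_bop.
have w0 := nr_ge0 W; have m0 := nr_ge0 m.
apply: nr_bop_le => [|y]; first by rewrite !mulr_ge0// exprn_ge0.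
have e : P ** (W ** (W ** W)) = W ** (W ** (P ** (m ** W))) + W ** (P ** (m ** (W ** W))).
  have Wm : W ** m = W - m ** W by rewrite mW subKr.
  have -> : W ** (W ** (P ** (m ** W))) = P ** (W ** (W ** (m ** W))).
    by rewrite (smulA W P) -PW -(smulA P W) (smulA W P) -PW -(smulA P W).
  rewrite (smulA W P) -PW -(smulA P W) -smulDr; congr (_ ** _).
  by rewrite (smulA W m W) Wm !(smulDl, smulDr, smulNl, smulNr) -!smulA subrK.
rewrite e bopDE; apply: le_trans (nrD _ _) _.
have h1 : nr ((W ** (W ** (P ** (m ** W)))) y) <=
    nr W * (nr W * (th * (nr m * (nr W * nr y)))).
  rewrite !smul_bopE; apply: le_trans (nr_bop _ _) _; rewrite ler_wpM2l//.
  by apply: le_trans (nr_bop _ _) _; rewrite ler_wpM2l.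
have h2 : nr ((W ** (P ** (m ** (W ** W)))) y) <=
    nr W * (th * (nr m * (nr W * (nr W * nr y)))).
  rewrite !smul_bopE; apply: le_trans (nr_bop _ _) _; rewrite ler_wpM2l//.
  apply: le_trans (Pm _) _; rewrite !ler_wpM2l//; exact: nr_bop.
by apply: le_trans (lerD h1 h2) _; rewrite le_eqVlt; apply/orP; left; apply/eqP; ring.
Qed.
End MatchedPair.

(** * The canonical operator D *)

Lemma spow_subsp (R : realType) (H : hilbertType R) (M : closed_subspace H)
    (P : bop H H) (G : bop (subsp M) (subsp M)) :
  (forall x, P (val x) = val (G x)) ->
  forall n x, spow P n (val x) = val (spow G n x).
Proof. by move=> PG; elim=> [|n IH] x /=; [exact: PG|rewrite IH PG]. Qed.

Section CanonicalOperator.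
Variables (R : realType) (H : hilbertType R) (Q : bop H H).
Local Notation K := (subsp (canon_H5 Q)).
Variables (D : bop K K) (U : bop K (subsp (canon_H6 Q))).
Hypotheses (hQ : nonprojection_idempotent Q) (hD : canonical_decomposition D U).

Local Notation Qs := (star Q).
Local Notation a := (Q ** Qs).
Local Notation w := ('i%C *: (Q - Qs)).
Local Notation z := (bid + w ** w).
Local Notation m := (matched_projection Q).
Local Notation Y := (Q + Qs - bid).
Local Notation F := (2 *: D - bid).

Let QQ : Q ** Q = Q. Proof. by case: hQ. Qed.
Let mm : m ** m = m. Proof. by case: (matched_projectionP QQ). Qed.
Let mQ : 2 *: (m ** Q) - Q = 2 *: (Qs ** m) - Qs.
Proof. by case: (matched_projectionP QQ). Qed.
Let mx (x : K) : m (val x) = val x. Proof. exact: matched_H5. Qed.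
Let my (y : subsp (canon_H6 Q)) : m (val y) = 0. Proof. exact: matched_H6. Qed.

Let valB (x y : K) : val (x - y) = val x - val y. Proof. exact: subsp_valB. Qed.
Let valZ c (x : K) : val (c *: x) = c *: val x. Proof. exact: subsp_valZ. Qed.

Lemma canonical_action (x : K) :
  exists g : subsp (canon_H6 Q), Q (val x) = val (D x) + val g.
Proof.
case: hD => _ _ _ h; have := h 0 0 x 0.
rewrite !bop_l0 !addr0 subr0 !add0r => ->; first by exists (U (ell D x)).
- by split; (exists 0; [by []|exact: bop_l0]).
- by split; exact: bop_l0.
Qed.

(** J = 2 m - 1 fixes H5 and negates H6. Hence Q^* x = J Q x has the same H5 part as Q x and the
    opposite H6 part. *)
Lemma canonical_star_action (x : K) :
  (Q + Qs) (val x) = 2 *: val (D x).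
Proof.
have [g gx] := canonical_action x.
have Jx (u : K) : (2 *: m - bid) (val u) = val u.
  by rewrite bopBE bopZE bidE mx; lmod R[i].
have Jg : (2 *: m - bid) (val g) = - val g.
  by rewrite bopBE bopZE bidE my; lmod R[i].
have : (Qs ** (2 *: m - bid)) (val x) = ((2 *: m - bid) ** Q) (val x).
  by rewrite (matched_symmetryC mQ).
rewrite !smul_bopE Jx gx bop_lD Jx Jg => Qsx.
by rewrite bopDE gx Qsx; lmod R[i].
Qed.

Lemma matched_compression_H5 (x : K) : m (Q (val x)) = val (D x).
Proof. by have [g ->] := canonical_action x; rewrite bop_lD mx my addr0. Qed.

Lemma idempotent_central_sqr : z = Y ** Y.
Proof.
rewrite idempotent_centralE// !(smulDl, smulDr, smulNl, smulNr).
rewrite QQ star_idempotent// !smul1r !smul1l.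
by lmod R[i].
Qed.

Lemma central_H5 (x : K) : z (val x) = val ((F ** F) x).
Proof.
have Yx (u : K) : Y (val u) = val (F u).
  by rewrite bopBE bidE canonical_star_action bopBE bopZE bidE valB valZ.
by rewrite idempotent_central_sqr smul_bopE !Yx.
Qed.

Lemma skew_sqr_H5 (x : K) : (w ** w) (val x) = val ((4 *: (D ** (D - bid))) x).
Proof.
have -> : (w ** w) (val x) = z (val x) - val x by rewrite bopDE bidE; lmod R[i].
have FF : F ** F = 4 *: (D ** (D - bid)) + bid.
  rewrite !(smulDl, smulDr, smulNl, smulNr, smulZl, smulZr) !smul1l !smul1r.
  by lmod R[i].
by rewrite central_H5 FF -valB bopDE bidE addrK.
Qed.

Lemma canonical_positive : positive_op (D - bid). Proof. by case: hD. Qed.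

Lemma canonical_selfadj : selfadj D.
Proof.
have := positive_selfadj canonical_positive.
by rewrite /selfadj starD starN star_bid => /addIr.
Qed.

Lemma canonical_expanding (x : K) : nr x <= nr (D x).
Proof.
have [x0|x0] := eqVneq (nr x) 0; first by rewrite x0 nr_ge0.
rewrite -(@ler_pM2r _ (nr x)) ?lt_def ?x0 ?nr_ge0//.
apply: le_trans (Re_inner_le _ _).
have := canonical_positive x; rewrite bopBE bidE innerBl inner_nr lecE => /andP[_].
by rewrite raddfB /= subr_ge0 expr2.
Qed.

(** If H5 were zero then m w = 0, so w = w m and w^2 = w m w = 0; w being self-adjoint, Q would be a
    projection. *)
Lemma canon_H5_neq0 : exists x : K, x <> 0.
Proof.
apply: contrapT => h; have K0 (x : K) : x = 0 by apply: contrapT => x0; apply: h; exists x.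
have mw : m ** w = 0.
  apply: bopP => y; have [x] := matched_skew_H5 mm mQ y.
  by rewrite (K0 x) raddf0 => /esym.
have wm : w ** m = w.
  by have := matched_skew mm mQ; rewrite mw => /esym/eqP; rewrite subr_eq0 => /eqP.
have w0 : w = 0.
  apply: nr_eq0; apply/eqP; rewrite -sqrf_eq0 -(nr_selfadj_sqr (idempotent_skew_selfadj Q)).
  by rewrite -{1}wm -smulA mw smul0r nr0.
case: hQ => _; apply; split=> //; apply/eqP; rewrite eq_sym -subr_eq0.
by move/eqP: w0; rewrite scaler_eq0 (negbTE (neq0Ci _)).
Qed.
End CanonicalOperator.

Lemma nr_bid_le1 (R : realType) (H : hilbertType R) : nr (bid : bop H H) <= 1.
Proof. by apply: nr_bop_le => // x; rewrite mul1r. Qed.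

Section CanonicalNorm.
Variables (R : realType) (H : hilbertType R) (Q : bop H H).
Local Notation K := (subsp (canon_H5 Q)).
Variables (D : bop K K) (U : bop K (subsp (canon_H6 Q))).
Hypotheses (hQ : nonprojection_idempotent Q) (hD : canonical_decomposition D U).

Local Notation Qs := (star Q).
Local Notation a := (Q ** Qs).
Local Notation w := ('i%C *: (Q - Qs)).
Local Notation z := (bid + w ** w).
Local Notation m := (matched_projection Q).
Local Notation F := (2 *: D - bid).

Let QQ : Q ** Q = Q. Proof. by case: hQ. Qed.
Let mm : m ** m = m. Proof. by case: (matched_projectionP QQ). Qed.
Let mQ : 2 *: (m ** Q) - Q = 2 *: (Qs ** m) - Qs.
Proof. by case: (matched_projectionP QQ). Qed.

Lemma canonical_norm_ge1 : 1 <= nr D.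
Proof.
have [x /nr_gt0 x0] := canon_H5_neq0 hQ.
have := le_trans (canonical_expanding hD x) (nr_bop _ _).
by rewrite -ler_pdivrMr// divff// gt_eqF.
Qed.

Lemma canonical_norm_sub1 : nr (D - bid) <= nr D - 1.
Proof.
apply: positive_nr_le; [exact: canonical_positive hD|by rewrite subr_ge0 canonical_norm_ge1|].
move=> x; rewrite bopBE bidE innerBl inner_nr raddfB /= mulrBl mul1r lerD2r.
apply: le_trans (Re_inner_le _ _) _; rewrite expr2 mulrA ler_wpM2r ?nr_ge0//.
exact: nr_bop.
Qed.

Lemma canonical_norm_gt1 : 1 < nr D.
Proof.
rewrite ltNge; apply/negP => D1; have [x x0] := canon_H5_neq0 hQ.
case: (hD) => _ _ inj _; apply: x0; apply: inj.
have -> : D - bid = 0; last by [].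
apply: nr_eq0; apply/le_anti; rewrite nr_ge0 andbT.
by apply: le_trans canonical_norm_sub1 _; rewrite subr_le0.
Qed.

(** On H5 the operator m Q z^n is D (2 D - 1)^(2n), and it equals m a^n Q. As D does not shrink
    vectors, n-th roots give |2 D - 1|^2 <= |a| = |Q|^2. *)
Lemma canonical_norm_lower : 2 * nr D - 1 <= nr Q.
Proof.
have Fs : selfadj F.
  by rewrite /selfadj starD starN starZ star_bid (canonical_selfadj hD) rmorph_nat.
have FFs : selfadj (F ** F) by rewrite /selfadj starM Fs.
have as_ : selfadj a by rewrite /selfadj starM starK.
have aQ n : Q ** spow z n = spow a n ** Q.
  elim: n => [|n IH] /=.
    by rewrite -idempotent_centralC// idempotent_central_smul.
  rewrite smulA -idempotent_centralC// -smulA IH -smulA.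
  rewrite -[spow a n ** Q]IH !smulA idempotent_centralC//.
  by rewrite -idempotent_centralC// idempotent_central_smul.
have FQ : nr (F ** F) <= nr a.
  apply: (@real_growth_le _ _ _ 1 (nr m * nr Q)); rewrite ?nr_ge0// => n.
  rewrite mul1r -!nr_spow//; apply: nr_bop_le => [|x]; first by rewrite !mulr_ge0 ?nr_ge0.
  apply: le_trans (canonical_expanding hD _) _.
  have -> : nr (D (spow (F ** F) n x)) = nr (val (D (spow (F ** F) n x))) by [].
  rewrite -(matched_compression_H5 hQ hD) -(spow_subsp (central_H5 hQ hD)) -(smul_bopE Q) aQ.
  apply: le_trans (nr_bop _ _) _; rewrite -!mulrA ler_wpM2l ?nr_ge0//.
  apply: le_trans (nr_bop _ _) _; rewrite mulrA ler_wpM2r ?nr_ge0//.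
  by apply: le_trans (nrM _ _) _; rewrite mulrC.
have {}FQ : nr F <= nr Q.
  by rewrite -(@ler_pXn2r _ 2) ?nnegrE ?nr_ge0// -nr_selfadj_sqr// -nr_Mstar.
have e : 2%:C *: D = F + bid by rewrite rmorph_nat subrK.
have := nrD F bid; rewrite -e nrZr ger0_norm//.
by have := nr_bid_le1 K; lra.
Qed.

(** Applying [skew_transfer] to powers of w^2 gives |w^2| <= |4 D (D - 1)|, and |a| <= |z| <= 1 +
    |w^2| <= (2 |D| - 1)^2. *)
Lemma canonical_norm_upper : nr Q <= 2 * nr D - 1.
Proof.
have D1 := canonical_norm_ge1.
have ws := idempotent_skew_selfadj Q.
have wws : selfadj (w ** w) by rewrite /selfadj starM ws.
have powC n : spow (w ** w) n ** w = w ** spow (w ** w) n.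
  by elim: n => [|n IH] /=; rewrite -smulA // IH !smulA.
set G := 4 *: (D ** (D - bid)).
have Gn : nr G <= 4 * nr D * (nr D - 1).
  have -> : G = 4%:C *: (D ** (D - bid)) by rewrite rmorph_nat.
  rewrite nrZr ger0_norm// -mulrA ler_wpM2l//; apply: le_trans (nrM _ _) _.
  by rewrite ler_wpM2l ?nr_ge0// canonical_norm_sub1.
have wwG : nr (w ** w) <= nr G.
  have [w0|w0] := eqVneq (nr (w ** w)) 0; first by rewrite w0 nr_ge0.
  have {}w0 : 0 < nr (w ** w) by rewrite lt_def w0 nr_ge0.
  apply: (@real_growth_le _ _ _ (nr (w ** w) ^+ 2) (2 * nr w ^+ 3 * nr m * nr w));
    rewrite ?nr_ge0 ?exprn_gt0// => n.
  have Px (x : K) : nr (spow (w ** w) n (val x)) <= nr G ^+ n.+1 * nr x.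
    rewrite (spow_subsp (skew_sqr_H5 hQ hD)) -[nr (val _)]/(nr (spow G n x)).
    apply: le_trans (nr_bop _ _) _.
    by rewrite ler_wpM2r ?nr_ge0// nr_spow_le.
  have := skew_transfer mm mQ (powC n) Px (exprn_ge0 _ (nr_ge0 _)) => h.
  have -> : nr (w ** w) ^+ 2 * nr (w ** w) ^+ n.+1 =
      nr ((spow (w ** w) n ** (w ** (w ** w))) ** w).
    have -> : (spow (w ** w) n ** (w ** (w ** w))) ** w = spow (w ** w) n.+2.
      by rewrite -[in RHS]addn1 -spowD /= -!smulA.
    by rewrite nr_spow// -exprD addSn.
  apply: le_trans (nrM _ _) _; apply: le_trans (ler_wpM2r (nr_ge0 w) h) _.
  by rewrite le_eqVlt; apply/orP; left; apply/eqP; ring.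
(* a^2 = z a. *)
have za : nr a <= nr z.
  have [a0|a0] := eqVneq (nr a) 0; first by rewrite a0 nr_ge0.
  have as_ : selfadj a by rewrite /selfadj starM starK.
  rewrite -(@ler_pM2r _ (nr a)) ?lt_def ?a0 ?nr_ge0// -expr2 -nr_selfadj_sqr//.
  rewrite [X in nr X]smulA -idempotent_central_smul// -(smulA z Q); exact: nrM.
have zn : nr z <= 1 + nr (w ** w).
  by apply: le_trans (nrD _ _) _; rewrite lerD2r nr_bid_le1.
have an := nr_Mstar Q.
rewrite -(@ler_pXn2r _ 2) ?nnegrE ?nr_ge0//; last lra.
rewrite -an; apply: le_trans za _; apply: le_trans zn _.
have := le_trans wwG Gn; lra.
Qed.
End CanonicalNorm.

(** * Approximate eigenvectors and the sufficiency of a full spectrum *)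

Section ApproximateEigenvectors.
Variables (R : realType) (H : hilbertType R).

(** The strict inequality in the conclusion forces x to be nonzero. *)
Lemma spectrum_approx (T : bop H H) (t e : R) : selfadj T -> 0 < e ->
  spectrum T t%:C -> exists x, nr (T x - t%:C *: x) < e * nr x.
Proof.
move=> Ts e0 Tt; apply: contrapT => h; apply: Tt.
have Ss : selfadj (t%:C *: bid - T).
  by rewrite /selfadj starD starN starZ star_bid Ts conj_real.
apply: (normal_invertible (d := e)) => // [|x]; first by rewrite Ss.
rewrite leNgt; apply/negP => hx; apply: h; exists x.
by rewrite nr_distC; rewrite bopBE bopZE bidE in hx.
Qed.

Lemma sqr_shift_factor (T : bop H H) (t : R) x :
  ((2 *: T - bid) ** (2 *: T - bid)) x - ((2 * t - 1) ^+ 2)%:C *: x =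
  (4%:C *: (T + (t - 1)%:C *: bid)) (T x - t%:C *: x).
Proof.
have -> : ((2 * t - 1) ^+ 2)%:C = (2 * t%:C - 1) ^+ 2 :> R[i].
  by rewrite rmorphXn rmorphB rmorphM rmorph_nat rmorph1.
rewrite smul_bopE !(bopBE, bopZE, bopDE, bidE) !bop_linE !rmorphB rmorph1 rmorph_nat.
by lmod R[i].
Qed.

Lemma pact_bounded (a : bop H H) (f : {poly R[i]}) :
  exists2 C : R, 0 <= C & forall x, nr (pact a f x) <= C * nr x.
Proof.
elim/poly_ind: f => [|f c [C C0 hC]].
  by exists 0 => // x; rewrite pact0 nr0 mul0r.
exists (nr a * C + cabs c) => [|x]; first by rewrite addr_ge0 ?mulr_ge0 ?nr_ge0 ?cabs_ge0.
rewrite pactD pactMX; last exact: bop_linear.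
rewrite pactC mulrDl -mulrA -nrZ; apply: le_trans (nrD _ _) _; rewrite lerD2r.
by apply: le_trans (nr_bop _ _) _; rewrite ler_wpM2l ?nr_ge0.
Qed.

(** Division of f(X) X - f(l) l by X - l shows that f(a) a nearly multiplies an approximate
    eigenvector by l f(l). *)
Lemma approx_eigenvalue_pact (a : bop H H) (f : {poly R[i]}) (l : R) :
  (forall e : R, 0 < e -> exists2 v, 0 < nr v & nr (a v - l%:C *: v) <= e * nr v) ->
  0 <= l -> l * cabs f.[l%:C] <= nr (pact (smul a) f a).
Proof.
move=> hl l0; set N := nr _; have al := @bop_linear _ _ _ a.
have [h hE] : exists h : {poly R[i]}, f * 'X - (f * 'X).[l%:C]%:P = h * ('X - l%:C%:P).
  by apply/factor_theorem; rewrite /root hornerD hornerN hornerC subrr.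
have [C C0 hC] := pact_bounded a h.
apply/ler_addgt0Pr => e e0.
have C1 : 0 < C + 1 by rewrite ltr_wpDl.
have [v v0 hv] := hl _ (divr_gt0 e0 C1).
rewrite -(ler_pM2r v0).
have lE : l * cabs f.[l%:C] = cabs (f * 'X).[l%:C].
  by rewrite hornerMX cabsM cabs_real (ger0_norm l0) mulrC.
have e1 : pact a (f * 'X) v = pact (smul a) f a v.
  rewrite pactM// pactX//; have sl : linear (smul a) by move=> c x y; exact: smulPr.
  by rewrite (@pact_morph _ _ _ (smul a) a (fun X : bop H H => X v)).
have e2 : (f * 'X).[l%:C] *: v = pact (smul a) f a v - pact a h (a v - l%:C *: v).
  rewrite -e1; have -> : a v - l%:C *: v = pact a ('X - l%:C%:P) v.
    by rewrite pactD -polyCN pactC pactX// scaleNr.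
  rewrite -pactM// -hE pactD -polyCN pactC scaleNr opprD opprK addNKr.
  by [].
rewrite lE -nrZ e2; apply: le_trans (nrB _ _) _; rewrite mulrDl.
apply: lerD; first exact: nr_bop.
apply: le_trans (hC _) _; apply: le_trans (ler_wpM2l C0 hv) _.
rewrite mulrA ler_wpM2r ?(ltW v0)// mulrCA ler_piMr ?(ltW e0)//.
by rewrite ler_pdivrMr// mul1r lerDl.
Qed.
End ApproximateEigenvectors.

Section FullSpectrum.
Variables (R : realType) (H : hilbertType R) (Q : bop H H).
Local Notation K := (subsp (canon_H5 Q)).
Variables (D : bop K K) (U : bop K (subsp (canon_H6 Q))).
Hypotheses (hQ : nonprojection_idempotent Q) (hD : canonical_decomposition D U).

Local Notation Qs := (star Q).
Local Notation a := (Q ** Qs).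
Local Notation w := ('i%C *: (Q - Qs)).
Local Notation z := (bid + w ** w).
Local Notation m := (matched_projection Q).
Local Notation F := (2 *: D - bid).

Let QQ : Q ** Q = Q. Proof. by case: hQ. Qed.

Lemma matched_nr_le1 : nr m <= 1.
Proof.
case: (matched_projectionP QQ) => ms mm _.
by have := nr_selfadj_sqr ms; rewrite mm; have := nr_ge0 m; nra.
Qed.

(** Take v = Q x with x an approximate eigenvector of D: a Q = Q z, z is (2 D - 1)^2 on H5, and |Q
    x| >= |D x| >= |x| keeps v away from 0. *)
Lemma approx_eigenvalue_of_spectrum (t e : R) : spectrum D t%:C -> 0 < e ->
  exists2 v, 0 < nr v & nr (a v - ((2 * t - 1) ^+ 2)%:C *: v) <= e * nr v.
Proof.
move=> Dt e0; pose C := nr Q * (4 * (nr D + `|t - 1| * 1)).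
have C0 : 0 <= C by rewrite !mulr_ge0 ?addr_ge0 ?mulr_ge0 ?nr_ge0.
have C1 : 0 < C + 1 by rewrite ltr_wpDl.
have [x hx] := spectrum_approx (canonical_selfadj hD) (divr_gt0 e0 C1) Dt.
have x0 : 0 < nr x.
  by have := le_lt_trans (nr_ge0 _) hx; rewrite pmulr_rgt0 ?divr_gt0.
have xv : nr x <= nr (Q (val x)).
  apply: le_trans (canonical_expanding hD x) _.
  rewrite -[nr (D x)]/(nr (val (D x))) -(matched_compression_H5 hQ hD).
  apply: le_trans (nr_bop _ _) _.
  by rewrite ler_piMl ?nr_ge0 ?matched_nr_le1.
exists (Q (val x)); first exact: lt_le_trans xv.
set l := ((2 * t - 1) ^+ 2)%:C.
have -> : a (Q (val x)) - l *: Q (val x) = Q (z (val x) - l *: val x).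
  rewrite bop_lB bop_lZ; congr (_ - _).
  by rewrite -(smul_bopE a Q) -idempotent_central_smul// idempotent_centralC.
rewrite (central_H5 hQ hD).
have -> : val ((F ** F) x) - l *: val x =
    val ((4%:C *: (D + (t - 1)%:C *: bid)) (D x - t%:C *: x)).
  by rewrite -subsp_valZ -subsp_valB sqr_shift_factor.
apply: le_trans (nr_bop _ _) _.
set y := val _.
have -> : nr y = nr ((4%:C *: (D + (t - 1)%:C *: bid)) (D x - t%:C *: x)) by [].
have h1 : nr (4%:C *: (D + (t - 1)%:C *: bid)) <= 4 * (nr D + `|t - 1| * 1).
  rewrite nrZr ger0_norm// ler_wpM2l//; apply: le_trans (nrD _ _) _; rewrite lerD2l nrZr.
  by rewrite ler_wpM2l// nr_bid_le1.
have h2 : nr ((4%:C *: (D + (t - 1)%:C *: bid)) (D x - t%:C *: x)) <=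
    4 * (nr D + `|t - 1| * 1) * (e / (C + 1) * nr x).
  apply: le_trans (nr_bop _ _) _; apply: ler_pM; rewrite ?nr_ge0//; exact: ltW.
apply: le_trans (ler_wpM2l (nr_ge0 Q) h2) _.
apply: (@le_trans _ _ (e * nr x)); last by rewrite ler_wpM2l ?(ltW e0).
have Ce : C * (e / (C + 1)) <= e.
  by rewrite mulrCA ler_piMr ?(ltW e0)// ler_pdivrMr// mul1r lerDl.
apply: le_trans (ler_wpM2r (nr_ge0 x) Ce).
by rewrite le_eqVlt /C; apply/orP; left; apply/eqP; ring.
Qed.

Lemma universal_of_full_spectrum (r : R) : `|Q| = r%:C ->
  spectrum D = [set c : R[i] | 1 <= c <= `|D|] -> universal_idempotent r Q.
Proof.
move=> Qr Dspec; have rE : r = nr Q by rewrite /nr Qr.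
have D1 := canonical_norm_gt1 hQ hD; have low := canonical_norm_lower hQ hD.
split => //; first by rewrite rE; lra.
move=> B p [pp _] pr; apply: (star_hom_of_corner_le QQ pp) => f.
have np : nr p <= nr Q by rewrite -lecR !nrE Qr.
apply: (nr_pact_idempotent pp np) => [l /andP[l1 lr]|]; last exact: nr_ge0.
apply: approx_eigenvalue_pact; last lra.
(* The solution t >= 1 of l = (2 t - 1)^2; [canonical_norm_upper] gives t <= |D|. *)
move=> e e0; pose t := (1 + Num.sqrt l) / 2.
have lE : l = (2 * t - 1) ^+ 2.
  have -> : 2 * t - 1 = Num.sqrt l by rewrite /t; field.
  by rewrite sqr_sqrtr//; lra.
rewrite lE; apply: approx_eigenvalue_of_spectrum e0; rewrite Dspec /=.
have s1 : 1 <= Num.sqrt l by rewrite -{1}[1](@sqrtr1 R) ler_wsqrtr.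
have sr : Num.sqrt l <= nr Q.
  by rewrite -(ger0_norm (nr_ge0 Q)) -sqrtr_sqr ler_wsqrtr.
have := canonical_norm_upper hQ hD.
rewrite -nrE -(rmorph1 (real_complex R)) !lecR /t => up; apply/andP; split; lra.
Qed.
End FullSpectrum.

(** * Rank-one idempotents and the obstruction from a spectral gap *)

Section RankOne.
Variables (R : realType) (H : hilbertType R).
Implicit Types (u v x y : H).

Fact rank_one_linear u v : linear (fun x => inner x v *: u).
Proof. by move=> c x y; rewrite innerDl innerZl scalerDl scalerA. Qed.

Fact rank_one_bounded u v :
  exists M : R[i], forall x, `|inner x v *: u| <= M * `|x|.
Proof.
exists (`|v| * `|u|) => x; rewrite normrZ mulrAC ler_wpM2r// mulrC.
exact: inner_CauchySchwarz.
Qed.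

Definition rank_one u v : bop H H := Bop (rank_one_linear u v) (rank_one_bounded u v).

Lemma star_rank_one u v : star (rank_one u v) = rank_one v u.
Proof.
apply: bopP => x; apply: innerI => y; rewrite -inner_star /= innerZl innerZr.
by rewrite mulrC -innerC.
Qed.

Lemma rank_oneM u v x y : rank_one u v ** rank_one x y = inner x v *: rank_one u y.
Proof. by apply: bopP => t; rewrite smul_bopE bopZE /= innerZl scalerA mulrC. Qed.

Lemma nr_rank_one u v : nr (rank_one u v) <= nr u * nr v.
Proof.
apply: nr_bop_le => [|x]; first by rewrite mulr_ge0 ?nr_ge0.
rewrite /= nrZ -mulrA mulrC ler_wpM2l ?nr_ge0// mulrC.
by rewrite -lecR rmorphM /= cabsE !nrE inner_CauchySchwarz.
Qed.

(** p x = (x, v) u with v = u + c g: (u, v) = 1 makes p idempotent, and c is chosen so that |v| = s.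
    Then p p^* is s^2 times the projection onto u. *)
Lemma rank_one_idempotent (u g : H) (s : R) : 1 < s -> nr u = 1 -> nr g = 1 ->
  inner u g = 0 -> exists p : bop H H, [/\ nonprojection_idempotent p, nr p <= s &
    (p ** star p) ** (p ** star p) = (s ^+ 2)%:C *: (p ** star p)].
Proof.
move=> s1 u1 g1 ug; pose c : R := Num.sqrt (s ^+ 2 - 1).
have c2 : c ^+ 2 = s ^+ 2 - 1 by rewrite sqr_sqrtr// subr_ge0 exprn_ege1// ltW.
pose v := u + c%:C *: g.
have gu : inner g u = 0 by rewrite innerC ug conjC0.
have uv : inner u v = 1 by rewrite innerDr innerZr ug mulr0 addr0 inner_nr u1 expr1n.
have vv : inner v v = (s ^+ 2)%:C.
  rewrite innerDl uv innerZl innerDr innerZr gu add0r inner_nr g1 expr1n conj_real.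
  by rewrite mulr1 -rmorphM -expr2 c2 rmorphB rmorph1 addrC subrK.
have s0 : 0 <= s by lra.
have nv : nr v = s.
  apply/eqP; rewrite -(@eqrXn2 _ 2) ?nr_ge0//.
  by have := inner_nr v; rewrite vv => /complexI ->.
exists (rank_one u v); rewrite star_rank_one rank_oneM vv; split.
- split; first by rewrite /idempotent_elt rank_oneM uv scale1r.
  case=> _; rewrite star_rank_one => /(congr1 (fun T : bop H H => T u)) /=.
  rewrite inner_nr u1 expr1n uv !scale1r => vu.
  by have := s1; rewrite -nv vu u1 ltxx.
- by apply: le_trans (nr_rank_one _ _) _; rewrite u1 nv mul1r.
- by rewrite smulZl smulZr rank_oneM inner_nr u1 expr1n scale1r.
Qed.
End RankOne.

Section Commutation.
Variables (R : realType) (A : cstarAlgType R).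
Implicit Types x y t : A.

Lemma smul_commD x y t : x ** t = t ** x -> y ** t = t ** y ->
  (x + y) ** t = t ** (x + y).
Proof. by move=> xt yt; rewrite smulDl smulDr xt yt. Qed.
Lemma smul_commZ c x t : x ** t = t ** x -> (c *: x) ** t = t ** (c *: x).
Proof. by move=> xt; rewrite smulZl xt smulZr. Qed.
Lemma smul_commB x y t : x ** t = t ** x -> y ** t = t ** y ->
  (x - y) ** t = t ** (x - y).
Proof. by move=> xt yt; rewrite smulDl smulDr smulNl smulNr xt yt. Qed.
Lemma smul_commM x y t : x ** t = t ** x -> y ** t = t ** y ->
  (x ** y) ** t = t ** (x ** y).
Proof. by move=> xt yt; rewrite -smulA yt smulA xt -smulA. Qed.
End Commutation.

Section GeometricElement.
Variables (R : realType) (H : hilbertType R) (Q m : bop H H).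
Hypotheses (QQ : Q ** Q = Q) (mm : m ** m = m).
Hypothesis mQ : 2 *: (m ** Q) - Q = 2 *: (star Q ** m) - star Q.

Local Notation Qs := (star Q).
Local Notation a := (Q ** Qs).
Local Notation w := ('i%C *: (Q - Qs)).
Local Notation z := (bid + w ** w).
Local Notation H5 := (closed_range (m \op Q \op (bid - m))).

(* y solves (l - a)^2 y = K (a - 1)^2 a: it is the sum of the geometric series
   of 1 - (l - z)^2 / K, a contraction on H5, applied to (a - 1)^2 a = w^4 a. *)
Lemma cstar_gen_resolvent (l : R) (G : bop (subsp H5) (subsp H5)) (d : R) :
  (forall x, z (val x) = val ((G + l%:C *: bid) x)) -> selfadj G -> 0 < d ->
  (forall x, d * nr x <= nr (G x)) ->
  exists (k : R) (y : bop H H), cstar_gen Q y /\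
    a ** (a ** a) - 2 *: (a ** a) + a =
    k%:C *: ((l ^+ 2)%:C *: y - (2 * l)%:C *: (a ** y) + a ** (a ** y)).
Proof.
move=> zG Gs d0 Gd.
have [K [th [K0 th01 _ nth']]] := bounded_below_contraction d0 Gd.
have [th0 th1] := andP th01.
rewrite Gs in nth'; pose k := K^-1.
pose c0 : bop H H := a ** (a ** a) - 2 *: (a ** a) + a.
pose X := z - l%:C *: bid; pose E : bop H H := bid - k%:C *: (X ** X).
(* Multiplication by 1 - k (l - a)^2, expanded so as to preserve C*{Q}; on elements x = Q x it
   agrees with E, since a and z do. *)
pose T (x : bop H H) : bop H H :=
  x - k%:C *: ((l ^+ 2)%:C *: x - (2 * l)%:C *: (a ** x) + a ** (a ** x)).
have aV x : Q ** (a ** x) = a ** x by rewrite !smulA QQ.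
have zV x : Q ** x = x -> z ** x = a ** x.
  by move=> Qx; rewrite smulDl smul1l idempotent_modulus// smulA.
have TE x : Q ** x = x -> T x = E ** x.
  move=> Qx; have Xx : X ** x = a ** x - l%:C *: x.
    by rewrite smulDl smulNl zV// smulZl smul1l.
  have XXx : X ** (X ** x) = a ** (a ** x) - l%:C *: (a ** x) - l%:C *: (a ** x - l%:C *: x).
    rewrite Xx smulDl smulNl zV; last by rewrite smulDr smulNr smulZr aV Qx.
    by rewrite smulDr smulNr smulZr smulZl smul1l.
  rewrite smulDl smulNl smul1l smulZl -smulA XXx /T rmorphXn rmorphM rmorph_nat.
  by lmod R[i].
have TV x : Q ** x = x -> Q ** T x = T x.
  by move=> Qx; rewrite /T !(smulDr, smulNr, smulZr) Qx !aV.
have c0V : Q ** c0 = c0.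
  by rewrite /c0 !(smulDr, smulNr, smulZr) !aV (smulA Q Q) QQ.
have iterV n : Q ** iter n T c0 = iter n T c0.
  by elim: n => //= n IH; exact: TV.
have iterE n : iter n.+1 T c0 = spow E n ** c0.
  elim: n => [|n IH]; first by rewrite /= TE.
  by rewrite iterS TE// IH smulA.
have za : z ** a = a ** a by apply: zV; rewrite smulA QQ.
have wwa : w ** (w ** a) = a ** a - a.
  by rewrite smulA -za smulDl smul1l; lmod R[i].
(* c0 = (a - 1)^2 a = w^4 a, grouped to expose the w^3 that [skew_transfer] requires. *)
have c0E : c0 = (w ** (w ** w)) ** (w ** a).
  have -> : (w ** (w ** w)) ** (w ** a) = (w ** (w ** a)) ** a - w ** (w ** a).
    have -> : (w ** (w ** w)) ** (w ** a) = w ** (w ** (w ** (w ** a))) by rewrite !smulA.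
    by rewrite {1}wwa 2!smulDr 2!smulNr -!smulA.
  rewrite wwa smulDl smulNl /c0 -(smulA a a a); lmod R[i].
have Ew : E ** w = w ** E.
  have ww : (w ** w) ** w = w ** (w ** w) by rewrite smulA.
  have bw : bid ** w = w ** bid by rewrite smul1l smul1r.
  have Xw : X ** w = w ** X by apply: smul_commB; [exact: smul_commD|exact: smul_commZ].
  by apply: smul_commB => //; apply: smul_commZ; exact: smul_commM.
have spowEw n : spow E n ** w = w ** spow E n.
  by elim: n => [|n IH] //=; rewrite -smulA IH !smulA Ew.
have EG (x : subsp H5) : E (val x) = val ((bid - k%:C *: (G ** G)) x).
  have XG (u : subsp H5) : X (val u) = val (G u).
    by rewrite bopBE zG bopZE bidE bopDE bopZE bidE -subsp_valZ -subsp_valB addrK.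
  rewrite /E bopBE bidE bopZE smul_bopE !XG -subsp_valZ -subsp_valB.
  by rewrite bopBE bidE bopZE.
have spowEG n (x : subsp H5) : nr (spow E n (val x)) <= th ^+ n.+1 * nr x.
  rewrite (spow_subsp EG).
  change (nr ((spow (bid - k%:C *: (G ** G)) n  : bop (subsp H5) (subsp H5)) x) <=
          th ^+ n.+1 * nr x).
  apply: le_trans (nr_bop _ _) _.
  rewrite ler_wpM2r ?nr_ge0//; apply: le_trans (nr_spow_le _ _) _.
  by rewrite ler_pXn2r ?nnegrE ?nr_ge0.
(* The first summand serves the exponents n >= 1, the second n = 0. *)
pose C := 2 * nr w ^+ 3 * nr m * nr (w ** a) + nr c0.
have [|||y yE yS] := @nr_geometric_fixpoint R (bop H H) T c0 C th
  (nr (bid - k%:C *: ((l ^+ 2)%:C *: bid - (2 * l)%:C *: a + a ** a))) _ th01.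
- by move=> c x y; rewrite /T !smulPr; lmod R[i].
- move=> x.
  have -> : T x = (bid - k%:C *: ((l ^+ 2)%:C *: bid - (2 * l)%:C *: a + a ** a)) ** x.
    by rewrite /T !(smulDl, smulNl, smulZl) smul1l smulA.
  exact: nrM.
- case=> [|n].
    rewrite expr0 mulr1 /= lerDr.
    by rewrite !mulr_ge0 ?exprn_ge0 ?nr_ge0.
  rewrite iterE c0E smulA; apply: le_trans (nrM _ _) _.
  have h := skew_transfer mm mQ (spowEw n) (spowEG n) (exprn_ge0 _ th0).
  apply: le_trans (ler_wpM2r (nr_ge0 _) h) _.
  by have := mulr_ge0 (nr_ge0 c0) (exprn_ge0 n.+1 th0); rewrite /C; lra.
exists k, y; split.
- have [[Sc S0 SD SM SS] Sq] := cstar_gen_subalgebra Q.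
  have Sa : cstar_gen Q a by apply: SM => //; exact: SS.
  have SZ c x : cstar_gen Q x -> cstar_gen Q (c *: x).
    by move=> Sx; rewrite -[c *: x]addr0; exact: SD.
  have SA u v : cstar_gen Q u -> cstar_gen Q v -> cstar_gen Q (u + v).
    by move=> Su Sv; rewrite -[u]scale1r; exact: SD.
  have SN u : cstar_gen Q u -> cstar_gen Q (- u) by rewrite -scaleN1r; exact: SZ.
  have Saa := SM _ _ Sa Sa.
  have Sc0 : cstar_gen Q c0 := SA _ _ (SA _ _ (SM _ _ Sa Saa) (SN _ (SZ 2 _ Saa))) Sa.
  apply: yS => // x Sx; have Sax := SM _ _ Sa Sx.
  have Sp := SA _ _ (SA _ _ (SZ (l ^+ 2)%:C _ Sx) (SN _ (SZ (2 * l)%:C _ Sax)))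
    (SM _ _ Sa Sax).
  exact: SA Sc0 (SA _ _ Sx (SN _ (SZ k%:C _ Sp))).
- rewrite -/c0; set t := k%:C *: _.
  have -> : c0 = (c0 + T y) - (y - t) by rewrite -[c0 in RHS]addr0 /T -/t; lmod R[i].
  by rewrite -yE; lmod R[i].
Qed.
End GeometricElement.

(** * Universal idempotents *)

Section Universality.
Variables (R : realType) (H : hilbertType R) (Q : bop H H).
Local Notation K := (subsp (canon_H5 Q)).
Variables (D : bop K K) (U : bop K (subsp (canon_H6 Q))).
Hypotheses (hQ : nonprojection_idempotent Q) (hD : canonical_decomposition D U).

Local Notation Qs := (star Q).
Local Notation a := (Q ** Qs).
Local Notation w := ('i%C *: (Q - Qs)).
Local Notation F := (2 *: D - bid).

Let QQ : Q ** Q = Q. Proof. by case: hQ. Qed.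

(** The unitary U moves a nonzero vector of H5 into H6; m fixes the one and annihilates the
    other. *)
Lemma canonical_orthonormal_pair : exists u g : H,
  [/\ nr u = 1, nr g = 1 & inner u g = 0].
Proof.
have [x x0] := canon_H5_neq0 hQ; have [ms mm mQ] := matched_projectionP QQ.
have Ux0 : U x <> 0.
  move=> Ux; apply: x0; case: (hD) => -[UU _] _ _ _.
  have h : (adj U) (U x) = x := congr1 (fun T : bop K K => T x) UU.
  by rewrite -h Ux bop_l0.
have vx0 : val x <> 0 by move=> vx; apply: x0; apply: val_inj; rewrite vx raddf0.
have vU0 : val (U x) <> 0 by move=> vU; apply: Ux0; apply: val_inj; rewrite vU raddf0.
exists ((nr (val x))^-1%:C *: val x), ((nr (val (U x)))^-1%:C *: val (U x)).
rewrite !nr_normalize//; split=> //; rewrite innerZl innerZr.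
have -> : inner (val x) (val (U x)) = 0; last by rewrite !mulr0.
by rewrite -(matched_H5 mm x) inner_star ms (matched_H6 mm (U x)) inner0r.
Qed.

Lemma star_hom_resolvent_eq0 (B : cstarAlgType R) (p : B) (pi : bop H H -> B)
    (l k : R) (y : bop H H) :
  star_hom (cstar_gen Q) (cstar_gen p) pi -> pi Q = p -> 1 < l -> cstar_gen Q y ->
  a ** (a ** a) - 2 *: (a ** a) + a =
    k%:C *: ((l ^+ 2)%:C *: y - (2 * l)%:C *: (a ** y) + a ** (a ** y)) ->
  (p ** star p) ** (p ** star p) = l%:C *: (p ** star p) -> p = 0.
Proof.
move=> [_ piD piM piS] piQ l1 Sy e bb; set b := p ** star p in bb.
have [[_ S0 SD SM SS] Sq] := cstar_gen_subalgebra Q.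
have Sa : cstar_gen Q a by apply: SM => //; exact: SS.
have Saa := SM _ _ Sa Sa; have Saaa := SM _ _ Sa Saa.
have Say := SM _ _ Sa Sy; have Saay := SM _ _ Sa Say.
have pia : pi a = b by rewrite piM// ?piS// ?piQ//; exact: SS.
have pi0 : pi 0 = 0.
  by have := piD (-1) _ _ Sa Sa; rewrite !scaleN1r !addNr.
have piZ c x : cstar_gen Q x -> pi (c *: x) = c *: pi x.
  by move=> Sx; have := piD c _ _ Sx S0; rewrite pi0 !addr0.
have e1 : pi (a ** (a ** a) - 2 *: (a ** a) + a) = b ** (b ** b) - 2 *: (b ** b) + b.
  have -> : a ** (a ** a) - 2 *: (a ** a) + a = 1 *: (a ** (a ** a)) + ((-2) *: (a ** a) + a).
    by lmod R[i].
  rewrite !piD//; last exact: SD.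
  by rewrite (piM a (a ** a))// (piM a a)// pia; lmod R[i].
have e2 : pi (k%:C *: ((l ^+ 2)%:C *: y - (2 * l)%:C *: (a ** y) + a ** (a ** y))) =
    k%:C *: ((l ^+ 2)%:C *: pi y - (2 * l)%:C *: (b ** pi y) + b ** (b ** pi y)).
  have -> : (l ^+ 2)%:C *: y - (2 * l)%:C *: (a ** y) + a ** (a ** y) =
      (l ^+ 2)%:C *: y + ((- (2 * l)%:C) *: (a ** y) + a ** (a ** y)) by lmod R[i].
  have S1 := SD (- (2 * l)%:C) _ _ Say Saay.
  rewrite piZ; last exact: SD.
  by rewrite !piD// (piM a (a ** y))// (piM a y)// pia; lmod R[i].
(* After multiplication by b, further factors b act as the scalar l: the right side gets the factor
   (l - l)^2 and the left becomes l (l - 1)^2 b. *)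
have := congr1 (smul b) (congr1 pi e); rewrite e1 e2.
have bbx x : b ** (b ** x) = l%:C *: (b ** x) by rewrite smulA bb smulZl.
rewrite !(smulDr, smulNr, smulZr, bbx, bb) => h.
have : (l * (l - 1) ^+ 2)%:C *: b = 0.
  have -> : (l * (l - 1) ^+ 2)%:C = l%:C * (l%:C - 1) ^+ 2 :> R[i].
    by rewrite rmorphM rmorphXn rmorphB rmorph1.
  have -> : (l%:C * (l%:C - 1) ^+ 2) *: b =
      l%:C *: (l%:C *: (l%:C *: b)) - 2 *: (l%:C *: (l%:C *: b)) + l%:C *: b by lmod R[i].
  rewrite h; have -> : (l ^+ 2)%:C = l%:C ^+ 2 :> R[i] by rewrite rmorphXn.
  have -> : (2 * l)%:C = 2 * l%:C :> R[i] by rewrite rmorphM rmorph_nat.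
  by lmod R[i].
have l0 : (l * (l - 1) ^+ 2)%:C != 0 :> R[i].
  rewrite -(rmorph0 (real_complex R)) (inj_eq (@complexI _)).
  by rewrite mulf_neq0 ?expf_neq0 ?subr_eq0 ?gt_eqF// (lt_trans ltr01).
move=> /eqP; rewrite scaler_eq0 (negbTE l0) /= => /eqP b0.
by apply: nr_eq0; apply/eqP; rewrite -sqrf_eq0 -nr_Mstar -/b b0 nr0.
Qed.

(** A gap of D at t is a gap of z on H5 at (2 t - 1)^2, because (2 D - 1)^2 - (2 t - 1)^2 = 4 (D + t
    - 1)(D - t) and D + t - 1 >= 1. As t < |D|, norm 2 t - 1 is admissible for universality. *)
Lemma canonical_no_gap (r t d : R) : universal_idempotent r Q -> 1 < t < nr D ->
  0 < d -> (forall x, d * nr x <= nr (D x - t%:C *: x)) -> False.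
Proof.
move=> [_ _ Qr univ] /andP[t1 tD] d0 Dt; have [ms mm mQ] := matched_projectionP QQ.
pose l := (2 * t - 1) ^+ 2; pose G : bop K K := F ** F - l%:C *: bid.
have zG (x : K) : (bid + w ** w) (val x) = val ((G + l%:C *: bid) x).
  by rewrite (central_H5 hQ hD) /G subrK.
have Ds := canonical_selfadj hD.
have Fs : selfadj F by rewrite /selfadj starD starN starZ star_bid Ds rmorph_nat.
have Gs : selfadj G by rewrite /selfadj starD starN starZ star_bid starM Fs conj_real.
have expand (y : K) : nr y <= nr ((D + (t - 1)%:C *: bid) y).
  have [y0|y0] := eqVneq (nr y) 0; first by rewrite y0 nr_ge0.
  rewrite -(@ler_pM2r _ (nr y)) ?lt_def ?y0 ?nr_ge0//.
  apply: le_trans (Re_inner_le _ _).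
  have := canonical_positive hD y.
  rewrite bopBE bopDE bopZE bidE innerBl innerDl innerZl inner_nr lecE => /andP[_].
  rewrite raddfB raddfD /= subr_ge0 mul0r subr0 -expr2 => /le_trans; apply.
  by rewrite lerDl mulr_ge0 ?sqr_ge0//; lra.
have Gd x : 4 * d * nr x <= nr (G x).
  have -> : G x = (4%:C *: (D + (t - 1)%:C *: bid)) (D x - t%:C *: x).
    by rewrite bopBE bopZE bidE -sqr_shift_factor.
  rewrite bopZE nrZr ger0_norm// -mulrA ler_wpM2l//.
  exact: le_trans (Dt x) (expand _).
have [k [y [Sy e]]] := cstar_gen_resolvent QQ mm mQ zG Gs (mulr_gt0 (ltr0n _ 4) d0) Gd.
have [u [g [u1 g1 ug]]] := canonical_orthonormal_pair.
have s1 : 1 < 2 * t - 1 by lra.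
have [p [hp ps pp]] := rank_one_idempotent s1 u1 g1 ug.
have pr : `|p| <= r%:C.
  rewrite -Qr -!nrE lecR; apply: le_trans ps _.
  by have := canonical_norm_lower hQ hD; lra.
have [pi pi_hom piQ] := univ _ _ hp pr.
have l1 : 1 < l by rewrite /l exprn_egt1.
have p0 := star_hom_resolvent_eq0 pi_hom piQ l1 Sy e pp.
by case: hp => _; apply; rewrite p0; split; rewrite ?star0// /idempotent_elt smul0l.
Qed.

(** The numerical range of D lies in [1, |D|]. For c outside, a rotation by i, -i, -1 or 1 gives the
    form of c - D a real part at least d |x|^2, so the normal operator c - D is invertible. *)
Lemma spectrum_canonical_sub (c : R[i]) : spectrum D c -> 1 <= c <= `|D|.
Proof.
move=> Dc; apply: contrapT => hc; apply: Dc.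
have Ds := canonical_selfadj hD.
suff [d d0 hd] : exists2 d : R, 0 < d & forall x, d * nr x <= nr ((c *: bid - D) x).
  apply: (normal_invertible (d := d)) => //.
  rewrite starD starN starZ star_bid Ds !(smulDl, smulDr, smulNl, smulNr, smulZl, smulZr).
  by rewrite !smul1l !smul1r; lmod R[i].
have Re_bd (x : K) : nr x ^+ 2 <= complex.Re (inner (D x) x) <= nr D * nr x ^+ 2.
  apply/andP; split.
    have := canonical_positive hD x; rewrite bopBE bidE innerBl inner_nr lecE => /andP[_].
    by rewrite raddfB /= subr_ge0.
  apply: le_trans (Re_inner_le _ _) _; rewrite expr2 mulrA ler_wpM2r ?nr_ge0//.
  exact: nr_bop.
have Im0 (x : K) : complex.Im (inner (D x) x) = 0.
  have := canonical_positive hD x; rewrite bopBE bidE innerBl inner_nr lecE => /andP[/eqP + _].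
  by rewrite raddfB /= subr0.
case: c hc => al be hc.
have bound (x : K) (k d : R) (v : R[i]) : cabs v = 1 ->
    d * nr x ^+ 2 <= complex.Re (v * inner (((al +i* be) *: bid - D) x) x) ->
    d * nr x <= nr (((al +i* be) *: bid - D) x).
  move=> v1 h; have [x0|x0] := eqVneq (nr x) 0; first by rewrite x0 mulr0 nr_ge0.
  rewrite -(@ler_pM2r _ (nr x)) ?lt_def ?x0 ?nr_ge0// -mulrA -expr2.
  apply: le_trans h _; rewrite -innerZl; apply: le_trans (Re_inner_le _ _) _.
  by rewrite -/(nr _) nrZ v1 mul1r.
have inE (x : K) : inner (((al +i* be) *: bid - D) x) x =
    (al * nr x ^+ 2 - complex.Re (inner (D x) x)) +i* (be * nr x ^+ 2).
  rewrite bopBE bopZE bidE innerBl innerZl inner_nr.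
  have := Im0 x; case: (inner (D x) x) => e f /= ->.
  by apply/eqP; rewrite eq_complex /= !(mulr0, subr0, addr0, add0r) !eqxx.
have [be0|be0|be0] := ltgtP be 0.
- exists (- be) => [|x]; first by rewrite oppr_gt0.
  apply: (bound x 0 _ 'i%C); first by rewrite normc_def /= expr0n expr1n add0r sqrtr1.
  by rewrite inE /= mul0r mul1r sub0r mulNr.
- exists be => // x; apply: (bound x 0 _ (- 'i%C)).
    by rewrite normrN normc_def /= expr0n expr1n add0r sqrtr1.
  by rewrite inE /= oppr0 mul0r mulN1r opprK add0r.
have [al1|al1] := ltP al 1.
  exists (1 - al) => [|x]; first by rewrite subr_gt0.
  apply: (bound x 0 _ (-1)); first by rewrite normrN1.
  rewrite mulN1r inE /=; have /andP[] := Re_bd x; lra.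
have [alD|alD] := ltP (nr D) al; last first.
  case: hc; rewrite be0 -nrE -(rmorph1 (real_complex R)).
  by rewrite !lecR al1 alD.
exists (al - nr D) => [|x]; first by rewrite subr_gt0.
apply: (bound x 0 _ 1); first by rewrite normr1.
rewrite mul1r inE /=; have /andP[] := Re_bd x; lra.
Qed.

Lemma full_spectrum_of_universal (r : R) : universal_idempotent r Q ->
  spectrum D = [set c : R[i] | 1 <= c <= `|D|].
Proof.
move=> univ; apply/seteqP; split => [c /spectrum_canonical_sub //|[t be] /= /andP[]].
rewrite -nrE -(rmorph1 (real_complex R)) !lecE /= => /andP[/eqP-> t1] /andP[_ tD].
move=> [S [ST _]]; have D1 := canonical_norm_gt1 hQ hD.
pose d := (nr S + 1)^-1; have S1 : 0 < nr S + 1 by rewrite ltr_wpDl ?nr_ge0.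
have d0 : 0 < d by rewrite invr_gt0.
have hd (x : K) : d * nr x <= nr (D x - t%:C *: x).
  rewrite ler_pdivrMl// nr_distC.
  have h : S ((t%:C *: bid - D) x) = x := congr1 (fun T : bop K K => T x) ST.
  rewrite -{1}h; apply: le_trans (nr_bop _ _) _; rewrite bopBE bopZE bidE.
  by rewrite ler_wpM2r ?nr_ge0// lerDl.
(* t may be an endpoint, where [canonical_no_gap] does not apply. Moving it towards the midpoint c
   by the fraction e lands strictly inside the interval and costs at most half of the bound d. *)
pose c := (1 + nr D) / 2; pose e := Order.min 2^-1 (d / (2 * nr D)).
have D0 : 0 < nr D by lra.
have e0 : 0 < e by rewrite lt_min invr_gt0 ltr0n divr_gt0// mulr_gt0.
have e1 : e <= 2^-1 by rewrite ge_min lexx.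
have eD : e * (2 * nr D) <= d by rewrite -ler_pdivlMr ?mulr_gt0// ge_min lexx orbT.
pose s := t + e * (c - t).
have s1 : 1 < s by rewrite /s /c; nra.
have sD : s < nr D by rewrite /s /c; nra.
have ts : `|s - t| <= d / 2.
  rewrite /s addrC addKr normrM (gtr0_norm e0).
  have : `|c - t| <= nr D by rewrite ler_norml /c; apply/andP; split; lra.
  by move=> h; have := ler_wpM2l (ltW e0) h; lra.
apply: (@canonical_no_gap r s (d / 2)) => //; first by rewrite s1 sD.
  by rewrite divr_gt0.
move=> x; have := nrD (D x - s%:C *: x) ((s - t)%:C *: x).
have -> : D x - s%:C *: x + (s - t)%:C *: x = D x - t%:C *: x.
  by rewrite rmorphB; lmod R[i].
rewrite nrZr; have := hd x; have := ler_wpM2r (nr_ge0 x) ts; lra.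
Qed.
End Universality.

(* In R[i], 1 <= z <= `|D| forces z to be real. *)
Theorem theorem3p13 (R : realType) (H : hilbertType R) (Q : bop H H) (r : R)
    (hQ : nonprojection_idempotent Q) (hr : `|Q| = r%:C)
    (D : bop (subsp (canon_H5 Q)) (subsp (canon_H5 Q)))
    (U : bop (subsp (canon_H5 Q)) (subsp (canon_H6 Q)))
    (hD : canonical_decomposition D U) :
  universal_idempotent r Q <->
  spectrum D = [set z : R[i] | 1 <= z <= `|D|].
Proof.
split; first exact: full_spectrum_of_universal hQ hD r.
exact: universal_of_full_spectrum hQ hD r hr.
Qed.
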